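(* Let $G$ be a locally compact abelian group, let $\omega$ be a weight on $G$, and let $(\Phi,\Psi)$ be a complementary pair of continuous strictly increasing Young functions. Suppose that there exists a nonzero continuous group homomorphism $\xi:G\to\mathbb{C}$ such that $\tilde\xi\in L^\infty(G)$, where $$\tilde\xi(s):=\frac{\xi(s)}{\omega(s)\,\omega(s^{-1})}\qquad(s\in G).$$ If $(L^\Phi_\omega(G),* )$ is a Banach algebra, then neither $L^\Phi_\omega(G)$ nor $\mathcal{S}^\Phi_\omega(G)$ is weakly amenable in any of the following cases: (i) $\tilde\Psi(x):=\Psi(\sqrt{x})$ is a Young function; (ii) $\tilde\Phi(x):=\Phi(\sqrt{x})$ is a Young function and $\tilde\xi\in L^{\tilde\Psi}(G)$, where (in this case) $\tilde\Psi$ denotes the complementary Young function of $\tilde\Phi$.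
   Context: $G$ carries a fixed Haar measure $ds$, and $\mathbb{C}$ is regarded as an additive group. Young functions: a nonzero function $\Phi:[0,\infty)\to[0,\infty]$ is a Young function if it is convex, $\Phi(0)=0$ and $\lim_{x\to\infty}\Phi(x)=\infty$. Its complementary function is $\Psi(y)=\sup\{xy-\Phi(x):x\ge 0\}$ ($y\ge0$), which is again a Young function whose complementary function is $\Phi$; $(\Phi,\Psi)$ is then called a complementary pair. Orlicz spaces: $L^\Phi(G)$ is the space of (classes of) measurable $f:G\to\mathbb{C}$ with $\int_G\Phi(\alpha|f(s)|)\,ds<\infty$ for some $\alpha>0$, with norm $\|f\|_\Phi=\sup\{\int_G|f(s)v(s)|\,ds:\int_G\Psi(|v(s)|)\,ds\le1\}$. $\mathcal{S}^\Phi(G)$ is the closure in $L^\Phi(G)$ of the linear space of all step functions in $L^\Phi(G)$. Weights: a weight on $G$ is a locally integrable measurable function $\omega:G\to(0,\infty)$ with $\omega(e)=1$, $1/\omega\in L^\infty(G)$, and such that for some $C>0$, $\omega(st)\le C\omega(s)\omega(t)$ for all $s,t\in G$. Weighted spaces: $L^\Phi_\omega(G)=\{f: f\omega\in L^\Phi(G)\}$ with norm $\|f\|_{\Phi,\omega}=\|f\omega\|_\Phi$, and $\mathcal{S}^\Phi_\omega(G)=\{f:f\omega\in\mathcal{S}^\Phi(G)\}$, a closed subspace. ''$(L^\Phi_\omega(G),* )$ is a Banach algebra'' means that it is a Banach algebra under convolution $*$, where multiplication is only required to be bounded ($\|f*g\|\le K\|f\|\|g\|$ for some constant $K$), not contractive.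 In that case $\mathcal{S}^\Phi_\omega(G)$ is a closed subalgebra. A Banach algebra $A$ is weakly amenable if every bounded derivation $D:A\to A^*$ is inner. *)

(* Defs.v *)
From HB Require Import structures.
From mathcomp Require Import all_boot all_order all_algebra.
From mathcomp Require Import all_classical all_reals all_analysis.
From mathcomp Require Import measurable_realfun complex.

Set Implicit Arguments.
Unset Strict Implicit.
Unset Printing Implicit Defensive.

Import Order.TTheory GRing.Theory Num.Theory.
Import numFieldNormedType.Exports.

Local Open Scope classical_set_scope.
Local Open Scope ring_scope.

(* [Num.Theory] shadows the projections of the type [R[i]] of complex numbers,
   and the norm [`|z|] of [z : R[i]] is itself an element of [R[i]]; [normc]
   is the modulus as an element of [R]. *)
Notation Re := complex.Re.
Notation Im := complex.Im.
Notation normc := ComplexField.Normc.normc.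

(* Measurable types must be pointed, which a [topologicalZmodType] is not
   canonically. *)
Definition pointed_group (G : topologicalZmodType) : Type := G.
HB.instance Definition _ (G : topologicalZmodType) :=
  TopologicalZmodule.on (pointed_group G).
HB.instance Definition _ (G : topologicalZmodType) :=
  isPointed.Build (pointed_group G) 0.

Definition borel (G : topologicalZmodType) :=
  g_sigma_algebraType (@open (pointed_group G)).

(* Only the values on [0, +oo[ of a Young function are meaningful. *)
Section Young.
Variable R : realType.
Implicit Types Phi Psi : R -> \bar R.
Local Open Scope ereal_scope.

Record young Phi : Prop := {
  young_ge0 : forall x, (0 <= x)%R -> 0 <= Phi x ;
  young_neq0 : exists2 x, (0 <= x)%R & Phi x != 0 ;
  young_convex : forall x y t, (0 <= x)%R -> (0 <= y)%R -> (0 <= t <= 1)%R ->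
    Phi (t * x + (1 - t) * y)%R <= t%:E * Phi x + (1 - t)%:E * Phi y ;
  young_0 : Phi 0%R = 0 ;
  young_cvgy : Phi x @[x --> +oo%R] --> +oo }.

Definition complementary Phi (y : R) : \bar R :=
  ereal_sup [set (x * y)%:E - Phi x | x in `[0%R, +oo[].

Definition complementary_pair Phi Psi : Prop :=
  [/\ young Phi, young Psi &
      forall y, (0 <= y)%R -> Psi y = complementary Phi y].

Definition increasing_on_nonneg Phi : Prop :=
  forall x y, (0 <= x)%R -> (x < y)%R -> Phi x < Phi y.

End Young.

Section ComplexFunctions.
Context d (T : measurableType d) (R : realType).
Variable mu : {measure set T -> \bar R}.
Implicit Types f g : T -> R[i].

Definition cmeasurable f : Prop :=
  measurable_fun [set: T] (fun s => Re (f s)) /\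
  measurable_fun [set: T] (fun s => Im (f s)).

Definition cintegrable f : Prop :=
  mu.-integrable [set: T] (fun s => (Re (f s))%:E) /\
  mu.-integrable [set: T] (fun s => (Im (f s))%:E).

Definition cintegral f : R[i] :=
  (Rintegral mu [set: T] (fun s => Re (f s)) +i*
   Rintegral mu [set: T] (fun s => Im (f s)))%C.

Definition cLinfty f : Prop :=
  cmeasurable f /\ (fun s => normc (f s)) \in Lfun mu +oo%E.

Definition step f : Prop := cmeasurable f /\ finite_set (range f).

End ComplexFunctions.

(* The vector space [L0 mu] of measurable functions [T -> R[i]] modulo equality
   almost everywhere. *)
Section MeasurableFunctions.
Context d (T : measurableType d) (R : realType).

Definition cmfun : {pred T -> R[i]} := mem [set f | cmeasurable f].

Lemma ReD (x y : R[i]) : Re (x + y) = Re x + Re y.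
Proof. by case: x y => [? ?] []. Qed.

Lemma ImD (x y : R[i]) : Im (x + y) = Im x + Im y.
Proof. by case: x y => [? ?] []. Qed.

Lemma ReM (x y : R[i]) : Re (x * y) = Re x * Re y - Im x * Im y.
Proof. by case: x y => [? ?] []. Qed.

Lemma ImM (x y : R[i]) : Im (x * y) = Re x * Im y + Im x * Re y.
Proof. by case: x y => [? ?] []. Qed.

Lemma cmfun_submod_closed : submod_closed cmfun.
Proof.
split; first by rewrite inE; split; exact: measurable_cst.
move=> a f g; rewrite !inE => -[f1 f2] [g1 g2]; split.
- rewrite (_ : (fun _ => _) = fun s =>
    Re a * Re (f s) - Im a * Im (f s) + Re (g s)); last first.
    by apply/funext => s; rewrite ReD ReM.
  apply: measurable_funD => //; apply: measurable_funB;
    exact: measurable_funM.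
- rewrite (_ : (fun _ => _) = fun s =>
    Re a * Im (f s) + Im a * Re (f s) + Im (g s)); last first.
    by apply/funext => s; rewrite ImD ImM.
  apply: measurable_funD => //; apply: measurable_funD;
    exact: measurable_funM.
Qed.

HB.instance Definition _ :=
  GRing.isSubmodClosed.Build _ _ cmfun cmfun_submod_closed.

Record cMeasurableFun := CMeasurableFun {
  cmfun_fun :> T -> R[i] ;
  cmfunP : cmfun_fun \in cmfun }.

HB.instance Definition _ := [isSub for cmfun_fun].
HB.instance Definition _ := [Choice of cMeasurableFun by <:].
HB.instance Definition _ := [SubChoice_isSubLmodule of cMeasurableFun by <:].

Variable mu : {measure set T -> \bar R}.

Definition cnull : {pred cMeasurableFun} :=
  mem [set f : cMeasurableFun | {ae mu, forall s, f s = 0}].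

Lemma cnull_zmod_closed : zmod_closed cnull.
Proof.
split; first by rewrite inE; apply/nearW.
move=> f g; rewrite !inE => f0 g0; rewrite /mkset.
by apply: filterS2 f0 g0 => s /= fs gs; rewrite /= !fctE fs gs subr0.
Qed.

HB.instance Definition _ :=
  GRing.isZmodClosed.Build _ cnull cnull_zmod_closed.

Definition L0 : Type := Quotient.quot cnull.

HB.instance Definition _ := Choice.on L0.
HB.instance Definition _ := EqQuotient.on L0.
HB.instance Definition _ := GRing.Zmodule.on L0.

Local Open Scope quotient_scope.

Definition L0_fun (f : L0) : T -> R[i] := repr f : cMeasurableFun.

Lemma L0_piP (f g : cMeasurableFun) :
  \pi_L0 f = \pi_L0 g <-> {ae mu, forall s, f s = g s}.
Proof.
have -> : {ae mu, forall s, f s = g s} <-> f - g \in cnull.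
  rewrite inE; split; rewrite /mkset; apply: filterS => s /=; rewrite !fctE.
    by move=> ->; rewrite subrr.
  by move/eqP; rewrite subr_eq0 => /eqP.
split=> [/eqP|]; first by rewrite eqmodE.
by move=> fg; apply/eqP; rewrite eqmodE.
Qed.

Lemma L0_funK (f : cMeasurableFun) :
  {ae mu, forall s, L0_fun (\pi_L0 f) s = f s}.
Proof. by apply/L0_piP; rewrite reprK. Qed.

Definition L0_scale (a : R[i]) (f : L0) : L0 :=
  \pi_L0 (a *: (repr f : cMeasurableFun)).

Lemma L0_scale_pi a (f : cMeasurableFun) :
  L0_scale a (\pi_L0 f) = \pi_L0 (a *: f).
Proof.
apply/L0_piP; have := L0_funK f; apply: filterS => s.
by rewrite /L0_fun /= !fctE => ->.
Qed.

Lemma L0_piD (f g : cMeasurableFun) : \pi_L0 (f + g) = \pi_L0 f + \pi_L0 g.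
Proof. by rewrite !piE. Qed.

Lemma L0_scaleA a b f : L0_scale a (L0_scale b f) = L0_scale (a * b) f.
Proof.
by elim/quotW: f => f; rewrite (L0_scale_pi b) !L0_scale_pi scalerA.
Qed.

Lemma L0_scale1 : left_id 1 L0_scale.
Proof. by elim/quotW => f; rewrite L0_scale_pi scale1r. Qed.

Lemma L0_scaleDr : right_distributive L0_scale +%R.
Proof.
move=> a; elim/quotW => f; elim/quotW => g.
by rewrite -L0_piD !L0_scale_pi scalerDr L0_piD.
Qed.

Lemma L0_scaleDl f : {morph L0_scale^~ f : a b / a + b}.
Proof.
by move=> a b; elim/quotW: f => f; rewrite !L0_scale_pi scalerDl L0_piD.
Qed.

HB.instance Definition _ := GRing.Zmodule_isLmodule.Build R[i] L0
  L0_scaleA L0_scale1 L0_scaleDr L0_scaleDl.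

End MeasurableFunctions.

Coercion L0_fun : L0 >-> Funclass.

Section Orlicz.
Context d (T : measurableType d) (R : realType).
Variables (mu : {measure set T -> \bar R}) (Phi : R -> \bar R).
Implicit Types f g v : T -> R[i].
Local Open Scope ereal_scope.

Definition orlicz f : Prop := cmeasurable f /\
  exists2 a : R, (0 < a)%R & \int[mu]_s Phi (a * normc (f s))%R < +oo.

Definition orlicz_norm f : \bar R :=
  ereal_sup [set \int[mu]_s (normc (f s * v s)%R)%:E | v in
    [set v | cmeasurable v /\
             \int[mu]_s complementary Phi (normc (v s)) <= 1]].

(* Membership in S^Phi, the closure in L^Phi of the step functions of L^Phi. *)
Definition orlicz_step f : Prop := orlicz f /\
  forall e : R, (0 < e)%R ->
    exists g, [/\ step g, orlicz g & orlicz_norm (f \- g)%R < e%:E].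

Variable omega : T -> R.

Definition weighted f : T -> R[i] := fun s => ((omega s)%:C%C * f s)%R.

Definition weighted_orlicz : set (L0 mu) := [set f | orlicz (weighted f)].

Definition weighted_orlicz_step : set (L0 mu) :=
  [set f | orlicz_step (weighted f)].

Definition weighted_orlicz_norm (f : L0 mu) : R :=
  fine (orlicz_norm (weighted f)).

End Orlicz.

Arguments weighted_orlicz {d T R} mu Phi omega.
Arguments weighted_orlicz_step {d T R} mu Phi omega.
Arguments weighted_orlicz_norm {d T R} mu Phi omega f.

(* The algebra is a subset [A] of a vector space [V]; the norm, the product,
   functionals and derivations are functions on [V] of which only the values on
   [A] matter. *)
Section BanachAlgebra.
Variables (R : realType) (V : lmodType R[i]).
Variables (A : set V) (N : V -> R) (mul : V -> V -> V).

Record banach_algebra : Prop := {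
  ba_0 : A 0 ;
  ba_linear : forall (c : R[i]) x y, A x -> A y -> A (c *: x + y) ;
  ba_norm_eq0 : forall x, A x -> N x = 0 -> x = 0 ;
  ba_normZ : forall (c : R[i]) x, A x -> N (c *: x) = normc c * N x ;
  ba_normD : forall x y, A x -> A y -> N (x + y) <= N x + N y ;
  ba_complete : forall u : nat -> V, (forall n, A (u n)) ->
    (forall e, 0 < e -> exists n0, forall m n, (n0 <= m)%N -> (n0 <= n)%N ->
      N (u m - u n) < e) ->
    exists2 l, A l & N (u n - l) @[n --> \oo] --> (0 : R) ;
  ba_mul : forall x y, A x -> A y -> A (mul x y) ;
  ba_mulA : forall x y z, A x -> A y -> A z ->
    mul x (mul y z) = mul (mul x y) z ;
  ba_mul_linearl : forall (c : R[i]) x y z, A x -> A y -> A z ->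
    mul (c *: x + y) z = c *: mul x z + mul y z ;
  ba_mul_linearr : forall (c : R[i]) x y z, A x -> A y -> A z ->
    mul z (c *: x + y) = c *: mul z x + mul z y ;
  ba_mul_bounded : exists K : R, forall x y, A x -> A y ->
    N (mul x y) <= K * (N x * N y) }.

Record dual (phi : V -> R[i]) : Prop := {
  dual_linear : forall (c : R[i]) x y, A x -> A y ->
    phi (c *: x + y) = c * phi x + phi y ;
  dual_bounded : exists K : R, forall x, A x -> normc (phi x) <= K * N x }.

(* [D a] is the functional [D] maps [a] to, so that [der_bounded] says
   [||D a|| <= K ||a||]. The module actions of [A] on its dual are
   [(a.phi)(x) = phi (x a)] and [(phi.a)(x) = phi (a x)]. *)
Record bounded_derivation (D : V -> V -> R[i]) : Prop := {
  der_dual : forall a, A a -> dual (D a) ;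
  der_linear : forall (c : R[i]) a b x, A a -> A b -> A x ->
    D (c *: a + b) x = c * D a x + D b x ;
  der_bounded : exists K : R, forall a x, A a -> A x ->
    normc (D a x) <= K * N a * N x ;
  der_leibniz : forall a b x, A a -> A b -> A x ->
    D (mul a b) x = D b (mul x a) + D a (mul b x) }.

Definition inner (D : V -> V -> R[i]) : Prop :=
  exists2 phi, dual phi &
    forall a x, A a -> A x -> D a x = phi (mul x a) - phi (mul a x).

Definition weakly_amenable : Prop :=
  forall D, bounded_derivation D -> inner D.

End BanachAlgebra.

Section Group.
Variables (R : realType) (G : topologicalZmodType).
Variable mu : {measure set (borel G) -> \bar R}.
Local Open Scope ereal_scope.

Record haar_measure : Prop := {
  haar_neq0 : mu [set: G] != 0 ;
  haar_invariant : forall (a : G) (B : set (borel G)), measurable B ->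
    mu [set (a + s)%R | s in (B : set G)] = mu B ;
  haar_compact : forall K : set G, compact K -> mu K < +oo ;
  haar_outer : forall B : set (borel G), measurable B ->
    mu B = ereal_inf [set mu U | U in [set U : set G | open U /\ B `<=` U]] ;
  haar_inner : forall U : set G, open U ->
    mu U = ereal_sup [set mu K | K in [set K : set G | compact K /\ K `<=` U]]
  }.

Record weight (omega : G -> R) : Prop := {
  weight_gt0 : forall s, (0 < omega s)%R ;
  weight_measurable : measurable_fun [set: borel G] (omega : borel G -> R) ;
  weight_loc_integrable : forall K : set G, compact K ->
    \int[mu]_(s in (K : set (borel G))) (omega s)%:E < +oo ;
  weight_0 : omega 0%R = 1%R ;
  weight_inv : (fun s : borel G => (omega s)^-1)%R \in Lfun mu +oo ;
  weight_submul : exists2 C : R, (0 < C)%R &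
    forall s t, (omega (s + t) <= C * (omega s * omega t))%R }.

(* This includes the absolute convergence, for almost every [s], of the integral
   that defines the convolution of [f] and [g] at [s]. *)
Definition is_convolution (f g h : L0 mu) : Prop :=
  {ae mu, forall s : borel G,
    let F (t : borel G) := (f t * g ((s : G) - (t : G)))%R in
    cintegrable mu F /\ h s = cintegral mu F}.

(* The junk value 0 is taken when the convolution does not exist. *)
Definition convolution (f g : L0 mu) : L0 mu :=
  xget 0%R [set h | is_convolution f g h].

Variables (Phi : R -> \bar R) (omega : G -> R).

Definition LPhi_weighted : set (L0 mu) :=
  weighted_orlicz mu Phi (omega : borel G -> R).

Definition SPhi_weighted : set (L0 mu) :=
  weighted_orlicz_step mu Phi (omega : borel G -> R).

Definition norm_Phi_weighted : L0 mu -> R :=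
  weighted_orlicz_norm mu Phi (omega : borel G -> R).

Definition LPhi_is_banach_algebra : Prop :=
  (forall f g, LPhi_weighted f -> LPhi_weighted g ->
    is_convolution f g (convolution f g)) /\
  banach_algebra LPhi_weighted norm_Phi_weighted convolution.

Definition xi_tilde (xi : G -> R[i]) : borel G -> R[i] :=
  fun s => (xi s / (omega s * omega (- (s : G)))%:C%C)%R.

End Group.

Arguments convolution {R G} mu f g.
Arguments LPhi_weighted {R G} mu Phi omega.
Arguments SPhi_weighted {R G} mu Phi omega.
Arguments norm_Phi_weighted {R G} mu Phi omega f.
Arguments LPhi_is_banach_algebra {R G} mu Phi omega.

(* Main.v *)
Require Import Defs.
From HB Require Import structures.
From mathcomp Require Import all_boot all_order all_algebra.
From mathcomp Require Import all_classical all_reals all_analysis.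
From mathcomp Require Import measurable_realfun complex.
From mathcomp Require Import ring lra.
From mathcomp Require ess_sup_inf.
Import Order.TTheory GRing.Theory Num.Theory.
Import numFieldNormedType.Exports.
Local Open Scope classical_set_scope.
Local Open Scope ring_scope.

(** If [D] is inner, with functional [phi], then
    [D a a = phi (a a) - phi (a a) = 0]. So it is enough to find a bounded
    derivation [D] and an element [a] with [D a a <> 0]; the same [D] and [a]
    serve for both spaces, because [a] is taken in the smaller one.

    Choose [t0] with [xi t0 <> 0], an open set [O] of finite measure that
    contains [t0 + t0], and put [kappa s = 1_O(s) / (1 + omega (- s))]. Then
    [D a x] is the integral of [kappa (t + s) xi(t) a(t) x(s)] over [t] and [s],
    that is the pairing of [kappa] with the convolution of [xi a] and [x]. Since
    [xi (t + s) = xi t + xi s], multiplication by [xi] is a derivation for the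
    convolution, and the group is commutative, so [D] satisfies the Leibniz rule
    ([cbilin_leibniz]).

    Boundedness: [omega (- t) <= C omega(s) omega (- (t + s))] bounds [|D a x|]
    by [C] times the integral of [1_O(t + s) |xi_tilde(t)| f(t) g(s)], where
    [f = |a| omega] and [g = |x| omega] are in [L^Phi] ([kernel_bound]). If
    [Psi (sqrt x)] is a Young function, then [Psi y <= y^2 Psi 1] for [y <= 1],
    and testing [f] against a small multiple of [min(f, 1)] bounds the integral
    of [f min(f, 1)] on the unit ball; as [xi_tilde] is bounded, the double
    integral is then estimated pointwise ([ebilin_bound_min]). If [xi_tilde] is
    in the Orlicz space of the complementary function [W] of [Phi (sqrt x)], the
    inequality [x^2 z <= W(z) + Phi x] bounds the integral of [|xi_tilde| f^2],
    and the same inequality averaged over the translates of [O] bounds the part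
    with [g^2] ([ebilin_bound_square]).

    The Leibniz rule also needs triple integrals to converge absolutely. These
    are double integrals for [a] and the convolution of [|b|] and [|x|], which
    is in [L^Phi] because [L^Phi] is an algebra
    ([eform_positive_convolution], [ebilin_triple_fin]).

    Nonvanishing: [a = 1_U / omega] for a neighbourhood [U] of [t0] on which
    [conj (xi t0) xi] has positive real part; then [conj (xi t0) D a a] has
    positive real part, as nonempty open sets have positive Haar measure
    ([cbilin_nonzero]).

    The order of integration is exchanged for Borel functions on [G x G], where
    the Borel sets need not be generated by rectangles and the Haar measure need
    not be sigma-finite. Inner regularity on open sets gives Tonelli's theorem
    for finite measures ([tonelli_borel]), and it extends to functions supported
    in [S x S] where [S] is a countable union of open sets of finite measure
    ([tonelli_sigma]); the functions of [L^Phi] vanish outside such sets. *)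

Set Implicit Arguments.
Unset Strict Implicit.
Unset Printing Implicit Defensive.

Local Notation Re := complex.Re.
Local Notation Im := complex.Im.
Local Notation normc0 := ComplexField.Normc.normc0.
Local Notation supported S a := (forall s, ~ S s -> a s = 0%R).

(** * Borel sets of the product group *)

Lemma continuous_measurable_open (X Y : ptopologicalType) (f : X -> Y) :
  continuous f -> measurable_fun setT
    (f : g_sigma_algebraType (@open X) -> g_sigma_algebraType (@open Y)).
Proof.
move=> cf; apply: (@measurability _ _ (g_sigma_algebraType (@open X))
  (g_sigma_algebraType (@open Y)) setT f (@open Y)) => //.
move=> _ [B oB <-]; rewrite setTI; apply: sub_sigma_algebra.
exact: open_comp.
Qed.

Definition pointed_group2 (G : topologicalZmodType) : Type := (G * G)%type.
HB.instance Definition _ (G : topologicalZmodType) :=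
  Topological.copy (pointed_group2 G) (G * G)%type.
HB.instance Definition _ (G : topologicalZmodType) :=
  isPointed.Build (pointed_group2 G) (0, 0).

Section ProductBorel.
Variable G : topologicalZmodType.
Local Notation PG := (pointed_group G).
Local Notation PG2 := (pointed_group2 G).

(** When [G] is not second countable, the product of two copies of the Borel
    sigma-algebra can be strictly smaller than the Borel sigma-algebra of the
    product, and addition need not be measurable for it. *)
Definition borel2 := g_sigma_algebraType (@open PG2).

Lemma measurable_open (U : set G) : open U -> measurable (U : set (borel G)).
Proof. by move=> oU; apply: sub_sigma_algebra. Qed.

Lemma measurable_open2 (W : set (G * G)) : open W -> measurable (W : set borel2).
Proof. by move=> oU; apply: sub_sigma_algebra. Qed.

Lemma measurable_closed (U : set G) : closed U -> measurable (U : set (borel G)).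
Proof.
move=> cU; rewrite -(setCK U); apply: measurableC; apply: measurable_open.
by rewrite openC.
Qed.

Lemma continuous_borel (f : G -> G) : continuous f ->
  measurable_fun setT (f : borel G -> borel G).
Proof. exact: (@continuous_measurable_open PG PG). Qed.

Lemma continuous_borel21 (f : G * G -> G) : continuous f ->
  measurable_fun setT (f : borel2 -> borel G).
Proof. exact: (@continuous_measurable_open PG2 PG). Qed.

Lemma continuous_borel12 (f : G -> G * G) : continuous f ->
  measurable_fun setT (f : borel G -> borel2).
Proof. exact: (@continuous_measurable_open PG PG2). Qed.

Lemma measurable_swap2 :
  measurable_fun setT ((fun p => (p.2, p.1)) : borel2 -> borel2).
Proof.
apply: (@continuous_measurable_open PG2 PG2) => p.
by apply: cvg_pair => /=; [exact: cvg_snd | exact: cvg_fst].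
Qed.

Lemma measurable_pair1 (x : G) :
  measurable_fun setT ((fun y : G => (x, y)) : borel G -> borel2).
Proof.
apply: continuous_borel12 => y.
by apply: cvg_pair => //=; exact: cvg_cst.
Qed.

Lemma measurable_pair2 (y : G) :
  measurable_fun setT ((fun x : G => (x, y)) : borel G -> borel2).
Proof.
apply: continuous_borel12 => x.
by apply: cvg_pair => //=; exact: cvg_cst.
Qed.

Lemma measurable_xsection2 (B : set borel2) (x : borel G) :
  measurable B -> measurable (xsection B x : set (borel G)).
Proof. by move=> mB; rewrite xsectionE -[_ @^-1` _]setTI; exact: measurable_pair1. Qed.

Lemma measurable_ysection2 (B : set borel2) (y : borel G) :
  measurable B -> measurable (ysection B y : set (borel G)).
Proof. by move=> mB; rewrite ysectionE -[_ @^-1` _]setTI; exact: measurable_pair2. Qed.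

Lemma measurable_fst2 : measurable_fun setT (fst : borel2 -> borel G).
Proof. by apply: continuous_borel21 => p; exact: cvg_fst. Qed.

Lemma measurable_snd2 : measurable_fun setT (snd : borel2 -> borel G).
Proof. by apply: continuous_borel21 => p; exact: cvg_snd. Qed.

Lemma measurable_add2 :
  measurable_fun setT ((fun p => p.1 + p.2) : borel2 -> borel G).
Proof. by apply: continuous_borel21; exact: add_continuous. Qed.

Lemma measurable_sub2 :
  measurable_fun setT ((fun p => p.1 - p.2) : borel2 -> borel G).
Proof. by apply: continuous_borel21; exact: sub_continuous. Qed.

Lemma measurable_opp : measurable_fun setT (-%R : borel G -> borel G).
Proof. by apply: continuous_borel; exact: opp_continuous. Qed.

Lemma measurable_addl (a : G) :
  measurable_fun setT ((fun x => a + x) : borel G -> borel G).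
Proof.
exact: (measurableT_comp measurable_add2 (measurable_pair1 a)).
Qed.

Lemma measurable_sub1 (t : G) :
  measurable_fun setT ((fun x => t - x) : borel G -> borel G).
Proof. exact: (measurableT_comp measurable_sub2 (measurable_pair1 t)). Qed.

End ProductBorel.

(** * Exhaustion of open sets by rectangles *)

Section Layer.
Context {R : realType}.

(** Slicing [h] into layers of height [e] approximates it from above, and in
    [layer_le] from below, up to one layer; an integral becomes a finite sum of
    measures of the sets [k * e < h], which are open when [h] is lower
    semicontinuous. *)
Lemma layer_ge (e h : R) N : 0 <= e -> 0 <= h ->
  Num.min h (N%:R * e) <= \sum_(k < N) e * ((k%:R * e < h)%R)%:R.
Proof.
move=> e0 h0; elim: N => [|N IH]; first by rewrite big_ord0 mul0r ge_min lexx orbT.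
rewrite big_ord_recr /=; have [hN|hN] := ltP (N%:R * e) h.
- move: IH; rewrite min_r ?(ltW hN)// => IH.
  rewrite ge_min; apply/orP; right.
  by rewrite -natr1 mulrDl mul1r mulr1n mulr1 lerD2r.
- move: IH; rewrite min_l// => IH.
  by rewrite mulr0n mulr0 addr0 ge_min IH.
Qed.

Lemma layer_le (e g : R) N : 0 <= e -> 0 <= g ->
  \sum_(k < N) e * ((k.+1%:R * e < g)%R)%:R <= Num.min g (N%:R * e).
Proof.
move=> e0 g0; elim: N => [|N IH]; first by rewrite big_ord0 mul0r le_min lexx g0.
rewrite big_ord_recr /=; move: IH; rewrite le_min => /andP[IHg IHN].
have [hN|hN] := ltP (N.+1%:R * e) g.
- by rewrite mulr1n mulr1 -natr1 mulrDl mul1r lerD2r.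
- by rewrite mulr0n mulr0 addr0.
Qed.

End Layer.

Section OpenRectangles.
Variable G : topologicalZmodType.

Inductive open_rectangles : set (G * G) -> Prop :=
| rect0 : open_rectangles set0
| rectU U V (W : set (G * G)) : open U -> open V -> open_rectangles W ->
    open_rectangles ((U `*` V) `|` W).

Lemma open_rectanglesU W W' : open_rectangles W -> open_rectangles W' ->
  open_rectangles (W `|` W').
Proof.
elim=> [|U V {}W oU oV rW IH rW']; first by rewrite set0U.
by rewrite -setUA; apply: rectU => //; exact: IH.
Qed.

Lemma open_rectangles1 (U V : set G) : open U -> open V ->
  open_rectangles (U `*` V).
Proof. by move=> oU oV; rewrite -(setU0 (_ `*` _)); apply: rectU => //; exact: rect0. Qed.

Lemma open_rectangles_prod W : open_rectangles W ->
  measurable (W : set (borel G * borel G)).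
Proof.
elim=> [//|U V {}W oU oV _ IH]; apply: measurableU => //.
by apply: measurableX; exact: measurable_open.
Qed.

Lemma open_rectangles_open W : open_rectangles W -> open W.
Proof.
elim=> [|U V {}W oU oV _ IH]; first exact: open0.
apply: openU => //; rewrite openE => -[x y] [/= Ux Vy].
exists (U, V) => //=; split; exact: open_nbhs_nbhs.
Qed.

(** The finite unions of open rectangles inside [W], directed by inclusion. As a
    filter, this directed family can be used with [compact_near_coveringP]. *)
Definition exhaustion (W : set (G * G)) : set_system (set (G * G)) :=
  [set A | exists R0, [/\ open_rectangles R0, R0 `<=` W &
    forall R, open_rectangles R -> R `<=` W -> R0 `<=` R -> A R]].

Lemma exhaustion_filter W : ProperFilter (exhaustion W).
Proof.
apply: Build_ProperFilter_ex.
  by move=> A [R0 [r0 RW]] /(_ R0 r0 RW) AR; exists R0; exact: AR.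
split.
- by exists set0; split => //; exact: rect0.
- move=> A B [RA [rA RAW AP]] [RB [rB RBW BP]]; exists (RA `|` RB); split.
  + exact: open_rectanglesU.
  + by rewrite subUset.
  + by move=> R rR RW; rewrite subUset => -[sA sB]; split; [exact: AP|exact: BP].
- move=> A B AB [R0 [r0 RW AP]]; exists R0; split=> // R rR RWs sR.
  by apply: AB; exact: AP.
Qed.

Lemma exhaustion_in W : \forall R \near exhaustion W,
  open_rectangles R /\ R `<=` W.
Proof. by exists set0; split => //; exact: rect0. Qed.

(** Tube lemma, by compactness of [K]: each point of [K] lies in an open
    rectangle inside [W], and finitely many of them suffice. *)
Lemma exhaustion_compact_section W (x : G) (K : set G) : open W -> compact K ->
  K `<=` xsection W x ->
  \forall x' \near nbhs x & R \near exhaustion W, K `<=` xsection R x'.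
Proof.
move=> oW /compact_near_coveringP cK KW.
have FW := exhaustion_filter W.
apply: (cK _ (filter_prod (nbhs x) (exhaustion W))
  (fun p y => xsection p.2 p.1 y)) => y /KW; rewrite /xsection/= inE => Wxy.
have : nbhs (x, y) W by exact: open_nbhs_nbhs.
case=> -[A B] /= [nA nB] AB.
exists (interior B, [set p | interior A p.1 /\ p.2 (p.1, y) /\ interior A `*` interior B `<=` p.2]).
  split => /=; first exact: nbhs_interior.
  exists (interior A, [set R | interior A `*` interior B `<=` R]) => /=.
    split; first exact: nbhs_interior.
    exists (interior A `*` interior B); split=> //.
      by apply: open_rectangles1; exact: open_interior.
    move=> [a b] [/= /interior_subset Aa /interior_subset Bb]; exact: (AB (a, b)).
  move=> [x' R] [/= Ax' RAB]; split => //; split => //.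
  by apply: RAB; split => //=; exact: nbhs_singleton (nbhs_interior nB).
by move=> [y' [x' R]] [/= By' [Ax' [_ RAB]]]; rewrite inE; exact: RAB.
Qed.

End OpenRectangles.

(** * Tonelli theorem for finite measures *)

Definition inner_regular (R : realType) (G : topologicalZmodType)
    (mu : {measure set (borel G) -> \bar R}) := forall U : set G, open U ->
  mu U = ereal_sup [set mu K | K in [set K : set G | compact K /\ K `<=` U]].

Definition translation_invariant (R : realType) (G : topologicalZmodType)
    (mu : {measure set (borel G) -> \bar R}) :=
  forall (a : G) (B : set (borel G)), measurable B ->
    mu [set a + s | s in (B : set G)] = mu B.

Lemma open_nbhsP (T : topologicalType) (A : set T) :
  (forall x, A x -> nbhs x A) -> open A.
Proof. by rewrite openE. Qed.

Section TonelliFinite.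
Context {R : realType} {G : topologicalZmodType}.
Hypothesis HG : hausdorff_space G.
Variable nu : {finite_measure set (borel G) -> \bar R}.
Hypothesis inner_nu : inner_regular nu.
Local Open Scope ereal_scope.

Lemma compact_borel (K : set G) : compact K -> measurable (K : set (borel G)).
Proof. by move=> cK; apply: measurable_closed; exact: compact_closed. Qed.

Lemma inner_compact (U : set G) (e : R) : open U -> (0 < e)%R ->
  exists K : set G, [/\ compact K, K `<=` U & nu U <= nu K + e%:E].
Proof.
move=> oU e0.
have fU : nu U \is a fin_num by apply: fin_num_measure; exact: measurable_open.
have := @ub_ereal_sup_adherent _ [set nu K | K in [set K : set G | compact K /\ K `<=` U]] e e0.
rewrite -inner_nu// => /(_ fU)[_ [K [cK KU] <-]] hK.
by exists K; split => //; rewrite -leeBlDr// ltW.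
Qed.

(** Inner regularity replaces the section by a compact subset, to which the tube
    lemma applies. *)
Lemma exhaustion_section (W : set (G * G)) (x : G) (r : R) : open W ->
  r%:E < nu (xsection W x) ->
  \forall x' \near nbhs x & S \near exhaustion W, r%:E < nu (xsection S x').
Proof.
move=> oW rW.
have oWx : open (xsection W x : set G).
  rewrite xsectionE; apply: open_nbhsP => y /= Wxy.
  have : nbhs (x, y) W by exact: open_nbhs_nbhs.
  case=> -[A B] /= [nA nB] AB; apply: filterS nB => z Bz.
  by apply: (AB (x, z)); split => //=; exact: nbhs_singleton.
have [K [cK KW rK]] : exists K : set G, [/\ compact K, K `<=` xsection W x &
    r%:E < nu K].
  move: rW; rewrite (inner_nu oWx) => /ereal_sup_gt[_ [K [cK KW] <-] rK].
  by exists K; split.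
have FW := exhaustion_filter W.
have h1 := exhaustion_compact_section oW cK KW.
have h2 : \forall x' \near nbhs x & S \near exhaustion W, open_rectangles S.
  exists (setT, [set S | open_rectangles S /\ S `<=` W]) => /=.
    by split; [exact: filterT|exact: exhaustion_in].
  by move=> [x' S] [_ []].
apply: filterS2 h1 h2 => -[x' S] /= KS rS.
apply: (lt_le_trans rK); apply: le_measure => //; rewrite inE.
- exact: compact_borel.
- by apply: measurable_xsection2; apply: measurable_open2; exact: open_rectangles_open.
Qed.

Lemma xsection_lsc (W : set (G * G)) (r : R) : open W ->
  open [set x : G | r%:E < nu (xsection W x)].
Proof.
move=> oW; apply: open_nbhsP => x /= /(exhaustion_section oW).
have FW := exhaustion_filter W.
case=> -[A B] /= [nA nB] AB.
apply: filterS nA => x' Ax'.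
have [S [[rS SW] BS]] := filter_ex (filterI (exhaustion_in W) nB).
apply: (lt_le_trans (AB (x', S) _)) => //=.
apply: le_measure; rewrite ?inE//; last exact: le_xsection.
- by apply: measurable_xsection2; apply: measurable_open2; exact: open_rectangles_open.
- by apply: measurable_xsection2; apply: measurable_open2.
Qed.

Lemma measurable_lsc (f : G -> \bar R) :
  (forall r : R, open [set x | r%:E < f x]) ->
  measurable_fun setT (f : borel G -> \bar R).
Proof.
move=> of_; apply: (@measurability _ _ (borel G) _ setT f _ (ErealGenOInfty.measurableE R)) => //.
move=> _ [_ [r ->] <-]; rewrite setTI; apply: measurable_open.
rewrite [X in open X](_ : _ = [set x | r%:E < f x])//.
by apply/seteqP; split=> x /=; rewrite in_itv/= andbT.
Qed.

Lemma measurable_xsection_open (W : set (G * G)) : open W ->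
  measurable_fun setT ((fun x => nu (xsection W x)) : borel G -> \bar R).
Proof. by move=> oW; apply: measurable_lsc => r; exact: xsection_lsc. Qed.

Lemma integral_sum_indic N (e : R) (A : 'I_N -> set (borel G)) : (0 <= e)%R ->
  (forall k, measurable (A k)) ->
  \int[nu]_x (\sum_(k < N) e * \1_(A k) x)%:E = \sum_(k < N) e%:E * nu (A k).
Proof.
move=> e0 mA.
under eq_integral do rewrite -sumEFin.
rewrite ge0_integral_sum//.
- apply: eq_bigr => k _.
  under eq_integral do rewrite EFinM.
  rewrite ge0_integralZl//; first by rewrite integral_indic// setIT.
  by apply/measurable_EFinP; exact: measurable_indic.
- move=> k; apply/measurable_EFinP; apply: measurable_funM => //.
- by move=> k x _; rewrite lee_fin mulr_ge0.
Qed.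

(** Finitely many layers of [x |-> nu (xsection W x)] suffice; each is open by
    [xsection_lsc], hence almost exhausted by a compact set, and on these
    finitely many compact sets one finite union of rectangles has large enough
    sections. *)
Lemma exhaustion_integral (W : set (G * G)) (eps : R) : open W -> (0 < eps)%R ->
  exists S, [/\ open_rectangles S, S `<=` W &
    \int[nu]_x nu (xsection W x) <= \int[nu]_x nu (xsection S x) + eps%:E].
Proof.
move=> oW eps0.
have fnu (A : set (borel G)) : measurable A -> nu A \is a fin_num.
  by move=> mA; exact: fin_num_measure.
pose c := fine (nu setT).
have cE : nu setT = c%:E by rewrite fineK// fnu.
have c0 : (0 <= c)%R by rewrite fine_ge0.
have nuc (A : set (borel G)) : measurable A -> nu A <= c%:E.
  by move=> mA; rewrite -cE le_measure// inE.
(* [N.+1] layers of height [e] reach above [c]. The error consists of one layer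
   on the whole space, at most [e * c], and of [e] in each of the [N] compact
   approximations, each of them weighted by [e]. *)
have [N HN] : exists N : nat, ((c + 1) * (2 * c + 1) / N.+1%:R <= eps)%R.
  exists (Num.truncn ((c + 1) * (2 * c + 1) / eps)).
  by rewrite ler_pdivrMr// [leRHS]mulrC -ler_pdivrMr// ltW// truncnS_gt.
pose e := ((c + 1) / N.+1%:R)%R.
have e0 : (0 < e)%R by rewrite divr_gt0// ltr_pwDr.
have eN : (N.+1%:R * e = c + 1)%R by rewrite /e mulrCA divff ?mulr1// pnatr_eq0.
have eeps : (e * (2 * c + 1) <= eps)%R by rewrite /e mulrAC.
clearbody e.
pose Om k := [set x : G | (k%:R * e)%:E < nu (xsection W x)].
have oOm k : open (Om k) by exact: xsection_lsc.
have mOm k : measurable (Om k : set (borel G)) by exact: measurable_open.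
have [C HC] := choice (fun k => inner_compact (oOm k.+1) e0).
have mC k : measurable (C k : set (borel G)).
  by apply: compact_borel => //; case: (HC k).
have FW := exhaustion_filter W.
have hS : \forall S \near exhaustion W, forall k : 'I_N,
    C k `<=` [set x | (k.+1%:R * e)%:E < nu (xsection S x)].
  apply: filter_forall => k.
  have [/compact_near_coveringP cC CO _] := HC k.
  apply: cC => x /CO; exact: exhaustion_section.
have [S [[rS SW] CS]] := filter_ex (filterI (exhaustion_in W) hS).
exists S; split => //.
have mWx x : measurable (xsection W x : set (borel G)).
  by apply: measurable_xsection2; exact: measurable_open2.
have mSx x : measurable (xsection S x : set (borel G)).
  apply: measurable_xsection2; apply: measurable_open2.
  exact: open_rectangles_open.
have step1 : \int[nu]_x nu (xsection W x) <= \sum_(k < N.+1) e%:E * nu (Om k).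
  rewrite -integral_sum_indic//; last exact: ltW.
  apply: ge0_le_integral => //.
  - exact: measurable_xsection_open.
  - apply/measurable_EFinP; apply: measurable_sum => k.
    by apply: measurable_funM => //; exact: measurable_indic.
  - move=> x _; rewrite -[leLHS]fineK ?fnu// lee_fin.
    have h0 : (0 <= fine (nu (xsection W x)))%R by rewrite fine_ge0.
    have := @layer_ge _ e _ N.+1 (ltW e0) h0.
    rewrite min_l; last first.
      by rewrite eN -lee_fin fineK ?fnu// (le_trans (nuc _ _))// lee_fin lerDl.
    move=> /le_trans; apply; apply: ler_sum => k _.
    rewrite ler_wpM2l ?(ltW e0)// indicE.
    case: ltP => // kh; rewrite mem_set//= /Om/=.
    by rewrite -[ltRHS]fineK ?fnu.
have step2 : \sum_(k < N) e%:E * nu (C k) <= \int[nu]_x nu (xsection S x).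
  rewrite -integral_sum_indic//; last exact: ltW.
  apply: ge0_le_integral => //.
  - by move=> x _; rewrite lee_fin sumr_ge0// => k _; rewrite mulr_ge0 ?(ltW e0).
  - apply/measurable_EFinP; apply: measurable_sum => k.
    by apply: measurable_funM => //; exact: measurable_indic.
  - by apply: measurable_xsection_open => //; exact: open_rectangles_open.
  - move=> x _; rewrite -[leRHS]fineK ?fnu// lee_fin.
    have h0 : (0 <= fine (nu (xsection S x)))%R by rewrite fine_ge0.
    have := @layer_le _ e _ N (ltW e0) h0.
    rewrite le_min => /andP[+ _]; apply: le_trans; apply: ler_sum => k _.
    rewrite ler_wpM2l ?(ltW e0)// indicE.
    have [xC|] := boolP (x \in C k) => //=.
    move: xC; rewrite inE => /CS /=; rewrite -[ltRHS]fineK ?fnu// lte_fin.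
    by move=> ->.
apply: (le_trans step1); rewrite big_ord_recl.
apply: (@le_trans _ _ (e%:E * c%:E + \sum_(k < N) (e%:E * nu (C k) + (e * e)%:E))).
  apply: leeD; first by rewrite lee_pmul2l//; exact: nuc.
  apply: lee_sum => k _; rewrite EFinM -ge0_muleDr//; last by rewrite lee_fin ltW.
  by rewrite lee_pmul2l//; case: (HC k).
rewrite big_split/= addeCA; apply: leeD => //.
rewrite sumEFin -EFinM -EFinD lee_fin sumr_const card_ord.
apply: le_trans eeps; rewrite -[X in (_ + X)%R]mulr_natl mulrA.
have : (N%:R * e <= c + 1)%R by rewrite -eN ler_wpM2r ?(ltW e0)// ler_nat.
move=> H; have := ler_wpM2r (ltW e0) H; lra.
Qed.

Let fnu (A : set (borel G)) : measurable A -> nu A \is a fin_num.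
Proof. by move=> mA; exact: fin_num_measure. Qed.

Let nuC (A : set (borel G)) : measurable A -> nu (~` A) = nu setT - nu A.
Proof. by move=> mA; rewrite -setTD measureD ?setTI// -ge0_fin_numE// fnu. Qed.

Definition swap_set (W : set (G * G)) := [set p | W (p.2, p.1)].

Lemma open_swap_set W : open W -> open (swap_set W).
Proof.
move=> oW; apply: (@open_comp _ _ (fun p : G * G => (p.2, p.1))) => // p _.
by apply: cvg_pair => /=; [exact: cvg_snd | exact: cvg_fst].
Qed.

Lemma ysection_swap W (y : G) : ysection W y = xsection (swap_set W) y.
Proof. by apply/seteqP; split=> x; rewrite /xsection /ysection /= !inE. Qed.

Lemma xsection_swap W (x : G) : xsection W x = ysection (swap_set W) x.
Proof. by apply/seteqP; split=> y; rewrite /xsection /ysection /= !inE. Qed.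

Lemma measurable_ysection_open (W : set (G * G)) : open W ->
  measurable_fun setT ((fun y => nu (ysection W y)) : borel G -> \bar R).
Proof.
move=> oW; under [X in measurable_fun _ X]eq_fun do rewrite ysection_swap.
by apply: measurable_xsection_open => //; exact: open_swap_set.
Qed.

(** Finite unions of rectangles belong to the product sigma-algebra, where
    Tonelli's theorem is available. *)
Lemma tonelli_open_le (W : set (G * G)) : open W ->
  \int[nu]_x nu (xsection W x) <= \int[nu]_y nu (ysection W y).
Proof.
move=> oW; apply/lee_addgt0Pr => e e0.
have [S [rS SW /le_trans]] := exhaustion_integral oW e0; apply.
rewrite leeD2r//.
have -> : \int[nu]_x nu (xsection S x) = \int[nu]_y nu (ysection S y).
  have mS := open_rectangles_prod rS.
  have := indic_fubini_tonelli nu nu mS.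
  by rewrite indic_fubini_tonelli_FE// indic_fubini_tonelli_GE.
have oS := open_rectangles_open rS.
apply: ge0_le_integral => //.
- exact: measurable_ysection_open.
- exact: measurable_ysection_open.
- move=> y _; apply: le_measure; rewrite ?inE.
  + by apply: measurable_ysection2; exact: measurable_open2.
  + by apply: measurable_ysection2; exact: measurable_open2.
  + exact: le_ysection.
Qed.

Lemma tonelli_open (W : set (G * G)) : open W ->
  \int[nu]_x nu (xsection W x) = \int[nu]_y nu (ysection W y).
Proof.
move=> oW; apply/eqP; rewrite eq_le tonelli_open_le//=.
have := tonelli_open_le (open_swap_set oW).
under eq_integral do rewrite -ysection_swap.
by move=> /le_trans; apply; under eq_integral do rewrite -xsection_swap.
Qed.

Definition tonelli_set (B : set (@borel2 G)) :=
  [/\ measurable_fun setT ((fun x => nu (xsection B x)) : borel G -> \bar R),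
    measurable_fun setT ((fun y => nu (ysection B y)) : borel G -> \bar R) &
    \int[nu]_x nu (xsection B x) = \int[nu]_y nu (ysection B y)].

(** Open sets are stable under intersection and generate the Borel sets, so that
    Dynkin's lemma applies; complements use that [nu] is finite. *)
Lemma tonelli_borel (B : set (@borel2 G)) : measurable B -> tonelli_set B.
Proof.
have gopen W : open W -> tonelli_set W.
  move=> oW; split; [exact: measurable_xsection_open|
    exact: measurable_ysection_open|exact: tonelli_open].
move: B; apply: (@dynkin_induction _ (@borel2 G) (@open (pointed_group2 G)) tonelli_set) => //.
- by move=> A B; exact: openI.
- by apply: gopen; exact: openT.
- move=> S mS [m1 m2 E].
  have mx x := measurable_xsection2 x mS; have my y := measurable_ysection2 y mS.
  have cx x : nu (xsection (~` S) x) = nu setT - nu (xsection S x).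
    by rewrite -nuC// !xsectionE preimage_setC.
  have cy y : nu (ysection (~` S) y) = nu setT - nu (ysection S y).
    by rewrite -nuC// !ysectionE preimage_setC.
  split.
  + by under [X in measurable_fun _ X]eq_fun do rewrite cx; exact: emeasurable_funB.
  + by under [X in measurable_fun _ X]eq_fun do rewrite cy; exact: emeasurable_funB.
  + under eq_integral do rewrite cx.
    under [RHS]eq_integral do rewrite cy.
    have icst : nu.-integrable setT (fun=> nu setT).
      apply/integrableP; split => //.
      rewrite integral_cst// gee0_abs// -ge0_fin_numE ?mule_ge0//.
      by rewrite fin_numM ?fnu.
    have bd (F : borel G -> set (borel G)) : measurable_fun setT (nu \o F) ->
        (forall x, measurable (F x)) -> nu.-integrable setT (nu \o F).
      move=> mf mF; apply: le_integrable icst => // x _.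
      by rewrite !gee0_abs// le_measure// inE.
    by rewrite !integralB ?E//; exact: bd.
- move=> F mF tF gF.
  have cx x : nu (xsection (\bigcup_k F k) x) = \sum_(k <oo) nu (xsection (F k) x).
    rewrite xsection_bigcup; apply/esym/cvg_lim => //.
    apply: measure_sigma_additive; last exact: trivIset_xsection.
    by move=> k; exact: measurable_xsection2.
  have cy x : nu (ysection (\bigcup_k F k) x) = \sum_(k <oo) nu (ysection (F k) x).
    rewrite ysection_bigcup; apply/esym/cvg_lim => //.
    apply: measure_sigma_additive; last exact: trivIset_ysection.
    by move=> k; exact: measurable_ysection2.
  split.
  + under [X in measurable_fun _ X]eq_fun do rewrite cx.
    by apply: ge0_emeasurable_sum => [k x _ _|k _]; [exact: measure_ge0 | case: (gF k)].
  + under [X in measurable_fun _ X]eq_fun do rewrite cy.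
    by apply: ge0_emeasurable_sum => [k x _ _|k _]; [exact: measure_ge0 | case: (gF k)].
  + under eq_integral do rewrite cx.
    under [RHS]eq_integral do rewrite cy.
    rewrite !integral_nneseries//; try by move=> k; case: (gF k).
    by apply: eq_eseriesr => k _; case: (gF k).
Qed.

End TonelliFinite.

Lemma ge0_cvg_integral d (T : measurableType d) (R : realType)
    (mu : {measure set T -> \bar R}) (g : (T -> \bar R)^nat) (f : T -> \bar R) :
  (forall n, measurable_fun setT (g n)) -> (forall n x, (0 <= g n x)%E) ->
  (forall x, nondecreasing_seq (g ^~ x)) -> (forall x, g ^~ x @ \oo --> f x) ->
  (\int[mu]_x g n x)%E @[n --> \oo] --> (\int[mu]_x f x)%E.
Proof.
move=> mg g0 ndg gf.
have -> : f = fun x => limn (g ^~ x).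
  by apply/funext => x; apply/esym/cvg_lim => //; exact: gf.
by apply: cvg_monotone_convergence => // x _; exact: ndg.
Qed.

(** Used for the restriction [nu] of [mu] to a set that carries [f]. *)
Lemma integral_mrestr_support d (T : measurableType d) (R : realType)
    (mu : {measure set T -> \bar R}) (D : set T) (mD : measurable D)
    (nu : {measure set T -> \bar R}) (f : T -> \bar R) :
  (forall A, measurable A -> A `<=` D -> nu A = mu A) ->
  (forall x, ~ D x -> f x = 0%E) ->
  (\int[nu]_x f x = \int[mu]_x f x)%E.
Proof.
move=> numu f0; have fD : f \_ D = f.
  by apply/funext => x; rewrite patchE; case: ifPn => // /negP; rewrite inE => /f0.
rewrite -[in LHS]fD -[in RHS]fD -!integral_mkcond.
by apply: eq_measure_integral => A mA AD; exact: numu.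
Qed.

Section Tonelli.
Context {R : realType} {G : topologicalZmodType}.
Local Open Scope ereal_scope.
Implicit Types (mu : {measure set (borel G) -> \bar R}) (F : G -> G -> \bar R).

Definition measurable2 d (T : measurableType d) (F : G -> G -> T) :=
  measurable_fun setT ((fun p => F p.1 p.2) : @borel2 G -> T).

Lemma measurable2_section1 d (T : measurableType d) (F : G -> G -> T) x :
  measurable2 F -> measurable_fun setT (F x : borel G -> T).
Proof. by move=> mF; exact: (measurableT_comp mF (@measurable_pair1 G x)). Qed.

Lemma measurable2_section2 d (T : measurableType d) (F : G -> G -> T) y :
  measurable2 F -> measurable_fun setT ((fun x => F x y) : borel G -> T).
Proof. by move=> mF; exact: (measurableT_comp mF (@measurable_pair2 G y)). Qed.

Definition tonelli mu F :=
  [/\ measurable_fun setT ((fun x => \int[mu]_y F x y) : borel G -> \bar R),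
    measurable_fun setT ((fun y => \int[mu]_x F x y) : borel G -> \bar R) &
    \int[mu]_x \int[mu]_y F x y = \int[mu]_y \int[mu]_x F x y].

Lemma tonelli_cvg mu (g : (G -> G -> \bar R)^nat) F :
  (forall n, measurable2 (g n)) -> (forall n x y, 0 <= g n x y) ->
  (forall x y, nondecreasing_seq (fun n => g n x y)) ->
  (forall x y, g n x y @[n --> \oo] --> F x y) ->
  (forall n, tonelli mu (g n)) -> tonelli mu F.
Proof.
move=> mg g0 ndg gF tg.
have cx (x : G) : \int[mu]_y g n x y @[n --> \oo] --> \int[mu]_y F x y.
  by apply: ge0_cvg_integral => // n; exact: measurable2_section1.
have cy (y : G) : \int[mu]_x g n x y @[n --> \oo] --> \int[mu]_x F x y.
  by apply: ge0_cvg_integral => // n; exact: measurable2_section2.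
split.
- apply: (@emeasurable_fun_cvg _ (borel G) _ setT
    (fun n x => \int[mu]_y g n x y)) => //.
  by move=> n; case: (tg n).
- apply: (@emeasurable_fun_cvg _ (borel G) _ setT
    (fun n y => \int[mu]_x g n x y)) => //.
  by move=> n; case: (tg n).
- have c1 : \int[mu]_x \int[mu]_y g n x y @[n --> \oo] -->
      \int[mu]_x \int[mu]_y F x y.
    apply: ge0_cvg_integral => //.
    + by move=> n; case: (tg n).
    + by move=> n x; exact: integral_ge0.
    + move=> x m n mn; apply: ge0_le_integral => //; try exact: measurable2_section1.
      by move=> y _; exact: ndg.
  have c2 : \int[mu]_y \int[mu]_x g n x y @[n --> \oo] -->
      \int[mu]_y \int[mu]_x F x y.
    apply: ge0_cvg_integral => //.
    + by move=> n; case: (tg n).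
    + by move=> n y; exact: integral_ge0.
    + move=> y m n mn; apply: ge0_le_integral => //; try exact: measurable2_section2.
      by move=> x _; exact: ndg.
  apply: (cvg_unique _ c1) => //.
  rewrite (_ : (fun n => _) = (fun n => \int[mu]_y \int[mu]_x g n x y))//.
  by apply/funext => n; case: (tg n).
Qed.

Import HBNNSimple.

Lemma tonelli_nnsfun (nu : {finite_measure set (borel G) -> \bar R})
    (f : {nnsfun (@borel2 G) >-> R}) :
  hausdorff_space G ->
  inner_regular nu ->
  tonelli nu (fun x y => (f (x, y))%:E).
Proof.
move=> HG inner_nu.
pose A k := f @^-1` [set k].
have mA k : measurable (A k) by exact: measurable_sfunP.
have fE p : (f p)%:E = \sum_(k \in range f) k%:E * (\1_(A k) p)%:E.
  by rewrite fsumEFin //= fimfunE.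
have sectionE (phi : borel G -> @borel2 G) : measurable_fun setT phi ->
    \int[nu]_y (f (phi y))%:E = \sum_(k \in range f) k%:E * nu (phi @^-1` A k).
  move=> mphi; have mi k : measurable_fun setT (fun y => (\1_(A k) (phi y))%:E : \bar R).
    apply/measurable_EFinP.
    by apply: (measurableT_comp (f := (\1_(A k) : @borel2 G -> R)) _ mphi); exact: measurable_indic.
  under eq_integral do rewrite fE.
  rewrite ge0_integral_fsum //; last 2 first.
  - by move=> k; exact: measurable_funeM.
  - by move=> r y _; rewrite nnfun_muleindic_ge0.
  apply: eq_fsbigr => k; rewrite inE => -[/= t _ <-].
  rewrite ge0_integralZl// ?lee_fin ?fun_ge0//.
  rewrite -[in RHS](setIT (_ @^-1` _)) -integral_indic//.
  by rewrite -[X in measurable X]setTI; exact: mphi.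
have E1 x : \int[nu]_y (f (x, y))%:E =
    \sum_(k \in range f) k%:E * nu (xsection (A k) x).
  under [RHS]eq_fsbigr do rewrite xsectionE.
  exact: (sectionE _ (@measurable_pair1 G x)).
have E2 y : \int[nu]_x (f (x, y))%:E =
    \sum_(k \in range f) k%:E * nu (ysection (A k) y).
  under [RHS]eq_fsbigr do rewrite ysectionE.
  exact: (sectionE _ (@measurable_pair2 G y)).
have T k := tonelli_borel HG inner_nu (mA k).
have pos k x : 0 <= k%:E * nu (xsection (A k) x).
  have [k0|k0] := leP 0%R k; first by rewrite mule_ge0.
  by rewrite /A preimage_nnfun0// xsection0 measure0 mule0.
have pos' k y : 0 <= k%:E * nu (ysection (A k) y).
  have [k0|k0] := leP 0%R k; first by rewrite mule_ge0.
  by rewrite /A preimage_nnfun0// ysection0 measure0 mule0.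
have fin : finite_set (range f) by exact: fimfunP.
split.
- under [X in measurable_fun _ X]eq_fun do rewrite E1.
  apply: emeasurable_fsum => // k; apply: measurable_funeM.
  by case: (T k).
- under [X in measurable_fun _ X]eq_fun do rewrite E2.
  apply: emeasurable_fsum => // k; apply: measurable_funeM.
  by case: (T k).
- under eq_integral do rewrite E1.
  under [RHS]eq_integral do rewrite E2.
  rewrite ge0_integral_fsum//; last first.
    by move=> k; apply: measurable_funeM; case: (T k).
  rewrite [RHS]ge0_integral_fsum//; last first.
    by move=> k; apply: measurable_funeM; case: (T k).
  apply: eq_fsbigr => k; rewrite inE => -[/= t _ <-].
  have [m1 m2 E] := T (f t).
  by rewrite !ge0_integralZl// ?lee_fin ?fun_ge0// E.
Qed.

Lemma tonelli_fin (nu : {finite_measure set (borel G) -> \bar R}) F :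
  hausdorff_space G ->
  inner_regular nu ->
  measurable2 F -> (forall x y, 0 <= F x y) -> tonelli nu F.
Proof.
move=> HG inner_nu mF F0.
pose g := nnsfun_approx measurableT mF.
apply: (@tonelli_cvg nu (fun n x y => (g n (x, y))%:E)).
- move=> n; apply/measurable_EFinP.
  have -> // : (fun p : @borel2 G => g n (p.1, p.2)) = g n by apply/funext => -[].
- move=> n x y; rewrite lee_fin. exact: fun_ge0.
- move=> x y m n mn; rewrite lee_fin.
  by have /lefP/(_ (x, y)) := nd_nnsfun_approx measurableT mF mn.
- move=> x y; apply: (@cvg_nnsfun_approx _ _ _ _ measurableT _ mF _ (x, y)) => //.
- by move=> n; exact: tonelli_nnsfun.
Qed.

End Tonelli.

(** * Tonelli theorem on countable unions of open sets of finite measure *)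

Section TonelliSigma.
Context {R : realType} {G : topologicalZmodType}.
Hypothesis HG : hausdorff_space G.
Variable mu : {measure set (borel G) -> \bar R}.
Local Open Scope ereal_scope.
Hypothesis inner_mu : inner_regular mu.
Implicit Types (F : G -> G -> \bar R) (S : set G).

(** The Haar measure is not sigma-finite in general; such sets carry every
    function of an Orlicz space (see [sigma_open_support]) and the kernels. *)
Definition sigma_open S := exists S_ : nat -> set G,
  [/\ forall n, open (S_ n), forall n, mu (S_ n) < +oo,
   nondecreasing_seq S_ & S = \bigcup_n S_ n].

Lemma sigma_openP (U_ : nat -> set G) :
  (forall n, open (U_ n)) -> (forall n, mu (U_ n) < +oo) ->
  sigma_open (\bigcup_n U_ n).
Proof.
move=> oU fU; exists (fun n => \big[setU/set0]_(i < n.+1) U_ i); split.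
- by move=> n; apply: big_ind => [|A B|i _]; [exact: open0|exact: openU|].
- move=> n; elim: n.+1 => [|m IH]; first by rewrite big_ord0 measure0.
  rewrite big_ord_recr/=; apply: le_lt_trans (measureU2 _ _ _) _.
  + apply: measurable_open; apply: big_ind => [|A B|i _]; [exact: open0|exact: openU|by []].
  + exact: measurable_open.
  + by apply: lte_add_pinfty; [exact: IH|exact: fU].
- by move=> m n mn; apply/subsetPset; exact: subset_bigsetU.
- apply/seteqP; split => x [n _ Ux].
  + by exists n => //; rewrite big_ord_recr/=; right.
  + by move: Ux; rewrite -bigcup_mkord => -[i _ ?]; exists i.
Qed.

Lemma sigma_openU S S' : sigma_open S -> sigma_open S' -> sigma_open (S `|` S').
Proof.
move=> [S_ [oS fS _ ->]] [T_ [oT fT _ ->]].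
rewrite -bigcupU.
apply: sigma_openP.
- by move=> n; exact: openU.
- move=> n; apply: le_lt_trans (measureU2 _ _ _) _; try exact: measurable_open.
  by apply: lte_add_pinfty; [exact: fS|exact: fT].
Qed.

Lemma sigma_open_open (S : set G) : open S -> mu S < +oo -> sigma_open S.
Proof.
move=> oS fS; rewrite -(@bigcup_const _ _ [set: nat] S); last by exists 0%N.
exact: sigma_openP.
Qed.

Lemma inner_mfrestr (D : set G) (oD : open D) (fD : mu D < +oo) (U : set G) :
  open U -> let nu := mfrestr (measurable_open oD) fD in
  nu U = ereal_sup [set nu K | K in [set K : set G | compact K /\ K `<=` U]].
Proof.
move=> oU nu; apply/eqP; rewrite eq_le; apply/andP; split.
- rewrite {1}/nu /mfrestr /mrestr inner_mu; last exact: openI.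
  apply: ge_ereal_sup => _ [K [cK KUD] <-].
  have -> : mu K = nu K.
    by rewrite /nu /mfrestr /mrestr setIidl// => x /KUD[].
  apply: ereal_sup_ubound; exists K => //; split => // x /KUD[]//.
- apply: ge_ereal_sup => _ [K [cK KU] <-].
  apply: le_measure => //; rewrite inE; first exact: compact_borel.
  exact: measurable_open.
Qed.

Lemma measurable2_indic S S' : open S -> open S' ->
  @measurable2 G _ R (fun x y => \1_S x * \1_S' y)%R.
Proof.
move=> oS oS'; apply: measurable_funM.
- apply: (measurableT_comp (f := (\1_S : borel G -> R)) _ (@measurable_fst2 G)).
  by apply: measurable_indic; exact: measurable_open.
- apply: (measurableT_comp (f := (\1_S' : borel G -> R)) _ (@measurable_snd2 G)).
  by apply: measurable_indic; exact: measurable_open.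
Qed.

Lemma tonelli_finite_open (D : set G) F : open D -> mu D < +oo ->
  measurable2 F -> (forall x y, 0 <= F x y) ->
  (forall x y, ~ D y -> F x y = 0) ->
  measurable_fun setT ((fun x => \int[mu]_y F x y) : borel G -> \bar R) /\
  ((forall x y, ~ D x -> F x y = 0) -> tonelli mu F).
Proof.
move=> oD fD mF F0 FD.
pose nu := mfrestr (measurable_open oD) fD.
have [m1 m2 E] := tonelli_fin (nu := nu) HG (inner_mfrestr oD fD) mF F0.
have nuE (A : set (borel G)) : measurable A -> A `<=` (D : set (borel G)) -> nu A = mu A.
  by move=> mA AD; rewrite /nu /= /mfrestr /mrestr setIidl.
have mD := measurable_open oD.
have E1 x : \int[nu]_y F x y = \int[mu]_y F x y.
  by apply: (integral_mrestr_support mD nuE) => y; exact: FD.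
under eq_fun do rewrite -E1.
split => // FD'.
have E2 y : \int[nu]_x F x y = \int[mu]_x F x y.
  by apply: (integral_mrestr_support mD nuE) => x; exact: FD'.
split.
- by under eq_fun do rewrite -E1.
- by under eq_fun do rewrite -E2.
- under eq_integral do rewrite -E1.
  under [RHS]eq_integral do rewrite -E2.
  rewrite -(integral_mrestr_support mD nuE).
    rewrite E; apply: (integral_mrestr_support mD nuE).
    by move=> y Dy; apply: integral0_eq => x _; exact: FD.
  by move=> x Dx; apply: integral0_eq => y _; exact: FD'.
Qed.

(** The first variable is unrestricted, because a convolution of functions
    supported in [S] need not be supported in [S]. *)
Lemma measurable_integral_sigma S F : sigma_open S ->
  measurable2 F -> (forall x y, 0 <= F x y) ->
  (forall x y, ~ S y -> F x y = 0) ->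
  measurable_fun setT ((fun x => \int[mu]_y F x y) : borel G -> \bar R).
Proof.
move=> [S_ [oS fS ndS SE]] mF F0 FS.
pose g n x y := F x y * (\1_(S_ n) y)%:E.
have mg n : measurable2 (g n).
  apply: emeasurable_funM => //; apply/measurable_EFinP.
  apply: (measurableT_comp (f := (\1_(S_ n) : borel G -> R)) _ (@measurable_snd2 G)).
  by apply: measurable_indic; exact: measurable_open.
have g0 n x y : 0 <= g n x y by rewrite mule_ge0.
apply: (@emeasurable_fun_cvg _ (borel G) _ setT (fun n x => \int[mu]_y g n x y)).
  move=> n; apply: (tonelli_finite_open (oS n) (fS n) (mg n) (g0 n) _).1 => x y Sy.
  by rewrite /g indicE memNset// mule0.
move=> x _; apply: ge0_cvg_integral.
- by move=> n; exact: measurable2_section1.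
- by move=> n y.
- move=> y m n mn; rewrite lee_wpmul2l// lee_fin !indicE.
  have [/set_mem ySm|] := boolP (y \in S_ m); last by [].
  by rewrite mem_set//; move: y ySm; exact/subsetPset/ndS.
- move=> y; have [Sy|Sy] := pselect (S y); last first.
    rewrite FS//; under eq_fun do rewrite /g FS// mul0e; exact: cvg_cst.
  move: Sy; rewrite SE => -[N _ SNy].
  apply: cvg_near_cst; exists N => // n /= Nn.
  rewrite /g indicE mem_set ?mule1//.
  by move: y SNy; exact/subsetPset/ndS.
Qed.

Lemma tonelli_sigma S F : sigma_open S ->
  measurable2 F -> (forall x y, 0 <= F x y) ->
  (forall x y, ~ (S x /\ S y) -> F x y = 0) -> tonelli mu F.
Proof.
move=> [S_ [oS fS ndS SE]] mF F0 FS.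
pose g n x y := F x y * (\1_(S_ n) x * \1_(S_ n) y)%:E.
have mg n : measurable2 (g n).
  by apply: emeasurable_funM => //; apply/measurable_EFinP; exact: measurable2_indic.
have g0 n x y : 0 <= g n x y by rewrite mule_ge0// lee_fin mulr_ge0.
apply: (tonelli_cvg mg g0).
- move=> x y m n mn; rewrite lee_wpmul2l// lee_fin !indicE.
  have sub z : S_ m z -> S_ n z by move: z; exact/subsetPset/ndS.
  have [/set_mem/sub Sx|] := boolP (x \in S_ m); last by rewrite mul0r mulr_ge0.
  have [/set_mem/sub Sy|] := boolP (y \in S_ m); last by rewrite mulr0 mulr_ge0.
  by rewrite !mem_set.
- move=> x y; have [[Sx Sy]|Sxy] := pselect (S x /\ S y); last first.
    rewrite FS//; under eq_fun do rewrite /g FS// mul0e; exact: cvg_cst.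
  move: Sx Sy; rewrite SE => -[N _ SNx] [M _ SMy].
  apply: cvg_near_cst; exists (maxn N M) => // n /=; rewrite geq_max => /andP[Nn Mn].
  rewrite /g !indicE !mem_set ?mulr1 ?mule1//.
  + by move: y SMy; exact/subsetPset/ndS.
  + by move: x SNx; exact/subsetPset/ndS.
- move=> n; apply: (tonelli_finite_open (oS n) (fS n) (mg n) (g0 n) _).2 => x y Sy.
  + by rewrite /g !indicE (memNset Sy) mulr0 mule0.
  + by rewrite /g !indicE (memNset Sy) mul0r mule0.
Qed.

End TonelliSigma.

(** * Complex integrals *)

Section Modulus.
Context {R : rcfType}.
Implicit Types x y z : R[i].

Lemma normc_ge0 z : 0 <= normc z.
Proof. by case: z => a b /=; exact: sqrtr_ge0. Qed.

Lemma normcMr x y : normc (x * y) = normc x * normc y.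
Proof. exact: ComplexField.Normc.normcM. Qed.

Lemma normc_add x y : normc (x + y) <= normc x + normc y.
Proof. exact: (@le_normcD R x y). Qed.

Lemma normc_real (a : R) : normc (a%:C)%C = `|a|.
Proof. by rewrite /= expr0n /= addr0 sqrtr_sqr. Qed.

Lemma Re_le_normc z : `|Re z| <= normc z.
Proof.
by case: z => a b /=; rewrite -sqrtr_sqr ler_wsqrtr// lerDl sqr_ge0.
Qed.

Lemma Im_le_normc z : `|Im z| <= normc z.
Proof.
by case: z => a b /=; rewrite -sqrtr_sqr ler_wsqrtr// lerDr sqr_ge0.
Qed.

Lemma normc_le z : normc z <= `|Re z| + `|Im z|.
Proof.
case: z => a b /=; have h : 0 <= `|a| + `|b| by rewrite addr_ge0.
rewrite -[leRHS]ger0_norm// -[leRHS]sqrtr_sqr ler_wsqrtr// sqrrD !real_normK ?num_real//.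
by rewrite -addrA (addrC (_ *+ 2)) addrA lerDl mulrn_wge0// mulr_ge0.
Qed.

End Modulus.

Section ComplexIntegral.
Context d (T : measurableType d) (R : realType).
Variable mu : {measure set T -> \bar R}.
Implicit Types f g : T -> R[i].

Lemma cmeasurable_normc f : cmeasurable f ->
  measurable_fun setT (fun s => normc (f s)).
Proof.
move=> [mr mi].
have -> : (fun s => normc (f s)) =
    (fun s => Num.sqrt (Re (f s) ^+ 2 + Im (f s) ^+ 2)).
  by apply/funext => s; case: (f s).
apply: (measurableT_comp (f := Num.sqrt : R -> R)).
  by apply: continuous_measurable_fun; exact: sqrt_continuous.
by apply: measurable_funD; exact: measurable_funX.
Qed.

Lemma cmeasurableM f g : cmeasurable f -> cmeasurable g ->
  cmeasurable (fun s => f s * g s).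
Proof.
move=> [mr mi] [mr' mi']; split.
- rewrite (_ : (fun s => _) = fun s => Re (f s) * Re (g s) - Im (f s) * Im (g s)).
    by apply: measurable_funB; exact: measurable_funM.
  by apply/funext => s; rewrite Defs.ReM.
- rewrite (_ : (fun s => _) = fun s => Re (f s) * Im (g s) + Im (f s) * Re (g s)).
    by apply: measurable_funD; exact: measurable_funM.
  by apply/funext => s; rewrite Defs.ImM.
Qed.

Lemma cmeasurableD f g : cmeasurable f -> cmeasurable g ->
  cmeasurable (fun s => f s + g s).
Proof.
move=> [mr mi] [mr' mi']; split.
- rewrite (_ : (fun s => _) = fun s => Re (f s) + Re (g s)).
    exact: measurable_funD.
  by apply/funext => s; rewrite Defs.ReD.
- rewrite (_ : (fun s => _) = fun s => Im (f s) + Im (g s)).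
    exact: measurable_funD.
  by apply/funext => s; rewrite Defs.ImD.
Qed.

Lemma cmeasurable_cst (c : R[i]) : cmeasurable (fun _ : T => c).
Proof. by split; exact: measurable_cst. Qed.

Lemma cmeasurable_real (h : T -> R) : measurable_fun setT h ->
  cmeasurable (fun s => (h s)%:C%C).
Proof. by move=> mh; split => //=; exact: measurable_cst. Qed.

Lemma cmeasurable_comp d' (T' : measurableType d') (phi : T' -> T) f :
  measurable_fun setT phi -> cmeasurable f -> cmeasurable (fun s => f (phi s)).
Proof.
move=> mphi [mr mi].
by split; [exact: (measurableT_comp mr mphi)|exact: (measurableT_comp mi mphi)].
Qed.

Lemma cintegrableP f :
  cintegrable mu f <->
  cmeasurable f /\ (\int[mu]_s (normc (f s))%:E < +oo)%E.
Proof.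
split=> [[/integrableP[mr ir] /integrableP[mi ii]]|[[mr mi] fi]].
  have cf : cmeasurable f by split; exact/measurable_EFinP.
  split => //; have [mr' mi'] := cf.
  apply: (@le_lt_trans _ _ (\int[mu]_s (`|(Re (f s))%:E| + `|(Im (f s))%:E|))%E).
    apply: ge0_le_integral => //.
    - by move=> s _; rewrite lee_fin normc_ge0.
    - by apply/measurable_EFinP; exact: cmeasurable_normc.
    - by apply: emeasurable_funD; apply: (measurableT_comp (@abse_measurable R setT)).
    - by move=> s _; rewrite lee_fin normc_le.
  rewrite ge0_integralD//; [exact: lte_add_pinfty| |];
    by apply: (measurableT_comp (@abse_measurable R setT)).
have mn := cmeasurable_normc (conj mr mi).
split; apply/integrableP; (split; first exact/measurable_EFinP);
  apply: le_lt_trans fi; apply: ge0_le_integral => //.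
- by apply: measurableT_comp => //; exact/measurable_EFinP.
- exact/measurable_EFinP.
- by move=> s _; rewrite lee_fin Re_le_normc.
- by apply: measurableT_comp => //; exact/measurable_EFinP.
- exact/measurable_EFinP.
- by move=> s _; rewrite lee_fin Im_le_normc.
Qed.

Lemma cintegrable_cmeasurable f : cintegrable mu f -> cmeasurable f.
Proof. by move=> /cintegrableP[]. Qed.

Lemma cintegrableD f g : cintegrable mu f -> cintegrable mu g ->
  cintegrable mu (fun s => f s + g s).
Proof.
move=> [fr fi] [gr gi]; split.
- rewrite (_ : (fun s => _) = (fun s => (Re (f s))%:E + (Re (g s))%:E)%E).
    exact: integrableD.
  by apply/funext => s; rewrite Defs.ReD.
- rewrite (_ : (fun s => _) = (fun s => (Im (f s))%:E + (Im (g s))%:E)%E).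
    exact: integrableD.
  by apply/funext => s; rewrite Defs.ImD.
Qed.

Lemma cintegrableZ (c : R[i]) f : cintegrable mu f ->
  cintegrable mu (fun s => c * f s).
Proof.
move=> /cintegrableP[mf fi]; apply/cintegrableP; split.
  by apply: cmeasurableM => //; exact: cmeasurable_cst.
under eq_integral do rewrite normcMr EFinM.
rewrite ge0_integralZl//.
- by apply: lte_mul_pinfty => //; rewrite lee_fin normc_ge0.
- by apply/measurable_EFinP; exact: cmeasurable_normc.
- by move=> s _; rewrite lee_fin normc_ge0.
- by rewrite lee_fin normc_ge0.
Qed.

Lemma cintegralD f g : cintegrable mu f -> cintegrable mu g ->
  cintegral mu (fun s => f s + g s) = cintegral mu f + cintegral mu g.
Proof.
move=> [fr fi] [gr gi]; rewrite /cintegral.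
under eq_Rintegral do rewrite Defs.ReD.
rewrite RintegralD//.
under [X in (_ +i* X)%C]eq_Rintegral do rewrite Defs.ImD.
by rewrite RintegralD.
Qed.

Lemma cintegralZ (c : R[i]) f : cintegrable mu f ->
  cintegral mu (fun s => c * f s) = c * cintegral mu f.
Proof.
move=> [fr fi]; rewrite /cintegral.
have Z (h : T -> R) (a : R) : mu.-integrable setT (EFin \o h) ->
    mu.-integrable setT (EFin \o (fun s => a * h s)).
  move=> ih; rewrite (_ : EFin \o _ = fun s => (a%:E * (h s)%:E)%E)//.
  exact: integrableZl.
under eq_Rintegral do rewrite Defs.ReM.
rewrite RintegralB//; [|exact: Z..].
under [X in (_ +i* X)%C]eq_Rintegral do rewrite Defs.ImM.
rewrite RintegralD//; [|exact: Z..].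
by rewrite !RintegralZl//; case: c.
Qed.

(** Integrability is asked of the product, which is what Fubini's theorem gives
    for almost every section. *)
Lemma cintegralZW (c : R[i]) f : cintegrable mu (fun s => c * f s) ->
  cintegral mu (fun s => c * f s) = c * cintegral mu f.
Proof.
have [->|c0 ci] := eqVneq c 0.
  move=> _; rewrite mul0r /cintegral.
  under eq_Rintegral do rewrite mul0r.
  under [X in (_ +i* X)%C]eq_Rintegral do rewrite mul0r.
  by rewrite /Rintegral integral0_eq.
apply: cintegralZ.
have -> : f = (fun s => c^-1 * (c * f s)).
  by apply/funext => s; rewrite mulrA mulVf// mul1r.
exact: cintegrableZ.
Qed.

Lemma eq_cintegral f g : f =1 g -> cintegral mu f = cintegral mu g.
Proof. by move=> /funext ->. Qed.

Lemma ae_eq_cintegral f g : cmeasurable f -> cmeasurable g ->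
  {ae mu, forall s, f s = g s} -> cintegral mu f = cintegral mu g.
Proof.
move=> [fr fi] [gr gi] fg; congr (_ +i* _)%C; congr fine;
  apply: ae_eq_integral => //; try exact/measurable_EFinP;
  by apply: filterS fg => s /= -> .
Qed.

(** The factor 2 comes from the separate estimates of the real and imaginary
    parts. *)
Lemma normc_cintegral_le f : cintegrable mu f ->
  ((normc (cintegral mu f))%:E <= 2%:E * \int[mu]_s (normc (f s))%:E)%E.
Proof.
move=> fi; have [mf ifin] := (cintegrableP f).1 fi; have [fr fim] := fi.
have [mr mi] := mf.
have key (h : T -> R) : mu.-integrable setT (fun s => (h s)%:E) ->
    (forall s, `|h s| <= normc (f s)) ->
    ((`|Rintegral mu setT h|)%:E <= \int[mu]_s (normc (f s))%:E)%E.
  move=> ih hf; rewrite EFin_normr_Rintegral//.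
  have mh : measurable_fun setT (fun s => (h s)%:E) by case/integrableP: ih.
  apply: le_trans (le_abse_integral _ _ _) _ => //.
  apply: ge0_le_integral => //; first exact: measurableT_comp.
  - by apply/measurable_EFinP; exact: cmeasurable_normc.
  - by move=> s _; rewrite lee_fin.
have hle : ((normc (cintegral mu f))%:E <=
    (`|Re (cintegral mu f)|)%:E + (`|Im (cintegral mu f)|)%:E)%E.
  by rewrite -EFinD lee_fin normc_le.
apply: (le_trans hle).
rewrite (_ : 2%:E = 1 + 1)%E// ge0_muleDl// mul1e.
by apply: leeD; apply: key => // s; [exact: Re_le_normc|exact: Im_le_normc].
Qed.

End ComplexIntegral.

(** * Young functions and Orlicz duality *)

Section YoungFunctions.
Context {R : realType}.
Implicit Types Phi Psi : R -> \bar R.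
Local Open Scope ereal_scope.

Definition nondecreasing_on_nonneg Phi :=
  forall x y, (0 <= x)%R -> (x <= y)%R -> Phi x <= Phi y.

Lemma increasing_nondecreasing Phi : increasing_on_nonneg Phi ->
  nondecreasing_on_nonneg Phi.
Proof.
move=> iP x y x0; rewrite le_eqVlt => /predU1P[->//|xy].
by apply: ltW; exact: iP.
Qed.

Lemma increasing_fin_num Phi x : young Phi -> increasing_on_nonneg Phi ->
  (0 <= x)%R -> Phi x \is a fin_num.
Proof.
move=> yP iP x0; rewrite ge0_fin_numE; last exact: young_ge0.
by apply: (lt_le_trans (iP x (x + 1)%R x0 _)); rewrite ?ltrDl ?leey.
Qed.

Lemma increasing_gt0 Phi x : young Phi -> increasing_on_nonneg Phi ->
  (0 < x)%R -> 0 < Phi x.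
Proof. by move=> yP iP x0; rewrite -(young_0 yP) iP. Qed.

Lemma young_scale Phi l x : young Phi -> (0 <= l <= 1)%R -> (0 <= x)%R ->
  Phi (l * x)%R <= l%:E * Phi x.
Proof.
move=> yP l01 x0.
have := young_convex yP x0 (lexx 0%R) l01.
by rewrite mulr0 addr0 (young_0 yP) mule0 adde0.
Qed.

Lemma young_ineq Phi x y : young Phi -> increasing_on_nonneg Phi -> (0 <= x)%R ->
  (x * y)%:E <= Phi x + complementary Phi y.
Proof.
move=> yP iP x0.
rewrite -leeBlDl; last exact: increasing_fin_num.
by apply: ereal_sup_ubound; exists x => //; rewrite /= in_itv/= x0.
Qed.

Lemma complementary_ge0 Phi y : Phi 0%R = 0 -> 0 <= complementary Phi y.
Proof.
move=> P0; apply: ereal_sup_ubound; exists 0%R.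
  by rewrite /= in_itv/= lexx.
by rewrite mul0r P0 sube0.
Qed.

Lemma complementary_nondecreasing Phi :
  nondecreasing_on_nonneg (complementary Phi).
Proof.
move=> x y x0 xy; apply: ge_ereal_sup => _ [z z0 <-].
apply: (@le_trans _ _ ((z * y)%:E - Phi z)).
  apply: leeB => //; rewrite lee_fin ler_wpM2l//.
  by move: z0; rewrite /= in_itv/= andbT.
by apply: ereal_sup_ubound; exists z.
Qed.

Lemma measurable_nondecreasing_comp d (T : measurableType d) Phi (u : T -> R) :
  nondecreasing_on_nonneg Phi -> measurable_fun setT u -> (forall s, (0 <= u s)%R) ->
  measurable_fun setT (fun s => Phi (u s)).
Proof.
move=> nP mu_ u0; apply: (@measurability _ _ T _ setT (fun s => Phi (u s)) _
  (ErealGenOInfty.measurableE R)) => //.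
move=> _ [_ [r ->] <-].
pose A := [set x : R | (0 <= x)%R /\ r%:E < Phi x].
have mA : measurable A.
  apply: is_interval_measurable => x y [x0 rx] [y0 ry] z /andP[xz zy].
  have z0 := le_trans x0 xz; split => //.
  by apply: (lt_le_trans rx); exact: nP.
have -> : (fun s => Phi (u s)) @^-1` `]r%:E, +oo[%classic = u @^-1` A.
  apply/seteqP; split => s /=; rewrite in_itv/= andbT; last by case.
  by move=> h; split.
by rewrite setTI -[_ @^-1` _]setTI; exact: mu_.
Qed.

End YoungFunctions.

Section UnitBall.
Context d (T : measurableType d) {R : realType}.
Variable mu : {measure set T -> \bar R}.
Variable Psi : R -> \bar R.
Local Open Scope ereal_scope.
Hypotheses (yPsi : young Psi) (iPsi : increasing_on_nonneg Psi).

(** [ub_pairing] says that the Orlicz norm of [f] is at most 1; [ub_finite] makes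
    truncation to sets of finite measure possible. *)
Record unit_ball (f : T -> R) : Prop := {
  ub_measurable : measurable_fun setT f ;
  ub_ge0 : forall s, (0 <= f s)%R ;
  ub_finite : forall e : R, (0 < e)%R -> mu [set s | (e < f s)%R] < +oo ;
  ub_pairing : forall w : T -> R, measurable_fun setT w -> (forall s, (0 <= w s)%R) ->
    \int[mu]_s Psi (w s) <= 1 -> \int[mu]_s (f s * w s)%:E <= 1 }.

(** Let [I] be the integral on the left. If [P + I > 2], the function [l * v] on
    [A], with [l = 2 / (P + I)], has [Psi]-integral at most
    [l / 2 * (P + I) = 1] by convexity, and pairing it with [f] gives
    [l * I <= 1], that is [I <= P]. *)
Lemma unit_ball_pairing_restr (f v : T -> R) (W : T -> \bar R) (P : R) (A : set T) :
  unit_ball f -> measurable_fun setT v -> (forall s, (0 <= v s)%R) ->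
  measurable_fun setT W -> (forall s, 0 <= W s) ->
  (forall s, Psi (v s) <= 2^-1%:E * (W s + (f s * v s)%:E)) ->
  \int[mu]_s W s <= P%:E -> measurable A ->
  \int[mu]_s (f s * v s * \1_A s)%:E < +oo ->
  \int[mu]_s (f s * v s * \1_A s)%:E <= (P + 2)%:E.
Proof.
move=> uf mv v0 mW W0 PW WP mA Ifin.
have [mf f0 _ fpair] := uf.
have m1A : measurable_fun setT (\1_A : T -> R) by exact: measurable_indic.
have I0 : 0 <= \int[mu]_s (f s * v s * \1_A s)%:E.
  by apply: integral_ge0 => s _; rewrite lee_fin !mulr_ge0.
have P0 : (0 <= P)%R.
  by rewrite -lee_fin (le_trans _ WP)// integral_ge0.
set I := fine (\int[mu]_s (f s * v s * \1_A s)%:E).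
have IE : \int[mu]_s (f s * v s * \1_A s)%:E = I%:E by rewrite fineK// ge0_fin_numE.
rewrite IE in I0 *; rewrite lee_fin in I0; rewrite lee_fin.
have [|PI2] := leP (P + I)%R 2%R; first by lra.
pose l := (2 / (P + I))%R.
have l0 : (0 < l)%R by rewrite divr_gt0//; lra.
have l1 : (l <= 1)%R by rewrite /l ler_pdivrMr; lra.
have lPI : (l * (P + I) = 2)%R by rewrite /l divfK// gt_eqF//; lra.
pose w s : R := (l * (v s * \1_A s))%R.
have mvA : measurable_fun setT (fun s => v s * \1_A s)%R by exact: measurable_funM.
have mfvA : measurable_fun setT (fun s => (f s * v s * \1_A s)%:E).
  by apply/measurable_EFinP; apply: measurable_funM => //; exact: measurable_funM.
have mw : measurable_fun setT w by apply: measurable_funM.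
have w0 s : (0 <= w s)%R by rewrite /w mulr_ge0 ?(ltW l0)// mulr_ge0.
have Pw s : Psi (w s) <= (l / 2)%:E * (W s + (f s * v s * \1_A s)%:E).
  apply: (@le_trans _ _ (l%:E * Psi (v s * \1_A s)%R)).
    by apply: young_scale; rewrite ?(ltW l0) ?l1// mulr_ge0.
  rewrite (EFinM l) -muleA lee_wpmul2l ?lee_fin ?(ltW l0)//.
  rewrite indicE; case: (s \in A); first by rewrite !mulr1.
  rewrite !mulr0 (young_0 yPsi) adde0.
  by rewrite mule_ge0 ?W0// lee_fin invr_ge0.
have : \int[mu]_s (f s * w s)%:E <= 1.
  apply: fpair => //.
  apply: (@le_trans _ _ (\int[mu]_s ((l / 2)%:E * (W s + (f s * v s * \1_A s)%:E)))).
    apply: ge0_le_integral => //.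
    - by move=> s _; exact: young_ge0.
    - exact: (measurable_nondecreasing_comp (increasing_nondecreasing iPsi)).
    - by apply: measurable_funeM; exact: emeasurable_funD.
  rewrite ge0_integralZl//; last 3 first.
  - exact: emeasurable_funD.
  - by move=> s _; rewrite adde_ge0// lee_fin !mulr_ge0.
  - by rewrite lee_fin divr_ge0 ?(ltW l0).
  rewrite ge0_integralD//; last by move=> s _; rewrite lee_fin !mulr_ge0.
  rewrite IE; apply: (@le_trans _ _ ((l / 2)%:E * (P%:E + I%:E))).
    rewrite lee_wpmul2l ?lee_fin ?divr_ge0 ?(ltW l0)//.
      exact: addr_ge0.
    exact: leeD.
  by rewrite -EFinD -EFinM lee_fin mulrAC lPI divff.
have -> : \int[mu]_s (f s * w s)%:E = (l * I)%:E.
  rewrite EFinM -IE -ge0_integralZl//.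
  - by apply: eq_integral => s _; rewrite /w -EFinM; congr _%:E; ring.
  - by move=> s _; rewrite lee_fin !mulr_ge0.
  - by rewrite lee_fin ltW.
rewrite lee_fin => lI1.
have : (l * (2 * I) <= l * (P + I))%R by rewrite lPI; lra.
rewrite ler_pM2l//; lra.
Qed.

(** On the sets [A n] the functions [f] and [v] are bounded and [f] is bounded
    away from zero, so that the integral is finite and
    [unit_ball_pairing_restr] applies. *)
Lemma unit_ball_pairing (f v : T -> R) (W : T -> \bar R) (P : R) :
  unit_ball f -> measurable_fun setT v -> (forall s, (0 <= v s)%R) ->
  measurable_fun setT W -> (forall s, 0 <= W s) ->
  (forall s, Psi (v s) <= 2^-1%:E * (W s + (f s * v s)%:E)) ->
  \int[mu]_s W s <= P%:E ->
  \int[mu]_s (f s * v s)%:E <= (P + 2)%:E.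
Proof.
move=> uf mv v0 mW W0 PW WP; have [mf f0 ffin _] := uf.
pose A n := f @^-1` `](n.+1%:R^-1)%R, (n%:R)%R]%classic `&` v @^-1` `]-oo, (n%:R)%R]%classic.
have mA n : measurable (A n).
  by apply: measurableI; rewrite -[X in measurable X]setTI; [exact: mf|exact: mv].
have mfv : measurable_fun setT (fun s => f s * v s)%R by exact: measurable_funM.
have ndA s m n : (m <= n)%N -> A m s -> A n s.
  move=> mn [/=]; rewrite !in_itv/= => /andP[f1 f2] v1.
  have mnR : (m%:R <= n%:R :> R)%R by rewrite ler_nat.
  split; rewrite /= in_itv/=; last exact: le_trans mnR.
  rewrite (le_trans f2 mnR) andbT (le_lt_trans _ f1)//.
  by rewrite lef_pV2 ?posrE// ler_nat.
have Afin n : \int[mu]_s (f s * v s * \1_(A n) s)%:E < +oo.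
  apply: (@le_lt_trans _ _ (\int[mu]_s ((n%:R * n%:R)%:E * (\1_(A n) s)%:E))).
    apply: ge0_le_integral => //.
    - by move=> s _; rewrite lee_fin !mulr_ge0.
    - by apply/measurable_EFinP; apply: measurable_funM.
    - by apply: measurable_funeM; apply/measurable_EFinP; exact: measurable_indic.
    - move=> s _; rewrite -EFinM lee_fin indicE.
      have [/set_mem[/=]|_] := boolP (s \in A n); last by rewrite !mulr0.
      rewrite !in_itv/= => /andP[_ f2] v1.
      by rewrite !mulr1 ler_pM.
  rewrite ge0_integralZl//; last by apply/measurable_EFinP; exact: measurable_indic.
  rewrite integral_indic// setIT lte_mul_pinfty// ?lee_fin ?mulr_ge0//.
  apply: le_lt_trans (ffin (n.+1%:R^-1)%R _); last by rewrite invr_gt0.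
  apply: le_measure; rewrite ?inE//.
    rewrite (_ : [set s | (n.+1%:R^-1 < f s)%R] = f @^-1` `](n.+1%:R^-1)%R, +oo[%classic).
      by rewrite -[X in measurable X]setTI; exact: mf.
    by apply/seteqP; split => s /=; rewrite in_itv/= andbT.
  by move=> s [/=]; rewrite in_itv/= => /andP[].
have lim : \int[mu]_s (f s * v s * \1_(A n) s)%:E @[n --> \oo] -->
    \int[mu]_s (f s * v s)%:E.
  apply: (ge0_cvg_integral (g := fun n s => (f s * v s * \1_(A n) s)%:E)).
  - by move=> n; apply/measurable_EFinP; apply: measurable_funM.
  - by move=> n s; rewrite lee_fin !mulr_ge0.
  - move=> s m n mn; rewrite lee_fin ler_wpM2l ?mulr_ge0// !indicE.
    have [/set_mem/(ndA _ _ _ mn) As|//] := boolP (s \in A m).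
    by rewrite mem_set.
  - move=> s; have [fs0|fs0] := eqVneq (f s) 0%R.
      by rewrite fs0; under eq_fun do rewrite !mul0r; rewrite mul0r; exact: cvg_cst.
    have fs1 : (0 < f s)%R by rewrite lt_neqAle eq_sym fs0 f0.
    pose N := maxn (Num.truncn (f s)^-1) (maxn (Num.truncn (f s)).+1 (Num.truncn (v s)).+1).
    apply: cvg_near_cst; exists N => // n /=; rewrite !geq_max => /and3P[n1 n2 n3].
    rewrite indicE mem_set ?mulr1//; split; rewrite /= in_itv/=.
      apply/andP; split.
        rewrite invf_plt ?posrE//; apply: (lt_le_trans (truncnS_gt _)).
        by rewrite ler_nat ltnS.
      by apply: ltW; apply: (lt_le_trans (truncnS_gt _)); rewrite ler_nat.
    by apply: ltW; apply: (lt_le_trans (truncnS_gt _)); rewrite ler_nat.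
rewrite -(cvg_lim _ lim)//; apply: lime_le; first exact: cvgP lim.
by apply: nearW => n; exact: (unit_ball_pairing_restr uf mv v0 mW W0 PW WP (mA n) (Afin n)).
Qed.

End UnitBall.

Section OrliczUnitBall.
Context d (T : measurableType d) {R : realType}.
Variable mu : {measure set T -> \bar R}.
Variables Phi Psi : R -> \bar R.
Local Open Scope ereal_scope.
Hypotheses (pairPP : complementary_pair Phi Psi).
Hypotheses (iPhi : increasing_on_nonneg Phi) (iPsi : increasing_on_nonneg Psi).

Let yPhi : young Phi. Proof. by case: pairPP. Qed.
Let yPsi : young Psi. Proof. by case: pairPP. Qed.
Let PsiE y : (0 <= y)%R -> Psi y = complementary Phi y.
Proof. by case: pairPP => _ _; apply. Qed.

(** Convexity of [Psi (sqrt x)] gives [Psi y <= y ^+ 2 * Psi 1] for [y <= 1], so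
    a small multiple of [min f 1] can be paired with [f]. *)
Lemma unit_ball_min_le : young (fun x => Psi (Num.sqrt x)) ->
  exists C : R, forall f : T -> R, unit_ball mu Psi f ->
    \int[mu]_s (f s * Num.min (f s) 1%R)%:E <= C%:E.
Proof.
move=> yT; pose c := fine (Psi 1%R).
have cE : Psi 1%R = c%:E by rewrite fineK// increasing_fin_num.
have c0 : (0 <= c)%R by rewrite fine_ge0// young_ge0.
(* [e * c <= 1 / 2], hence
   [Psi (e * m) <= e ^+ 2 * c * m ^+ 2 <= f * (e * m) / 2] for [m = min f 1]. *)
pose e := ((1 + 2 * c)^-1)%R.
have e0 : (0 < e)%R by rewrite invr_gt0; lra.
have eE : (e * (1 + 2 * c) = 1)%R by rewrite mulVf// gt_eqF//; lra.
have e1 : (e <= 1)%R by have := mulr_ge0 (ltW e0) c0; lra.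
exists (2 / e)%R => f uf; have [mf f0 _ _] := uf.
pose m s := Num.min (f s) 1%R.
have m0 s : (0 <= m s)%R by rewrite le_min f0 ler01.
have mm : measurable_fun setT m by exact: measurable_minr.
have h : \int[mu]_s (f s * (e * m s))%:E <= (0 + 2)%:E.
  apply: (unit_ball_pairing yPsi iPsi (W := cst 0)) => //.
  - exact: (measurable_funM (@measurable_cst _ _ T R setT e) mm).
  - by move=> s; rewrite mulr_ge0// ltW.
  - move=> s; rewrite add0e -EFinM.
    have y1 : (0 <= (e * m s) ^+ 2 <= 1)%R.
      rewrite sqr_ge0/= expr_le1// ?mulr_ge0 ?(ltW e0)//.
      by rewrite mulr_ile1// ?(ltW e0)// ge_min lexx orbT.
    have := young_scale yT y1 (@ler01 R).
    rewrite mulr1 sqrtr_sqr sqrtr1 cE ger0_norm ?mulr_ge0 ?(ltW e0)// => /le_trans; apply.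
    rewrite -EFinM lee_fin.
    have mf' : (m s * m s <= f s * m s)%R by rewrite ler_wpM2r// ge_min lexx.
    have ec : (e * c <= 2^-1)%R by lra.
    rewrite exprMn [X in (_ * X * _)%R]expr2 (expr2 e).
    have := ler_wpM2l (ltW e0) (ler_pM (mulr_ge0 (ltW e0) c0) (mulr_ge0 (m0 s) (m0 s)) ec mf').
    lra.
  - by rewrite integral0_eq.
move: h; rewrite add0r.
have -> : \int[mu]_s (f s * (e * m s))%:E = e%:E * \int[mu]_s (f s * m s)%:E.
  rewrite -ge0_integralZl//.
  - by apply: eq_integral => s _; rewrite -EFinM mulrCA.
  - by apply/measurable_EFinP; exact: measurable_funM.
  - by move=> s _; rewrite lee_fin mulr_ge0.
  - by rewrite lee_fin ltW.
by rewrite EFinM muleC -lee_pdivlMr.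
Qed.

(** Since [x * (eta * f) <= (x ^+ 2 * eta + f ^+ 2 * eta) / 2] and [Phi x] is at
    least [(x ^+ 2 * eta - W) / 2], the definition of [Psi] as a supremum gives
    [Psi (eta * f) <= (W + eta * f ^+ 2) / 2], and [unit_ball_pairing] applies to
    [v = eta * f]. *)
Lemma unit_ball_square_le (f eta : T -> R) (W : T -> \bar R) (P : R) :
  unit_ball mu Psi f -> measurable_fun setT eta -> (forall s, (0 <= eta s)%R) ->
  measurable_fun setT W -> (forall s, 0 <= W s) ->
  (forall s x, (0 <= x)%R -> (x ^+ 2 * eta s)%:E <= W s + Phi x) ->
  \int[mu]_s W s <= P%:E ->
  \int[mu]_s (eta s * f s ^+ 2)%:E <= (P + 2)%:E.
Proof.
move=> uf me eta0 mW W0 WP PW; have [mf f0 _ _] := uf.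
rewrite (_ : (fun s => _) = (fun s => (f s * (eta s * f s))%:E)); last first.
  by apply/funext => s; congr _%:E; ring.
apply: (unit_ball_pairing yPsi iPsi (W := W)) => //.
- exact: measurable_funM.
- by move=> s; rewrite mulr_ge0.
- move=> s; rewrite PsiE ?mulr_ge0//; apply: ge_ereal_sup => _ [x + <-].
  rewrite /= in_itv/= andbT => x0.
  have := WP s x x0; have := W0 s.
  have := increasing_fin_num yPhi iPhi x0; have := young_ge0 yPhi x0.
  case: (Phi x) => // p; rewrite lee_fin => p0 _.
  case: (W s) => [w| |]// w0.
    rewrite -EFinN -!EFinD -EFinM !lee_fin => h.
    have : (0 <= (x - f s) ^+ 2 * eta s)%R by rewrite mulr_ge0// sqr_ge0.
    by rewrite lee_fin in w0; rewrite !expr2 in h *; lra.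
  by move=> _; rewrite addye// gt0_muley ?leey// lte_fin.
Qed.

Variable g : T -> R[i].
Hypothesis og : orlicz mu Phi g.

Let ng s := normc (g s).
Let mng : measurable_fun setT ng. Proof. by case: og => /cmeasurable_normc. Qed.

Lemma orlicz_pairing : exists K : R, forall v : T -> R[i], cmeasurable v ->
  \int[mu]_s complementary Phi (normc (v s)) <= 1 ->
  \int[mu]_s (normc (g s * v s))%:E <= K%:E.
Proof.
have [mg [a a0 afin]] := og.
have ma : measurable_fun setT (fun s => a * ng s)%R.
  exact: (measurable_funM (@measurable_cst _ _ T R setT a) mng).
have mP : measurable_fun setT (fun s => Phi (a * ng s)%R).
  apply: measurable_nondecreasing_comp => //.
  - exact: increasing_nondecreasing.
  - by move=> s; rewrite mulr_ge0 ?normc_ge0 ?ltW.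
have P0 s : 0 <= Phi (a * ng s)%R.
  by apply: young_ge0 => //; rewrite mulr_ge0 ?normc_ge0 ?ltW.
pose I := fine (\int[mu]_s Phi (a * ng s)%R).
have IE : \int[mu]_s Phi (a * ng s)%R = I%:E.
  by rewrite fineK// ge0_fin_numE ?integral_ge0.
exists (a^-1 * (I + 1))%R => v mv v1.
have mc : measurable_fun setT (fun s => complementary Phi (normc (v s))).
  apply: measurable_nondecreasing_comp.
  - exact: complementary_nondecreasing.
  - exact: cmeasurable_normc.
  - by move=> s; exact: normc_ge0.
have c0 y : 0 <= complementary Phi y by apply: complementary_ge0; exact: young_0.
apply: (@le_trans _ _ (\int[mu]_s (a^-1%:E * (Phi (a * ng s)%R + complementary Phi (normc (v s)))))).
  apply: ge0_le_integral => //.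
  - by move=> s _; rewrite lee_fin normc_ge0.
  - by apply/measurable_EFinP; apply: cmeasurable_normc; exact: cmeasurableM.
  - by apply: measurable_funeM; exact: emeasurable_funD.
  - move=> s _; rewrite muleC lee_pdivlMr// -EFinM normcMr.
    apply: le_trans (young_ineq _ yPhi iPhi _); last by rewrite mulr_ge0 ?normc_ge0 ?ltW.
    by rewrite lee_fin mulrC mulrA.
rewrite ge0_integralZl//; last 3 first.
- exact: emeasurable_funD.
- by move=> s _; rewrite adde_ge0.
- by rewrite lee_fin invr_ge0 ltW.
rewrite ge0_integralD// IE EFinM EFinD lee_wpmul2l ?lee_fin ?invr_ge0 ?(ltW a0)//.
exact: leeD.
Qed.

Lemma orlicz_norm_fin : orlicz_norm mu Phi g \is a fin_num.
Proof.
have [K HK] := orlicz_pairing.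
have N0 : 0 <= orlicz_norm mu Phi g.
  apply: ereal_sup_ubound; exists (fun=> 0%R).
    split; first exact: cmeasurable_cst.
    rewrite integral0_eq// => s _; rewrite normc0 -PsiE//.
    exact: young_0.
  by rewrite integral0_eq// => s _; rewrite mulr0 normc0.
rewrite ge0_fin_numE//; apply: (@le_lt_trans _ _ K%:E); last exact: ltry.
by apply: ge_ereal_sup => _ [v [mv v1] <-]; exact: HK.
Qed.

Lemma orlicz_finite (e : R) : (0 < e)%R -> mu [set s | (e < ng s)%R] < +oo.
Proof.
move=> e0; have [mg [a a0 afin]] := og.
have mA : measurable [set s | (e < ng s)%R].
  rewrite (_ : [set s | _] = ng @^-1` `]e, +oo[%classic).
    by rewrite -[X in measurable X]setTI; exact: mng.
  by apply/seteqP; split => s /=; rewrite in_itv/= andbT.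
have ae0 : (0 < a * e)%R by rewrite mulr_gt0.
have p0 := increasing_gt0 yPhi iPhi ae0.
have pf := increasing_fin_num yPhi iPhi (ltW ae0).
have : Phi (a * e)%R * mu [set s | (e < ng s)%R] < +oo.
  apply: le_lt_trans afin.
  rewrite -[X in mu X]setIT -integral_indic//.
  rewrite -ge0_integralZl//; last 2 first.
  - by apply/measurable_EFinP; exact: measurable_indic.
  - exact: ltW.
  apply: ge0_le_integral => //.
  - by move=> s _; rewrite mule_ge0// ltW.
  - by apply: measurable_funeM; apply/measurable_EFinP; exact: measurable_indic.
  - apply: measurable_nondecreasing_comp.
    + exact: increasing_nondecreasing.
    + exact: (measurable_funM (@measurable_cst _ _ T R setT a) mng).
    + by move=> s; rewrite mulr_ge0 ?normc_ge0 ?ltW.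
  - move=> s _; rewrite indicE; have [/set_mem/= es|_] := boolP (s \in _).
      rewrite mule1; apply: increasing_nondecreasing => //; first exact: ltW.
      by rewrite ler_wpM2l// ltW.
    by rewrite mule0; apply: young_ge0 => //; rewrite mulr_ge0 ?normc_ge0 ?ltW.
have := leey (mu [set s | (e < ng s)%R]); rewrite le_eqVlt => /predU1P[->|//].
by rewrite gt0_muley.
Qed.

Lemma orlicz_unit_ball (N : R) : (0 < N)%R -> orlicz_norm mu Phi g <= N%:E ->
  unit_ball mu Psi (fun s => ng s / N)%R.
Proof.
move=> N0 NE; split.
- exact: (measurable_funM mng (@measurable_cst _ _ T R setT (N^-1)%R)).
- by move=> s; rewrite divr_ge0 ?normc_ge0 ?ltW.
- move=> e e0; rewrite (_ : [set s | _] = [set s | (e * N < ng s)%R]).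
    by apply: orlicz_finite; rewrite mulr_gt0.
  by apply/seteqP; split => s /=; rewrite ltr_pdivlMr.
- move=> w mw w0 w1.
  have -> : \int[mu]_s (ng s / N * w s)%:E = N^-1%:E * \int[mu]_s (ng s * w s)%:E.
    rewrite -ge0_integralZl//.
    + by apply: eq_integral => s _; rewrite -EFinM; congr _%:E; ring.
    + by apply/measurable_EFinP; exact: measurable_funM.
    + by move=> s _; rewrite lee_fin mulr_ge0// normc_ge0.
    + by rewrite lee_fin invr_ge0 ltW.
  rewrite muleC lee_pdivrMr// mul1e; apply: le_trans NE.
  apply: ereal_sup_ubound; exists (fun s => (w s)%:C%C).
    split; first exact: cmeasurable_real.
    by under eq_integral do rewrite normc_real ger0_norm// -PsiE//.
  by apply: eq_integral => s _; rewrite normcMr normc_real ger0_norm.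
Qed.

End OrliczUnitBall.

(** * Fubini theorem and translations *)

Lemma integral_maxE d (T : measurableType d) (R : realType)
    (mu : {measure set T -> \bar R}) (f : T -> \bar R) :
  (\int[mu]_x f x = \int[mu]_x maxe (f x) 0 - \int[mu]_x maxe (- f x) 0)%E.
Proof.
rewrite integralE; under eq_integral do rewrite funeposE.
by under [X in (_ - X)%E]eq_integral do rewrite funenegE.
Qed.

Lemma maxe0_norm (R : realDomainType) (x : R) :
  (0 <= maxe x%:E 0 <= (`|x|)%:E)%E.
Proof. by rewrite le_max lexx orbT ge_max !lee_fin normr_ge0 andbT ler_norm. Qed.

Lemma addl_continuous (G : topologicalZmodType) (a : G) :
  continuous (fun x : G => a + x).
Proof.
move=> t; apply: (@continuous_comp _ _ _ (fun t : G => (a, t))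
  (fun p : G * G => p.1 + p.2)); last exact: add_continuous.
by apply: cvg_pair => //=; exact: cvg_cst.
Qed.

Lemma cLinfty_bound d (T : measurableType d) (R : realType)
    (mu : {measure set T -> \bar R}) (f : T -> R[i]) : cLinfty mu f ->
  exists L : R, {ae mu, forall s, normc (f s) <= L}.
Proof.
move=> [_]; rewrite inE/= => /andP[_]; rewrite inE/= /finite_norm unlock /Lnorm.
case: ifPn => // mT; last first.
  move=> _; exists 0; apply: measure0_ae; apply/eqP.
  by rewrite eq_le measure_ge0 andbT leNgt.
move=> h; have [M HM] := @ess_sup_inf.ess_supr_bounded _ T R mu (fun s => `|normc (f s)|) h.
by exists M; apply: filterS HM => s; rewrite ger0_norm// normc_ge0.
Qed.

Section Measurable2.
Context {R : realType} {G : topologicalZmodType}.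
Implicit Types F : G -> G -> R[i].

Definition cmeasurable2 F := cmeasurable ((fun p => F p.1 p.2) : @borel2 G -> R[i]).

Lemma cmeasurable2_section1 F x : cmeasurable2 F -> cmeasurable (F x : borel G -> R[i]).
Proof. by move=> mF; exact: (cmeasurable_comp (@measurable_pair1 G x) mF). Qed.

Lemma cmeasurable2_section2 F y : cmeasurable2 F ->
  cmeasurable ((fun x => F x y) : borel G -> R[i]).
Proof. by move=> mF; exact: (cmeasurable_comp (@measurable_pair2 G y) mF). Qed.

Lemma cmeasurable2_normc F : cmeasurable2 F ->
  measurable2 (fun x y => (normc (F x y))%:E).
Proof. by move=> mF; apply/measurable_EFinP; exact: cmeasurable_normc. Qed.

End Measurable2.

Section Supports.
Context {T : Type} {V : nmodType} {S : set T} {f : T -> V}.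

Lemma supportedUl S' : supported S f -> supported (S `|` S') f.
Proof. by move=> fS s /not_orP[+ _]; exact: fS. Qed.

Lemma supportedUr S' : supported S f -> supported (S' `|` S) f.
Proof. by move=> fS s /not_orP[_]; exact: fS. Qed.

End Supports.

Section HaarIntegrals.
Context {R : realType} {G : topologicalZmodType}.
Hypothesis HG : hausdorff_space G.
Variable mu : {measure set (borel G) -> \bar R}.
Hypothesis inner_mu : inner_regular mu.
Hypothesis invariant_mu : translation_invariant mu.

Section FubiniSigma.
Variables (S : set G) (sS : sigma_open mu S).
Local Open Scope ereal_scope.

Lemma tonelli_dominated (B P : G -> G -> \bar R) :
  measurable2 B -> (forall x y, ~ (S x /\ S y) -> B x y = 0) ->
  \int[mu]_x \int[mu]_y B x y < +oo ->
  measurable2 P -> (forall x y, 0 <= P x y <= B x y) ->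
  [/\ tonelli mu P,
    mu.-integrable setT (fun x : borel G => \int[mu]_y P x y) &
    mu.-integrable setT (fun y : borel G => \int[mu]_x P x y)].
Proof.
move=> mB BS Bfin mP PB.
have P0 x y : 0 <= P x y by case/andP: (PB x y).
have B0 x y : 0 <= B x y by case/andP: (PB x y) => /le_trans; apply.
have tB : tonelli mu B by exact: (tonelli_sigma HG inner_mu sS).
have tP : tonelli mu P.
  apply: (tonelli_sigma HG inner_mu sS) => // x y /BS Bxy.
  by apply/eqP; rewrite eq_le P0 andbT -Bxy; case/andP: (PB x y).
have Pfin : \int[mu]_x \int[mu]_y P x y < +oo.
  have [mP1 _ _] := tP; have [mB1 _ _] := tB.
  apply: le_lt_trans Bfin; apply: ge0_le_integral => //.
  - by move=> x _; exact: integral_ge0.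
  - move=> x _; apply: ge0_le_integral => //; try exact: measurable2_section1.
    by move=> y _; case/andP: (PB x y).
have [mP1 mP2 EP] := tP.
split=> //; apply/integrableP; split => //.
- under eq_integral do rewrite gee0_abs ?integral_ge0//.
  exact: Pfin.
- under eq_integral do rewrite gee0_abs ?integral_ge0//.
  by rewrite -EP.
Qed.

Lemma measurable2_swap d (T : measurableType d) (F : G -> G -> T) :
  measurable2 F -> measurable2 (fun x y => F y x).
Proof. by move=> mF; exact: (measurableT_comp mF (@measurable_swap2 G)). Qed.

(** The iterated integral is a difference of two iterated integrals of
    nonnegative functions, for which the order does not matter. *)
Lemma fubini_half (f : G -> G -> R) : measurable2 f ->
  (forall x y, ~ (S x /\ S y) -> f x y = 0%R) ->
  \int[mu]_x \int[mu]_y (`|f x y|)%:E < +oo ->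
  [/\ {ae mu, forall x : borel G, mu.-integrable setT (fun y : borel G => (f x y)%:E)},
   mu.-integrable setT (fun x : borel G => (Rintegral mu setT (f x))%:E) &
   (Rintegral mu setT (fun x : borel G => Rintegral mu setT (f x)))%:E =
   \int[mu]_x \int[mu]_y maxe (f x y)%:E 0 -
   \int[mu]_x \int[mu]_y maxe (- (f x y)%:E) 0].
Proof.
move=> mf fS fi.
pose B x y : \bar R := (`|f x y|)%:E.
pose p x y : \bar R := maxe (f x y)%:E 0.
pose n x y : \bar R := maxe (- (f x y)%:E) 0.
have mF : measurable2 (fun x y => (f x y)%:E) by exact/measurable_EFinP.
have mB : measurable2 B.
  by apply/measurable_EFinP; exact: measurableT_comp.
have mp : measurable2 p.
  exact: measurable_maxe.
have mn : measurable2 n.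
  by apply: measurable_maxe => //; exact: measurableT_comp.
have BS x y : ~ (S x /\ S y) -> B x y = 0 by move=> /fS; rewrite /B => ->; rewrite normr0.
have pB x y : 0 <= p x y <= B x y by exact: maxe0_norm.
have nB x y : 0 <= n x y <= B x y by rewrite /B -normrN; exact: maxe0_norm.
have BB x y : 0 <= B x y <= B x y by rewrite lexx andbT lee_fin.
have [tB iB _] := tonelli_dominated mB BS fi mB BB.
have [tp ip _] := tonelli_dominated mB BS fi mp pB.
have [tn i_n _] := tonelli_dominated mB BS fi mn nB.
have aeB := integrable_ae measurableT iB.
have aeint : {ae mu, forall x : borel G,
    mu.-integrable setT (fun y : borel G => (f x y)%:E)}.
  apply: filterS aeB => x /(_ I) h; apply/integrableP; split.
    exact: (measurable2_section1 _ mF).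
  by rewrite -ge0_fin_numE//; exact: integral_ge0.
have aeE : {ae mu, forall x : borel G, (Rintegral mu setT (f x))%:E =
    \int[mu]_y p x y - \int[mu]_y n x y}.
  apply: filterS aeint => x ix.
  rewrite /Rintegral fineK; last exact: integrable_fin_num.
  by rewrite integral_maxE.
have mD : measurable_fun setT
    (fun x : borel G => \int[mu]_y p x y - \int[mu]_y n x y).
  have [mp1 _ _] := tp; have [mn1 _ _] := tn.
  exact: (emeasurable_funB mp1 mn1).
have mR : measurable_fun setT (fun x : borel G => (Rintegral mu setT (f x))%:E).
  apply/measurable_EFinP.
  rewrite (_ : (fun x => _) = fine \o (fun x : borel G => \int[mu]_y p x y - \int[mu]_y n x y)).
    exact: (measurableT_comp (fine_measurable measurableT) mD).
  by apply/funext => x; rewrite /Rintegral/= integral_maxE.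
have iD : mu.-integrable setT (fun x : borel G => \int[mu]_y p x y - \int[mu]_y n x y).
  exact: (integrableB measurableT ip i_n).
have iR : mu.-integrable setT (fun x : borel G => (Rintegral mu setT (f x))%:E).
  case/integrableP: iD => _ iD; apply/integrableP; split => //.
  rewrite (ae_eq_integral (fun x : borel G => `|\int[mu]_y p x y - \int[mu]_y n x y|))//.
  - exact: measurableT_comp.
  - exact: measurableT_comp.
  - by apply: filterS aeE => x xE _; rewrite xE.
split => //.
rewrite {1}/Rintegral fineK; last exact: integrable_fin_num.
transitivity (\int[mu]_x (\int[mu]_y p x y - \int[mu]_y n x y)).
  apply: (ae_eq_integral _ _ measurableT mR mD).
  by apply: filterS aeE => x xE _; rewrite xE.
exact: (integralB measurableT ip i_n).
Qed.

Lemma fubini_real (f : G -> G -> R) : measurable2 f ->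
  (forall x y, ~ (S x /\ S y) -> f x y = 0%R) ->
  \int[mu]_x \int[mu]_y (`|f x y|)%:E < +oo ->
  Rintegral mu setT (fun x : borel G => Rintegral mu setT (f x)) =
  Rintegral mu setT (fun y : borel G => Rintegral mu setT (f ^~ y)).
Proof.
move=> mf fS fi.
have mB : measurable2 (fun x y => (`|f x y|)%:E).
  by apply/measurable_EFinP; exact: measurableT_comp.
have BS x y : ~ (S x /\ S y) -> (`|f x y|)%:E = 0 by move=> /fS ->; rewrite normr0.
have T P := tonelli_dominated mB BS fi (P := P).
have [|[_ _ EB] _ _] := T _ mB; first by move=> x y; rewrite lexx andbT lee_fin.
have fi' : \int[mu]_y \int[mu]_x (`|f x y|)%:E < +oo by rewrite -EB.
have fS' y x : ~ (S y /\ S x) -> f x y = 0%R by rewrite andC => /fS.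
have [_ _ E1] := fubini_half mf fS fi.
have [_ _ E2] := fubini_half (measurable2_swap mf) fS' fi'.
apply: EFin_inj; rewrite E1 [RHS]E2.
have mF : measurable2 (fun x y => (f x y)%:E) by exact/measurable_EFinP.
pose p x y : \bar R := maxe (f x y)%:E 0.
pose n x y : \bar R := maxe (- (f x y)%:E) 0.
have mp : measurable2 p by exact: measurable_maxe.
have mn : measurable2 n by apply: measurable_maxe => //; exact: measurableT_comp.
have pB x y : 0 <= p x y <= (`|f x y|)%:E by exact: maxe0_norm.
have nB x y : 0 <= n x y <= (`|f x y|)%:E by rewrite -normrN; exact: maxe0_norm.
have [[_ _ e1] _ _] := T p mp pB.
have [[_ _ e2] _ _] := T n mn nB.
exact: (f_equal2 (fun a b => a - b) e1 e2).
Qed.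

End FubiniSigma.

Section ComplexFubini.
Implicit Types F : G -> G -> R[i].
Variables (S : set G) (sS : sigma_open mu S).

Lemma cfubini F : cmeasurable2 F ->
  (forall x y, ~ (S x /\ S y) -> F x y = 0) ->
  (\int[mu]_x \int[mu]_y (normc (F x y))%:E < +oo)%E ->
  [/\ {ae mu, forall x : borel G, cintegrable mu (F x : borel G -> R[i])},
    cintegrable mu (fun x : borel G => cintegral mu (F x : borel G -> R[i])) &
    cintegral mu (fun x : borel G => cintegral mu (F x : borel G -> R[i])) =
    cintegral mu (fun y : borel G => cintegral mu (fun x : borel G => F x y))].
Proof.
move=> mF FS Ffin; have [mr mi] := mF.
have FS' (h : R[i] -> R) : h 0 = 0 -> forall x y, ~ (S x /\ S y) -> h (F x y) = 0.
  by move=> h0 x y /FS ->.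
have fin (h : R[i] -> R) : measurable2 (fun x y => h (F x y)) ->
    (forall z, `|h z| <= normc z) -> h 0 = 0 ->
    (\int[mu]_x \int[mu]_y (`|h (F x y)|)%:E < +oo)%E.
  move=> mh hn h0; apply: le_lt_trans Ffin.
  have mB : measurable2 (fun x y => (`|h (F x y)|)%:E).
    by apply/measurable_EFinP; exact: measurableT_comp.
  have mN := cmeasurable2_normc mF.
  have [mB1 _ _] : tonelli mu (fun x y => (`|h (F x y)|)%:E).
    apply: (tonelli_sigma HG inner_mu sS) => // x y /FS ->.
    by rewrite h0 normr0.
  have [mN1 _ _] : tonelli mu (fun x y => (normc (F x y))%:E).
    apply: (tonelli_sigma HG inner_mu sS) => // [x y|x y /FS ->].
      by rewrite lee_fin normc_ge0.
    by rewrite normc0.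
  apply: ge0_le_integral => //.
  - by move=> x _; apply: integral_ge0 => y _; rewrite lee_fin.
  - move=> x _; apply: ge0_le_integral => //.
    + exact: (measurable2_section1 (F := fun x y => (`|h (F x y)|)%:E) x mB).
    + exact: (measurable2_section1 (F := fun x y => (normc (F x y))%:E) x mN).
    + by move=> y _; rewrite lee_fin.
have finr := fin _ mr (@Re_le_normc R) erefl.
have fini := fin _ mi (@Im_le_normc R) erefl.
have [ar ir Er] := fubini_half sS mr (FS' _ erefl) finr.
have [ai ii Ei] := fubini_half sS mi (FS' _ erefl) fini.
split.
- by apply: filterS2 ar ai => x rx ix; split.
- by split.
- rewrite /cintegral/=; congr (_ +i* _)%C.
  + exact: (fubini_real sS mr (FS' _ erefl) finr).
  + exact: (fubini_real sS mi (FS' _ erefl) fini).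
Qed.

Lemma csection_cmeasurable F :  cmeasurable2 F ->
  (forall x y, ~ S y -> F x y = 0) ->
  cmeasurable (fun x : borel G => cintegral mu (F x : borel G -> R[i])).
Proof.
move=> [mr mi] FS.
have key (f : G -> G -> R) : measurable2 f -> (forall x y, ~ S y -> f x y = 0) ->
    measurable_fun setT (fun x : borel G => Rintegral mu setT (f x : borel G -> R)).
  move=> mf fS.
  have mF : measurable2 (fun x y => (f x y)%:E) by exact/measurable_EFinP.
  rewrite (_ : (fun x => _) = fine \o (fun x : borel G =>
     \int[mu]_y maxe (f x y)%:E 0 - \int[mu]_y maxe (- (f x y)%:E) 0)%E); last first.
    by apply/funext => x; rewrite /Rintegral/= integral_maxE.
  apply: measurableT_comp => //; apply: emeasurable_funB.
  - apply: (measurable_integral_sigma HG inner_mu sS).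
    + exact: measurable_maxe.
    + by move=> x y; rewrite le_max lexx orbT.
    + by move=> x y /fS ->; rewrite maxxx.
  - apply: (measurable_integral_sigma HG inner_mu sS).
    + by apply: measurable_maxe => //; exact: measurableT_comp.
    + by move=> x y; rewrite le_max lexx orbT.
    + by move=> x y /fS ->; rewrite oppe0 maxxx.
by split; apply: key => // x y /FS ->.
Qed.

End ComplexFubini.

Lemma measure_preimage_translation (a : G) (B : set (borel G)) : measurable B ->
  mu [set s : G | B (a + s)] = mu B.
Proof.
move=> mB; rewrite -(invariant_mu (- a) mB); congr (mu _).
apply/seteqP; split=> s /=.
  by move=> Bs; exists (a + s) => //; rewrite addrA addNr add0r.
by move=> [t Bt <-]; rewrite addrA addrN add0r.
Qed.

Lemma ge0_integral_translation (a : G) (f : G -> \bar R) :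
  measurable_fun setT (f : borel G -> \bar R) -> (forall s, (0 <= f s)%E) ->
  (\int[mu]_s f (a + s)%R = \int[mu]_s f s)%E.
Proof.
move=> mf f0.
have := ge0_integral_pushforward (measurable_addl a) mu measurableT mf.
move=> /(_ (fun s _ => f0 s)).
rewrite preimage_setT => <-.
apply: eq_measure_integral; first exact: measurable_addl.
by move=> ? B mB _; exact: (measure_preimage_translation a mB).
Qed.

Lemma cintegral_translation (a : G) (f : G -> R[i]) :
  cmeasurable (f : borel G -> R[i]) ->
  cintegral mu (fun s : borel G => f (a + (s : G))) = cintegral mu (f : borel G -> R[i]).
Proof.
have key (h : G -> R) : measurable_fun setT (h : borel G -> R) ->
    Rintegral mu setT (fun s : borel G => h (a + (s : G))) =
    Rintegral mu setT (h : borel G -> R).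
  move=> mh; have mh' : measurable_fun setT ((fun s => (h s)%:E) : borel G -> \bar R).
    exact/measurable_EFinP.
  rewrite /Rintegral; congr fine.
  rewrite (integral_maxE mu (fun s => (h s)%:E)).
  apply: (etrans (integral_maxE mu (fun s : borel G => (h (a + (s : G)))%:E))).
  apply: (f_equal2 (fun x y => x - y)%E).
  - apply: (@ge0_integral_translation a (fun s => maxe (h s)%:E 0)).
      exact: measurable_maxe.
    by move=> s; rewrite le_max lexx orbT.
  - apply: (@ge0_integral_translation a (fun s => maxe (- (h s)%:E) 0)%E).
      by apply: measurable_maxe => //; exact: measurableT_comp.
    by move=> s; rewrite le_max lexx orbT.
by move=> [mr mi]; rewrite /cintegral; congr (_ +i* _)%C; exact: key.
Qed.

(** * Pairings with convolutions *)

Section Forms.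
Local Open Scope ereal_scope.

Section NonnegativeForms.
Implicit Types k a b : borel G -> \bar R.

(** [ebilin k a b] is the pairing of [k] with the convolution of [a] and [b]
    ([econvolution_pairing]); the variable [u + s] makes the symmetry in [a] and
    [b] visible. *)
Definition eform k b (u : borel G) : \bar R :=
  \int[mu]_s (k ((u : G) + (s : G))%R * b s).

Definition ebilin k a b : \bar R := \int[mu]_u (a u * eform k b u).

Lemma measurable2_eform k b : measurable_fun setT k -> measurable_fun setT b ->
  measurable2 (fun u s : G => k (u + s)%R * b s).
Proof.
move=> mk mb; apply: emeasurable_funM.
- exact: (measurableT_comp mk (@measurable_add2 G)).
- exact: (measurableT_comp mb (@measurable_snd2 G)).
Qed.

Lemma eform_ge0 k b u : (forall s, 0 <= k s) -> (forall s, 0 <= b s) ->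
  0 <= eform k b u.
Proof. by move=> k0 b0; apply: integral_ge0 => s _; exact: mule_ge0. Qed.

Variables (S : set G) (sS : sigma_open mu S).

Lemma measurable_eform k b : measurable_fun setT k -> measurable_fun setT b ->
  (forall s, 0 <= k s) -> (forall s, 0 <= b s) -> supported S b ->
  measurable_fun setT (eform k b : borel G -> \bar R).
Proof.
move=> mk mb k0 b0 bS.
apply: (measurable_integral_sigma HG inner_mu sS (F := fun u s => k (u + s)%R * b s)).
- exact: measurable2_eform.
- by move=> u s; exact: mule_ge0.
- by move=> u s /bS ->; rewrite mule0.
Qed.

Lemma ebilin_double k a b : measurable_fun setT k -> measurable_fun setT b ->
  (forall s, 0 <= k s) -> (forall s, 0 <= b s) ->
  (forall s, 0 <= a s) ->
  ebilin k a b = \int[mu]_u \int[mu]_s (a u * (k ((u : G) + (s : G))%R * b s)).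
Proof.
move=> mk mb k0 b0 a0; apply: eq_integral => u _; rewrite ge0_integralZl//.
- exact: (measurable2_section1 _ (measurable2_eform mk mb)).
- by move=> s _; exact: mule_ge0.
Qed.

Lemma ebilin_sym k a b : measurable_fun setT k -> measurable_fun setT a ->
  measurable_fun setT b -> (forall s, 0 <= k s) -> (forall s, 0 <= a s) ->
  (forall s, 0 <= b s) -> supported S a ->
  supported S b ->
  ebilin k a b = ebilin k b a.
Proof.
move=> mk ma mb k0 a0 b0 aS bS.
rewrite (ebilin_double mk mb k0 b0 a0) (ebilin_double mk ma k0 a0 b0).
have [_ _ ->] : tonelli mu (fun u s => a u * (k (u + s)%R * b s)).
  apply: (tonelli_sigma HG inner_mu sS).
  - apply: emeasurable_funM; last exact: measurable2_eform.
    exact: (measurableT_comp ma (@measurable_fst2 G)).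
  - by move=> u s; apply: mule_ge0 => //; exact: mule_ge0.
  - move=> u s us; have [Su|/aS ->] := pselect (S u); last by rewrite mul0e.
    have [Ss|/bS ->] := pselect (S s); last by rewrite !mule0.
    by case: us.
apply: eq_integral => s _; apply: eq_integral => u _.
by rewrite muleCA [in RHS]muleCA [(_ + _)%R]addrC (muleC (a u)).
Qed.

Lemma econvolution_pairing k a b : measurable_fun setT k -> measurable_fun setT a ->
  measurable_fun setT b -> (forall s, 0 <= k s) -> (forall s, 0 <= a s) ->
  (forall s, 0 <= b s) -> supported S a ->
  supported S k ->
  \int[mu]_t (k t * \int[mu]_u (a u * b ((t : G) - (u : G))%R)) = ebilin k a b.
Proof.
move=> mk ma mb k0 a0 b0 aS kS.
have mab : measurable2 (fun t u : G => a u * b (t - u)%R).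
  apply: emeasurable_funM.
  - exact: (measurableT_comp ma (@measurable_snd2 G)).
  - exact: (measurableT_comp mb (@measurable_sub2 G)).
have mF : measurable2 (fun t u : G => k t * (a u * b (t - u)%R)).
  apply: emeasurable_funM => //.
  exact: (measurableT_comp mk (@measurable_fst2 G)).
have -> : \int[mu]_t (k t * \int[mu]_u (a u * b ((t : G) - (u : G))%R)) =
    \int[mu]_t \int[mu]_u (k t * (a u * b ((t : G) - (u : G))%R)).
  apply: eq_integral => t _; rewrite ge0_integralZl//.
  - exact: (measurable2_section1 t mab).
  - by move=> u _; exact: mule_ge0.
have [_ _ ->] : tonelli mu (fun t u : G => k t * (a u * b (t - u)%R)).
  apply: (tonelli_sigma HG inner_mu sS) => //.
  - by move=> u s; apply: mule_ge0 => //; exact: mule_ge0.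
  - move=> t u tu; have [St|/kS ->] := pselect (S t); last by rewrite mul0e.
    have [Su|/aS ->] := pselect (S u); last by rewrite mul0e mule0.
    by case: tu.
rewrite (ebilin_double mk mb k0 b0 a0); apply: eq_integral => u _.
rewrite -(ge0_integral_translation u
  (f := fun t => k t * (a u * b (t - (u : G))%R))).
- apply: eq_integral => s _; rewrite muleCA; congr (_ * (_ * b _)).
  by rewrite addrAC subrr add0r.
- exact: (measurable2_section2 u mF).
- by move=> s; apply: mule_ge0 => //; exact: mule_ge0.
Qed.

End NonnegativeForms.

Section ComplexForms.
Implicit Types k a b : borel G -> R[i].

(** Absolute convergence of the complex forms below is expressed by [eform] and
    [ebilin] on the moduli. *)
Definition nn a : borel G -> \bar R := fun s => (normc (a s))%:E.

Definition cform k b (u : borel G) : R[i] :=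
  cintegral mu (fun s : borel G => k ((u : G) + (s : G))%R * b s)%R.

Definition cbilin k a b : R[i] :=
  cintegral mu (fun u : borel G => a u * cform k b u)%R.

Lemma measurable_nn a : cmeasurable a -> measurable_fun setT (nn a).
Proof. by move=> ma; apply/measurable_EFinP; exact: cmeasurable_normc. Qed.

Lemma nn_ge0 a s : 0 <= nn a s.
Proof. by rewrite lee_fin normc_ge0. Qed.

Lemma nn_eq0 a s : a s = 0%R -> nn a s = 0.
Proof. by rewrite /nn => ->; rewrite normc0. Qed.

Lemma cmeasurable2_cform k b : cmeasurable k -> cmeasurable b ->
  cmeasurable2 (fun u s : G => k (u + s) * b s)%R.
Proof.
move=> mk mb; apply: cmeasurableM.
- exact: (cmeasurable_comp (@measurable_add2 G) mk).
- exact: (cmeasurable_comp (@measurable_snd2 G) mb).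
Qed.

Variables (S : set G) (sS : sigma_open mu S).

Lemma cmeasurable_cform k b : cmeasurable k -> cmeasurable b ->
  supported S b -> cmeasurable (cform k b : borel G -> R[i]).
Proof.
move=> mk mb bS.
apply: (csection_cmeasurable sS (cmeasurable2_cform mk mb)) => u s /bS ->.
by rewrite mulr0.
Qed.

Lemma le_normc_cform k b u : cmeasurable k -> cmeasurable b ->
  eform (nn k) (nn b) u < +oo ->
  cintegrable mu (fun s : borel G => k (u + (s : G)) * b s)%R /\
  (normc (cform k b u))%:E <= 2%:E * eform (nn k) (nn b) u.
Proof.
move=> mk mb fin.
have E : eform (nn k) (nn b) u =
    \int[mu]_s (normc (k ((u + (s : G)))%R * b s)%R)%:E.
  by apply: eq_integral => s _; rewrite /nn normcMr EFinM.
have ci : cintegrable mu (fun s : borel G => k (u + (s : G)) * b s)%R.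
  apply/cintegrableP; split; last by rewrite -E.
  exact: (cmeasurable2_section1 (F := fun u s : G => k (u + s) * b s)%R u
    (cmeasurable2_cform mk mb)).
by split => //; rewrite E; exact: normc_cintegral_le.
Qed.

Section Cbilin.
Variables k a b : borel G -> R[i].
Hypotheses (mk : cmeasurable k) (ma : cmeasurable a) (mb : cmeasurable b).
Hypotheses (aS : supported S a) (bS : supported S b).
Hypothesis fin : ebilin (nn k) (nn a) (nn b) < +oo.

Let F (u s : G) : R[i] := (a u * (k (u + s) * b s))%R.

Let mF : cmeasurable2 F.
Proof.
apply: cmeasurableM; last exact: cmeasurable2_cform.
exact: (cmeasurable_comp (@measurable_fst2 G) ma).
Qed.

Let FS u s : ~ (S u /\ S s) -> F u s = 0%R.
Proof.
move=> us; rewrite /F; have [Su|/aS ->] := pselect (S u); last by rewrite mul0r.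
have [Ss|/bS ->] := pselect (S s); last by rewrite !mulr0.
by case: us.
Qed.

Let Ffin : \int[mu]_u \int[mu]_s (normc (F u s))%:E < +oo.
Proof.
move: fin; rewrite (ebilin_double (measurable_nn mk) (measurable_nn mb)
  (@nn_ge0 k) (@nn_ge0 b) (@nn_ge0 a)).
rewrite (_ : (fun u => \int[mu]_s (nn a u * _)) =
  (fun u => \int[mu]_s (normc (F u s))%:E))//.
apply/funext => u; apply: eq_integral => s _.
by rewrite /nn /F !normcMr !EFinM.
Qed.

Let mcF : cmeasurable (fun u : borel G => cintegral mu (F u : borel G -> R[i])).
Proof.
by apply: (csection_cmeasurable sS mF) => u s /bS; rewrite /F => ->; rewrite !mulr0.
Qed.

Let mint : cmeasurable (fun u : borel G => a u * cform k b u)%R.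
Proof. by apply: cmeasurableM => //; exact: cmeasurable_cform. Qed.

Let FE : {ae mu, forall u : borel G, cintegral mu (F u : borel G -> R[i]) = (a u * cform k b u)%R}.
Proof.
have [aeF _ _] := cfubini sS mF FS Ffin.
by apply: filterS aeF => u iF; exact: (cintegralZW iF).
Qed.

Lemma cbilin_double : cbilin k a b =
  cintegral mu (fun u : borel G => cintegral mu (fun s : borel G => F u s)).
Proof. by apply/esym/ae_eq_cintegral. Qed.

Lemma cbilin_swap : cbilin k a b =
  cintegral mu (fun s : borel G => cintegral mu (fun u : borel G => F u s)).
Proof. by rewrite cbilin_double; case: (cfubini sS mF FS Ffin). Qed.

Lemma cbilin_cintegrable : cintegrable mu (fun u : borel G => a u * cform k b u)%R.
Proof.
have [_ /cintegrableP[_ iF] _] := cfubini sS mF FS Ffin.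
apply/cintegrableP; split => //; apply: le_lt_trans iF.
rewrite le_eqVlt; apply/orP; left; apply/eqP.
apply: ge0_ae_eq_integral => //.
- by apply/measurable_EFinP; exact: (cmeasurable_normc mint).
- by apply/measurable_EFinP; exact: (cmeasurable_normc mcF).
- by move=> u _; rewrite lee_fin normc_ge0.
- by move=> u _; rewrite lee_fin normc_ge0.
- by apply: filterS FE => u uE _; rewrite uE.
Qed.

End Cbilin.

Lemma cbilin_sym k a b : cmeasurable k -> cmeasurable a -> cmeasurable b ->
  supported S a -> supported S b ->
  ebilin (nn k) (nn a) (nn b) < +oo -> cbilin k a b = cbilin k b a.
Proof.
move=> mk ma mb aS bS fin.
have fin' : ebilin (nn k) (nn b) (nn a) < +oo.
  rewrite -(ebilin_sym sS (measurable_nn mk) (measurable_nn ma) (measurable_nn mb)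
    (@nn_ge0 k) (@nn_ge0 a) (@nn_ge0 b)) // => s; [move/aS|move/bS]; exact: nn_eq0.
rewrite (cbilin_swap mk ma mb aS bS fin) (cbilin_double mk mb ma bS aS fin').
apply: eq_cintegral => s; apply: eq_cintegral => u.
by rewrite mulrCA [in RHS]mulrCA addrC (mulrC (a u)).
Qed.

Lemma cconvolution_pairing k a b h : cmeasurable k -> cmeasurable a ->
  cmeasurable b -> cmeasurable h ->
  supported S a -> supported S b ->
  supported S k ->
  {ae mu, forall t : borel G,
    let F (u : borel G) := (a u * b ((t : G) - (u : G)))%R in
    cintegrable mu F /\ h t = cintegral mu F} ->
  ebilin (nn k) (nn a) (nn b) < +oo ->
  cintegral mu (fun t => k t * h t)%R = cbilin k a b.
Proof.
move=> mk ma mb mh aS bS kS hE fin.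
have mab : cmeasurable2 (fun t u : G => a u * b (t - u))%R.
  apply: cmeasurableM.
  - exact: (cmeasurable_comp (@measurable_snd2 G) ma).
  - exact: (cmeasurable_comp (@measurable_sub2 G) mb).
pose F (t u : G) : R[i] := (k t * (a u * b (t - u)))%R.
have mF : cmeasurable2 F.
  apply: cmeasurableM => //.
  exact: (cmeasurable_comp (@measurable_fst2 G) mk).
have FS t u : ~ (S t /\ S u) -> F t u = 0%R.
  move=> tu; rewrite /F; have [St|/kS ->] := pselect (S t); last by rewrite mul0r.
  have [Su|/aS ->] := pselect (S u); last by rewrite mul0r mulr0.
  by case: tu.
have Ffin : \int[mu]_t \int[mu]_u (normc (F t u))%:E < +oo.
  move: fin; rewrite -(econvolution_pairing sS (measurable_nn mk) (measurable_nn ma)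
    (measurable_nn mb) (@nn_ge0 k) (@nn_ge0 a) (@nn_ge0 b)
    (fun s Ss => nn_eq0 (aS s Ss)) (fun s Ss => nn_eq0 (kS s Ss))).
  rewrite (_ : (fun t => nn k t * _) = (fun t => \int[mu]_u (normc (F t u))%:E))//.
  apply/funext => t; rewrite -ge0_integralZl//.
  - by apply: eq_integral => u _; rewrite /nn /F !normcMr !EFinM.
  - apply: emeasurable_funM; first exact: measurable_nn.
    apply: measurable_nn; exact: (cmeasurable_comp (@measurable_sub1 G t) mb).
  - by move=> u _; rewrite mule_ge0// nn_ge0.
  - exact: nn_ge0.
have [aeF _ EF] := cfubini sS mF FS Ffin.
transitivity (cintegral mu (fun t : borel G => cintegral mu (F t : borel G -> R[i]))).
  apply: ae_eq_cintegral.
  - exact: cmeasurableM.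
  - apply: (csection_cmeasurable sS mF) => t u /aS.
    by rewrite /F => ->; rewrite mul0r mulr0.
  - apply: filterS2 aeF hE => t iF [_ ->].
    by rewrite (cintegralZW iF).
rewrite EF (cbilin_double mk ma mb aS bS fin).
apply: eq_cintegral => u.
rewrite -(cintegral_translation u
  (cmeasurable2_section2 u mF)).
apply: eq_cintegral => s; rewrite /F mulrCA; congr (_ * (_ * b _))%R.
by rewrite addrAC subrr add0r.
Qed.

End ComplexForms.

End Forms.

(** * Leibniz rule *)

Section Leibniz.
Local Open Scope ereal_scope.
Implicit Types k a b p x h l c : borel G -> R[i].

Definition shift T (k : borel G -> T) (u : G) : borel G -> T :=
  fun t : borel G => k (u + (t : G))%R.

Lemma cmeasurable_shift k u : cmeasurable k -> cmeasurable (shift k u).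
Proof. by move=> mk; exact: (cmeasurable_comp (measurable_addl u) mk). Qed.

Lemma cform_shift k u b s : cform (shift k u) b s = cform k b (u + s)%R.
Proof. by apply: eq_cintegral => t; rewrite /shift addrA. Qed.

Lemma eform_shift (k b : borel G -> \bar R) u s :
  eform (shift k u) b s = eform k b (u + s)%R.
Proof. by apply: eq_integral => t _; rewrite /shift addrA. Qed.

(** A pairing with a triple convolution becomes a bilinear form with kernel
    [cform k b]. *)
Lemma cbilin_shift k u p b : cbilin (shift k u) p b = cform (cform k b) p u.
Proof. by apply: eq_cintegral => s; rewrite cform_shift mulrC. Qed.

Lemma ebilin_shift (k b p : borel G -> \bar R) u :
  ebilin (shift k u) p b = eform (eform k b) p u.
Proof. by apply: eq_integral => s _; rewrite eform_shift muleC. Qed.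

Lemma sigma_open_shift (O : set G) u : open O -> mu O < +oo ->
  sigma_open mu (fun t => O (u + t)%R).
Proof.
move=> oO fO; apply: sigma_open_open.
- apply: (@open_comp _ _ (fun t : G => u + t)%R O) => // t _.
  exact: addl_continuous.
- by rewrite (measure_preimage_translation)//; exact: measurable_open.
Qed.

Lemma ae_finite_or_zero (f g : borel G -> \bar R) :
  measurable_fun setT f -> measurable_fun setT g ->
  (forall s, 0 <= f s) -> (forall s, 0 <= g s) ->
  \int[mu]_s (f s * g s) < +oo ->
  {ae mu, forall s, f s = 0 \/ g s < +oo}.
Proof.
move=> mf mg f0 g0 fin.
have i : mu.-integrable setT (fun s => f s * g s).
  apply/integrableP; split; first exact: emeasurable_funM.
  by under eq_integral do rewrite gee0_abs ?mule_ge0//.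
apply: filterS (integrable_ae measurableT i) => s /(_ I).
have [->|fs] := eqVneq (f s) 0; first by left.
have f1 : 0 < f s by rewrite lt0e fs f0.
have := leey (g s); rewrite le_eqVlt => /predU1P[->|]; last by right.
by rewrite gt0_muley.
Qed.

Lemma nn_eq0P a s : nn a s = 0 -> a s = 0%R.
Proof. by rewrite /nn => -[] /ComplexField.Normc.eq0_normc. Qed.

Variables (O : set G) (oO : open O) (fO : mu O < +oo).
Variables (kappa : borel G -> R[i]) (mkappa : cmeasurable kappa).
Hypothesis kappaO : supported O kappa.
Variables (S : set G) (sS : sigma_open mu S).

Local Notation K := (nn kappa).

Let SO u := S `|` (fun t => O (u + t)%R).
Let sSO u : sigma_open mu (SO u).
Proof. by apply: sigma_openU => //; exact: sigma_open_shift. Qed.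
Let widen u a : supported S a -> supported (SO u) a.
Proof. exact: supportedUl. Qed.
Let kappaSO u s : ~ SO u s -> shift kappa u s = 0%R.
Proof. by move=> /not_orP[_ /kappaO]. Qed.
Let mK : measurable_fun setT K. Proof. exact: measurable_nn. Qed.
Let K0 s : 0 <= K s. Proof. exact: nn_ge0. Qed.

Definition convolution_spec a b h := {ae mu, forall t : borel G,
    let F (u : borel G) := (a u * b ((t : G) - (u : G)))%R in
    cintegrable mu F /\ h t = cintegral mu F}.

Lemma nn_le_cform b s : cmeasurable b ->
  nn (cform kappa b) s <= 2%:E * eform K (nn b) s.
Proof.
move=> mb.
have h0 : 0 <= eform K (nn b) s by apply: eform_ge0 => // t; exact: nn_ge0.
have := leey (eform K (nn b) s); rewrite le_eqVlt => /predU1P[->|fin].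
  by rewrite gt0_muley ?leey.
by have [] := le_normc_cform mkappa mb fin.
Qed.

Lemma measurable_eformK b : cmeasurable b -> supported S b ->
  measurable_fun setT (eform K (nn b)).
Proof.
move=> mb bS; apply: (measurable_eform sS) => //.
- exact: measurable_nn.
- by move=> s; exact: nn_ge0.
- by move=> s /bS; exact: nn_eq0.
Qed.

Lemma eformK_ge0 b s : 0 <= eform K (nn b) s.
Proof. by apply: eform_ge0 => // t; exact: nn_ge0. Qed.

Lemma ebilin_cform_fin b p x : cmeasurable b -> cmeasurable p -> cmeasurable x ->
  supported S b -> supported S x ->
  ebilin (eform K (nn b)) (nn p) (nn x) < +oo ->
  ebilin (nn (cform kappa b)) (nn p) (nn x) < +oo.
Proof.
move=> mb mp mx bS xS fin.
have meb := measurable_eformK mb bS.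
have eb0 := eformK_ge0 b.
have mcb : measurable_fun setT (nn (cform kappa b)).
  by apply: measurable_nn; exact: (cmeasurable_cform sS).
have mnx := measurable_nn mx; have mnp := measurable_nn mp.
have xS' s : ~ S s -> nn x s = 0 by move/xS; exact: nn_eq0.
have mf1 := measurable_eform sS mcb mnx (nn_ge0 _) (nn_ge0 x) xS'.
have mf2 := measurable_eform sS meb mnx eb0 (nn_ge0 x) xS'.
have f20 u : 0 <= eform (eform K (nn b)) (nn x) u by apply: eform_ge0 => // s; exact: nn_ge0.
apply: (@le_lt_trans _ _ (2%:E * ebilin (eform K (nn b)) (nn p) (nn x))).
  rewrite /ebilin -ge0_integralZl//; last 2 first.
  - exact: emeasurable_funM.
  - by move=> u _; rewrite mule_ge0// nn_ge0.
  apply: ge0_le_integral => //.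
  - by move=> u _; rewrite mule_ge0 ?nn_ge0// eform_ge0// => s; exact: nn_ge0.
  - exact: emeasurable_funM.
  - by apply: measurable_funeM; exact: emeasurable_funM.
  - move=> u _; rewrite [leRHS]muleCA lee_wpmul2l ?nn_ge0//.
    rewrite /eform -ge0_integralZl//; last 2 first.
    + exact: (measurable2_section1 u (measurable2_eform meb mnx)).
    + by move=> s _; apply: mule_ge0; [exact: eb0|exact: nn_ge0].
    apply: ge0_le_integral => //.
    + by move=> s _; rewrite mule_ge0 ?nn_ge0.
    + exact: (measurable2_section1 u (measurable2_eform mcb mnx)).
    + by apply: measurable_funeM; exact: (measurable2_section1 u (measurable2_eform meb mnx)).
    + by move=> s _; rewrite muleA lee_wpmul2r ?nn_ge0// nn_le_cform.
by rewrite lte_mul_pinfty// ?lee_fin.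
Qed.

Lemma ae_eform_finite b p x : cmeasurable b -> cmeasurable p -> cmeasurable x ->
  supported S b -> supported S x ->
  ebilin (eform K (nn b)) (nn p) (nn x) < +oo ->
  {ae mu, forall u, p u = 0%R \/ eform (eform K (nn b)) (nn x) u < +oo}.
Proof.
move=> mb mp mx bS xS fin.
have meb := measurable_eformK mb bS.
have mex : measurable_fun setT (eform (eform K (nn b)) (nn x)).
  apply: (measurable_eform sS meb (measurable_nn mx)).
  - exact: eformK_ge0.
  - exact: nn_ge0.
  - by move=> s /xS; exact: nn_eq0.
have ex0 u : 0 <= eform (eform K (nn b)) (nn x) u.
  by apply: eform_ge0; [exact: eformK_ge0|exact: nn_ge0].
have := ae_finite_or_zero (measurable_nn mp) mex (nn_ge0 p) ex0 fin.
by apply: filterS => u [/nn_eq0P|]; [left|right].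
Qed.

(** The pairing with the convolution of [p], [x] and [a], through the convolution
    of the last two; in [cbilin_convolution_left] the kernel absorbs the first
    factor of that convolution instead. *)
Lemma cbilin_convolution_right p x a l :
  cmeasurable p -> cmeasurable x -> cmeasurable a -> cmeasurable l ->
  supported S x ->
  supported S a -> supported S l ->
  convolution_spec x a l ->
  ebilin (eform K (nn a)) (nn p) (nn x) < +oo ->
  cbilin kappa p l = cbilin (cform kappa a) p x.
Proof.
move=> mp mx ma ml xS aS lS lE fin.
have mca : cmeasurable (cform kappa a) by exact: (cmeasurable_cform sS).
apply: ae_eq_cintegral.
- by apply: cmeasurableM => //; exact: (cmeasurable_cform sS).
- by apply: cmeasurableM => //; exact: (cmeasurable_cform sS).
apply: filterS (ae_eform_finite ma mp mx aS xS fin) => u [->|finu]; first by rewrite !mul0r.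
congr (_ * _)%R; rewrite -cbilin_shift.
apply: (cconvolution_pairing (sSO u)
  (cmeasurable_shift u mkappa) mx ma ml (widen xS) (widen aS) (@kappaSO u) lE).
by rewrite -(ebilin_shift K) in finu.
Qed.

Lemma cbilin_convolution_left p b x k :
  cmeasurable p -> cmeasurable b -> cmeasurable x -> cmeasurable k ->
  supported S b ->
  supported S x -> supported S k ->
  convolution_spec b x k ->
  ebilin (eform K (nn b)) (nn p) (nn x) < +oo ->
  cbilin kappa p k = cbilin (cform kappa b) p x.
Proof.
move=> mp mb mx ml bS xS lS lE fin.
have mca : cmeasurable (cform kappa b) by exact: (cmeasurable_cform sS).
apply: ae_eq_cintegral.
- by apply: cmeasurableM => //; exact: (cmeasurable_cform sS).
- by apply: cmeasurableM => //; exact: (cmeasurable_cform sS).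
apply: filterS (ae_eform_finite mb mp mx bS xS fin) => u [->|finu]; first by rewrite !mul0r.
have mku := cmeasurable_shift u mkappa.
have finu1 : ebilin (nn (shift kappa u)) (nn x) (nn b) < +oo.
  by rewrite -(ebilin_shift K) in finu.
have finu2 : ebilin (nn (shift kappa u)) (nn b) (nn x) < +oo.
  rewrite (ebilin_sym sS (measurable_nn mku) (measurable_nn mb)
    (measurable_nn mx) (nn_ge0 _) (nn_ge0 _) (nn_ge0 _)) // => s;
    [move/bS|move/xS]; exact: nn_eq0.
congr (_ * _)%R; rewrite -cbilin_shift -(cbilin_sym sS mku mb mx bS xS finu2).
exact: (cconvolution_pairing (sSO u)
  mku mb mx ml (widen bS) (widen xS) (@kappaSO u) lE finu2).
Qed.

Section Derivation.
Variable xi : {additive G -> R[i]}.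
Hypothesis mxi : cmeasurable (xi : borel G -> R[i]).

Definition xi_mul a : borel G -> R[i] := fun s => (xi s * a s)%R.

Lemma cmeasurable_xi_mul a : cmeasurable a -> cmeasurable (xi_mul a).
Proof. by move=> ma; exact: cmeasurableM. Qed.

Lemma xi_mul_supp a : supported S a ->
  supported S (xi_mul a).
Proof. by move=> aS s /aS; rewrite /xi_mul => ->; rewrite mulr0. Qed.

(** The kernel splits because [xi (u + s) = xi u + xi s]: multiplication by [xi]
    is a derivation for convolution, tested against [k]. *)
Lemma cbilin_xi k a b : cmeasurable k -> cmeasurable a -> cmeasurable b ->
  supported S a -> supported S b ->
  ebilin (nn k) (nn (xi_mul a)) (nn b) < +oo ->
  ebilin (nn k) (nn a) (nn (xi_mul b)) < +oo ->
  ebilin (nn (xi_mul k)) (nn a) (nn b) < +oo /\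
  cbilin (xi_mul k) a b = (cbilin k (xi_mul a) b + cbilin k a (xi_mul b))%R.
Proof.
move=> mk ma mb aS bS fin1 fin2.
have mxa := cmeasurable_xi_mul ma; have mxb := cmeasurable_xi_mul mb.
have mxk := cmeasurable_xi_mul mk.
have xaS := xi_mul_supp aS; have xbS := xi_mul_supp bS.
pose F1 (u s : G) : R[i] := (xi_mul a u * (k (u + s) * b s))%R.
pose F2 (u s : G) : R[i] := (a u * (k (u + s) * xi_mul b s))%R.
pose F (u s : G) : R[i] := (a u * (xi_mul k (u + s) * b s))%R.
have FE u s : F u s = (F1 u s + F2 u s)%R.
  by rewrite /F /F1 /F2 /xi_mul raddfD; ring.
have mF1 : cmeasurable2 F1.
  apply: cmeasurableM; last exact: cmeasurable2_cform.
  exact: (cmeasurable_comp (@measurable_fst2 G) mxa).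
have mF2 : cmeasurable2 F2.
  apply: cmeasurableM; last exact: cmeasurable2_cform.
  exact: (cmeasurable_comp (@measurable_fst2 G) ma).
have nnE k' a' b' : cmeasurable k' -> cmeasurable b' ->
    ebilin (nn k') (nn a') (nn b') = \int[mu]_u \int[mu]_s
      (normc (a' u * (k' ((u : G) + (s : G)) * b' s)))%:E.
  move=> mk' mb'; rewrite (ebilin_double (measurable_nn mk') (measurable_nn mb')
    (nn_ge0 k') (nn_ge0 b') (nn_ge0 a')).
  apply: eq_integral => u _; apply: eq_integral => s _.
  by rewrite /nn !normcMr !EFinM.
have suppF (f g : G -> R[i]) (h : G -> G -> R[i]) :
    supported S f -> supported S g ->
    forall u s, ~ (S u /\ S s) -> (f u * (h u s * g s))%R = 0%R.
  move=> fS gS u s us; have [Su|/fS ->] := pselect (S u); last by rewrite mul0r.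
  have [Ss|/gS ->] := pselect (S s); last by rewrite !mulr0.
  by case: us.
have F1S := suppF _ _ (fun u s => k (u + s)%R) xaS bS.
have F2S := suppF _ _ (fun u s => k (u + s)%R) aS xbS.
have F1fin : \int[mu]_u \int[mu]_s (normc (F1 u s))%:E < +oo.
  by move: fin1; rewrite nnE.
have F2fin : \int[mu]_u \int[mu]_s (normc (F2 u s))%:E < +oo.
  by move: fin2; rewrite nnE.
have tnn (H : G -> G -> R[i]) : cmeasurable2 H ->
    (forall u s, ~ (S u /\ S s) -> H u s = 0%R) ->
    measurable_fun setT (fun u : borel G => \int[mu]_s (normc (H u s))%:E).
  move=> mH HS.
  have [] // : tonelli mu (fun u s => (normc (H u s))%:E).
  apply: (tonelli_sigma HG inner_mu sS (cmeasurable2_normc mH)).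
  - by move=> u s; rewrite lee_fin normc_ge0.
  - by move=> u s /HS ->; rewrite normc0.
have fin : ebilin (nn (xi_mul k)) (nn a) (nn b) < +oo.
  rewrite (nnE (xi_mul k) a b mxk mb).
  apply: le_lt_trans (lte_add_pinfty F1fin F2fin).
  have mF : cmeasurable2 F.
    apply: cmeasurableM; last exact: cmeasurable2_cform.
    exact: (cmeasurable_comp (@measurable_fst2 G) ma).
  have FS := suppF _ _ (fun u s => xi_mul k (u + s)%R) aS bS.
  have t1 := tnn _ mF1 F1S; have t2 := tnn _ mF2 F2S; have t := tnn _ mF FS.
  rewrite -ge0_integralD//; last 2 first.
  - by move=> u _; apply: integral_ge0 => s _; rewrite lee_fin normc_ge0.
  - by move=> u _; apply: integral_ge0 => s _; rewrite lee_fin normc_ge0.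
  apply: ge0_le_integral => //.
  - by move=> u _; apply: integral_ge0 => s _; rewrite lee_fin normc_ge0.
  - exact: emeasurable_funD.
  have sec (H : G -> G -> R[i]) u : cmeasurable2 H ->
      measurable_fun setT (fun s : borel G => (normc (H u s))%:E).
    by move=> mH; apply/measurable_EFinP; apply: cmeasurable_normc; exact: (cmeasurable2_section1 u mH).
  move=> u _; rewrite -ge0_integralD//; last 4 first.
  - by move=> s _; rewrite lee_fin normc_ge0.
  - exact: sec.
  - by move=> s _; rewrite lee_fin normc_ge0.
  - exact: sec.
  apply: ge0_le_integral => //.
  - by move=> s _; rewrite lee_fin normc_ge0.
  - exact: (sec F).
  - by apply: emeasurable_funD; exact: sec.
  - by move=> s _; rewrite -/(F u s) FE -EFinD lee_fin normc_add.
split => //.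
rewrite (cbilin_double sS mxk ma mb aS bS fin).
rewrite (cbilin_double sS mk mxa mb xaS bS fin1).
rewrite (cbilin_double sS mk ma mxb aS xbS fin2).
have [ae1 i1 _] := cfubini sS mF1 F1S F1fin.
have [ae2 i2 _] := cfubini sS mF2 F2S F2fin.
rewrite -(cintegralD i1 i2).
apply: ae_eq_cintegral.
- apply: (csection_cmeasurable sS (F := F)).
    apply: cmeasurableM; last exact: cmeasurable2_cform.
    exact: (cmeasurable_comp (@measurable_fst2 G) ma).
  by move=> u s /bS; rewrite /F => ->; rewrite !mulr0.
- by case/cintegrableP: (cintegrableD i1 i2).
- apply: filterS2 ae1 ae2 => u iu1 iu2; rewrite -(cintegralD iu1 iu2).
  by apply: eq_cintegral => s; exact: FE.
Qed.

(** All three terms are integrals against [x s]. For fixed [s], the first one is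
    the pairing of [xi] times the translate of [kappa] by [s] with the
    convolution of [a] and [b], which [cbilin_xi] splits. *)
Lemma cbilin_leibniz a b x h k l :
  cmeasurable a -> cmeasurable b -> cmeasurable x ->
  cmeasurable h -> cmeasurable k -> cmeasurable l ->
  supported S a -> supported S b ->
  supported S x -> supported S h ->
  supported S k -> supported S l ->
  convolution_spec a b h -> convolution_spec b x k -> convolution_spec x a l ->
  ebilin (eform K (nn b)) (nn (xi_mul a)) (nn x) < +oo ->
  ebilin (eform K (nn a)) (nn (xi_mul b)) (nn x) < +oo ->
  ebilin K (nn (xi_mul h)) (nn x) < +oo ->
  cbilin kappa (xi_mul h) x =
  (cbilin kappa (xi_mul b) l + cbilin kappa (xi_mul a) k)%R.
Proof.
move=> ma mb mx mh mk ml aS bS xS hS kS lS hE kE lE T1 T2 T3.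
have mxa := cmeasurable_xi_mul ma; have mxb := cmeasurable_xi_mul mb.
have mxh := cmeasurable_xi_mul mh.
have xaS := xi_mul_supp aS; have xbS := xi_mul_supp bS; have xhS := xi_mul_supp hS.
rewrite (cbilin_convolution_right mxb mx ma ml xS aS lS lE T2).
rewrite (cbilin_convolution_left mxa mb mx mk bS xS kS kE T1).
rewrite (cbilin_sym sS mkappa mxh mx xhS xS T3).
have mca := cmeasurable_cform sS mkappa ma aS.
have mcb := cmeasurable_cform sS mkappa mb bS.
have F1 := ebilin_cform_fin mb mxa mx bS xS T1.
have F2 := ebilin_cform_fin ma mxb mx aS xS T2.
rewrite (cbilin_sym sS mca mxb mx xbS xS F2).
rewrite (cbilin_sym sS mcb mxa mx xaS xS F1).
have sy (k' : borel G -> \bar R) p : measurable_fun setT k' -> (forall t, 0 <= k' t) ->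
    cmeasurable p -> supported S p -> ebilin k' (nn p) (nn x) = ebilin k' (nn x) (nn p).
  move=> mk' k0' mp pS.
  apply: (ebilin_sym sS mk' (measurable_nn mp) (measurable_nn mx) k0' (nn_ge0 _) (nn_ge0 _)) => s.
    by move/pS; exact: nn_eq0.
  by move/xS; exact: nn_eq0.
rewrite (sy _ _ (measurable_eformK mb bS) (eformK_ge0 b) mxa xaS) in T1.
rewrite (sy _ _ (measurable_eformK ma aS) (eformK_ge0 a) mxb xbS) in T2.
have zero3 (y y1 y2 : R[i]) : (0 * y = 0 * y1 + 0 * y2)%R by rewrite !mul0r addr0.
rewrite (sy _ _ (measurable_nn mcb) (nn_ge0 _) mxa xaS) in F1.
rewrite (sy _ _ (measurable_nn mca) (nn_ge0 _) mxb xbS) in F2.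
have i1 := cbilin_cintegrable sS mcb mx mxa xS xaS F1.
have i2 := cbilin_cintegrable sS mca mx mxb xS xbS F2.
rewrite /cbilin -(cintegralD i2 i1).
apply: ae_eq_cintegral.
- by apply: cmeasurableM => //; exact: (cmeasurable_cform sS).
- by case/cintegrableP: (cintegrableD i2 i1).
apply: filterS2 (ae_eform_finite mb mx mxa bS xaS T1)
  (ae_eform_finite ma mx mxb aS xbS T2) => s [->|fin1]; first by move=> _; exact: zero3.
move=> [->|fin2]; first exact: zero3.
refine (etrans _ (mulrDr _ _ _)); congr (_ * _)%R.
have mks := cmeasurable_shift s mkappa.
have fin1' : ebilin (nn (shift kappa s)) (nn (xi_mul a)) (nn b) < +oo.
  by rewrite -(ebilin_shift K) in fin1.
have fin2r : ebilin (nn (shift kappa s)) (nn (xi_mul b)) (nn a) < +oo.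
  by rewrite -(ebilin_shift K) in fin2.
have fin2' : ebilin (nn (shift kappa s)) (nn a) (nn (xi_mul b)) < +oo.
  rewrite (ebilin_sym sS (measurable_nn mks) (measurable_nn ma)
    (measurable_nn mxb) (nn_ge0 _) (nn_ge0 _) (nn_ge0 _)) // => t;
    [move/aS|move/xbS]; exact: nn_eq0.
have [fin E] := cbilin_xi mks ma mb aS bS fin1' fin2'.
transitivity (cintegral mu (fun t => xi_mul (shift kappa s) t * h t)%R).
  by apply: eq_cintegral => t; rewrite /xi_mul /shift; ring.
rewrite (cconvolution_pairing (sSO s)
  (cmeasurable_xi_mul mks) ma mb mh (widen aS) (widen bS) _ hE fin).
  rewrite E (cbilin_sym sS mks ma mxb aS xbS fin2').
  by rewrite !cbilin_shift; exact: addrC.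
by move=> t /kappaSO; rewrite /xi_mul => ->; rewrite mulr0.
Qed.

End Derivation.

End Leibniz.

(** * Convolutions of nonnegative functions *)

Section PositiveConvolution.
Local Open Scope ereal_scope.

(** By translation invariance the integral of the indicator function of [N] at
    [s - t] over [D] and [S] vanishes. *)
Lemma ae_sub_null (N S D : set G) : measurable (N : set (borel G)) -> mu N = 0 ->
  sigma_open mu S -> sigma_open mu D ->
  {ae mu, forall s : borel G, D s -> {ae mu, forall t : borel G, S t -> ~ N ((s : G) - (t : G))%R}}.
Proof.
move=> mN N0 sS sD.
have meas A : sigma_open mu A -> measurable (A : set (borel G)).
  by move=> [S_ [oS _ _ ->]]; apply: bigcupT_measurable => n; exact: measurable_open.
pose i (A : set G) : borel G -> \bar R := fun s => (\1_A s)%:E.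
have mi A : measurable (A : set (borel G)) -> measurable_fun setT (i A).
  by move=> mA; apply/measurable_EFinP; exact: measurable_indic.
have i0 A s : 0 <= i A s by rewrite lee_fin.
have miS := mi _ (meas _ sS); have miD := mi _ (meas _ sD); have miN := mi _ mN.
have sSD := sigma_openU sS sD.
have off A B s : ~ (A `|` B) s -> i A s = 0 /\ i B s = 0.
  by move=> /not_orP[As Bs]; rewrite /i !indicE !memNset.
have mg : measurable2 (fun s t : G => i S t * i N (s - t)%R).
  apply: emeasurable_funM.
  - exact: (measurableT_comp miS (@measurable_snd2 G)).
  - exact: (measurableT_comp miN (@measurable_sub2 G)).
have mgi : measurable_fun setT
    (fun s : borel G => \int[mu]_t (i S t * i N ((s : G) - (t : G))%R)).
  apply: (measurable_integral_sigma HG inner_mu sS mg).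
  - by move=> s t; rewrite mule_ge0.
  - by move=> s t St; rewrite /i indicE memNset// mul0e.
have Z : \int[mu]_s (i D s * \int[mu]_t (i S t * i N ((s : G) - (t : G))%R)) = 0.
  rewrite (econvolution_pairing sSD miD miS miN (i0 D) (i0 S) (i0 N)).
  - rewrite /ebilin integral0_eq// => u _.
    rewrite [X in _ * X](_ : _ = 0) ?mule0//.
    apply/eqP; rewrite eq_le eform_ge0// andbT.
    apply: (@le_trans _ _ (\int[mu]_s i N s)).
      apply: ge0_le_integral => //.
      + by move=> s _; rewrite mule_ge0.
      + exact: (measurable2_section1 u (measurable2_eform miD miN)).
      + by move=> s _; rewrite -[leRHS]mul1e lee_wpmul2r// lee_fin indicE; case: (_ \in D).
    by rewrite integral_indic// setIT N0.
  - by move=> s /off[].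
  - by move=> s /off[].
have mF : measurable_fun setT
    (fun s : borel G => i D s * \int[mu]_t (i S t * i N ((s : G) - (t : G))%R)).
  exact: emeasurable_funM.
have F0 (s : borel G) : 0 <= i D s * \int[mu]_t (i S t * i N ((s : G) - (t : G))%R).
  by rewrite mule_ge0// integral_ge0// => t _; rewrite mule_ge0.
have := (ae_eq_integral_abs mu measurableT mF).1.
under eq_integral do rewrite gee0_abs//.
move=> /(_ Z); apply: filterS => s /(_ I) + Ds.
rewrite {1}/i indicE mem_set// mul1e => Zs.
have mgs : measurable_fun setT (fun t : borel G => i S t * i N ((s : G) - (t : G))%R).
  exact: (measurable2_section1 s mg).
have := (ae_eq_integral_abs mu measurableT mgs).1.
under eq_integral do rewrite gee0_abs ?mule_ge0//.
move=> /(_ Zs); apply: filterS => t /(_ I) + St.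
rewrite /i !indicE (mem_set St) mul1e => /eqP.
have [//|/negP] := boolP ((s : G) - (t : G) \in N)%R; first by rewrite eqe oner_eq0.
by move=> nN _ Nst; apply: nN; rewrite inE.
Qed.

Definition ae_nonneg (f : borel G -> R[i]) :=
  {ae mu, forall s, f s = (normc (f s))%:C%C}.

Variables (O : set G) (oO : open O) (fO : mu O < +oo).
Variables (kappa : borel G -> R[i]) (mkappa : cmeasurable kappa).
Hypothesis kappaO : supported O kappa.
Local Notation K := (nn kappa).

(** The convolution of nonnegative functions has the integral of their moduli as
    its modulus, so that a form in [y] is an absolutely convergent triple
    integral. Nonnegativity holds only outside a null set [N], and [ae_sub_null]
    is applied to it. *)
Lemma eform_positive_convolution (S : set G) (x c y : borel G -> R[i]) (u : G) :
  sigma_open mu S -> cmeasurable x -> cmeasurable c -> cmeasurable y ->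
  supported S x -> ae_nonneg x -> ae_nonneg c ->
  convolution_spec x c y ->
  eform K (nn y) u = eform (eform K (nn c)) (nn x) u.
Proof.
move=> sS mx mc my xS x0 c0 yE.
have sD : sigma_open mu (fun t => O (u + t)%R) by exact: (sigma_open_shift).
have sSD := sigma_openU sS sD.
have mks := cmeasurable_shift u mkappa.
rewrite -ebilin_shift.
have xS' s : ~ (S `|` (fun t => O (u + t)%R)) s -> nn x s = 0.
  by move=> /not_orP[Ss _]; apply: nn_eq0; exact: xS.
have kS' s : ~ (S `|` (fun t => O (u + t)%R)) s -> nn (shift kappa u) s = 0.
  by move=> /not_orP[_ Os]; apply: nn_eq0; exact: kappaO.
rewrite -(econvolution_pairing sSD (measurable_nn mks)
  (measurable_nn mx) (measurable_nn mc) (nn_ge0 _) (nn_ge0 _) (nn_ge0 _) xS' kS').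
have [N [mN N0 cN]] := c0.
have aeN := ae_sub_null mN N0 sS sD.
have mg : measurable2 (fun t v : G => nn x v * nn c (t - v)%R).
  apply: emeasurable_funM.
  - exact: (measurableT_comp (measurable_nn mx) (@measurable_snd2 G)).
  - exact: (measurableT_comp (measurable_nn mc) (@measurable_sub2 G)).
have mgi : measurable_fun setT
    (fun t : borel G => \int[mu]_v (nn x v * nn c ((t : G) - (v : G))%R)).
  apply: (measurable_integral_sigma HG inner_mu sS mg).
  - by move=> t v; rewrite mule_ge0 ?nn_ge0.
  - by move=> t v Sv; rewrite (nn_eq0 (xS _ Sv)) mul0e.
apply: ge0_ae_eq_integral => //.
- by apply: emeasurable_funM; [exact: (measurable_nn mks)|exact: measurable_nn].
- by apply: emeasurable_funM; [exact: (measurable_nn mks)|].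
- by move=> t _; rewrite mule_ge0 ?nn_ge0.
- by move=> t _; rewrite mule_ge0 ?nn_ge0// integral_ge0// => v _; rewrite mule_ge0 ?nn_ge0.
apply: filterS2 aeN yE => t aet [iF yt] _.
have [Ot|Ot] := pselect (O (u + (t : G))%R); last first.
  by rewrite [X in X * _ = _](nn_eq0 (kappaO Ot)) [X in _ = X * _](nn_eq0 (kappaO Ot)) !mul0e.
congr (_ * _); rewrite /nn yt.
pose r (v : borel G) : R := (normc (x v) * normc (c ((t : G) - (v : G))))%R.
have mr : measurable_fun setT r.
  apply: measurable_funM; first exact: cmeasurable_normc.
  apply: (measurableT_comp (cmeasurable_normc mc)); exact: measurable_sub1.
have mrc : cmeasurable (fun v => (r v)%:C%C) by exact: cmeasurable_real.
have Fr : {ae mu, forall v : borel G, (x v * c ((t : G) - (v : G)))%R = (r v)%:C%C}.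
  apply: filterS2 (aet Ot) x0 => v Nv xv.
  have [Sv|Sv] := pselect (S v); last first.
    by rewrite /r (xS _ Sv) mul0r normc0 mul0r.
  have cv : c ((t : G) - (v : G))%R = (normc (c ((t : G) - (v : G))%R))%:C%C.
    by apply: contrapT => h; apply: (Nv Sv); exact: cN.
  by rewrite {1}xv {1}cv /r rmorphM.
have ir : cintegrable mu (fun v => (r v)%:C%C).
  have [mF iFfin] := (cintegrableP _ _).1 iF.
  apply/cintegrableP; split => //; apply: le_lt_trans iFfin.
  rewrite le_eqVlt; apply/orP; left; apply/eqP; apply: ge0_ae_eq_integral => //.
  - by apply/measurable_EFinP; exact: (cmeasurable_normc mrc).
  - by apply/measurable_EFinP; exact: (cmeasurable_normc mF).
  - by move=> v _; rewrite lee_fin normc_ge0.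
  - by move=> v _; rewrite lee_fin normc_ge0.
  - by apply: filterS Fr => v -> _.
rewrite (ae_eq_cintegral (cintegrable_cmeasurable iF) mrc Fr).
have r0 v : (0 <= r v)%R by rewrite mulr_ge0 ?normc_ge0.
have -> : cintegral mu (fun v => (r v)%:C%C) = (Rintegral mu setT r)%:C%C.
  rewrite /cintegral/=; congr (_ +i* _)%C.
  by rewrite /Rintegral integral0_eq.
have I0 : (0 <= Rintegral mu setT r)%R by apply: Rintegral_ge0 => v _; exact: r0.
rewrite normc_real (ger0_norm I0) /Rintegral fineK; last first.
  by case: ir => [/= ir _]; exact: integrable_fin_num.

by apply: eq_integral => v _; rewrite EFinM.
Qed.

End PositiveConvolution.

(** * Estimates of bilinear forms *)

Section MainEstimate.
Local Open Scope ereal_scope.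
Variables (O : set G) (oO : open O) (m : R) (mO : mu O = m%:E) (m0 : (0 < m)%R).

Definition ind (A : set G) : borel G -> \bar R := fun s => (\1_A s)%:E.

Let mindO : measurable_fun setT (ind O).
Proof. by apply/measurable_EFinP; apply: measurable_indic; exact: measurable_open. Qed.

Let ind_ge0 A s : 0 <= ind A s.
Proof. by rewrite lee_fin. Qed.

Lemma integral_ind_translate u : \int[mu]_s ind O ((u : G) + (s : G))%R = m%:E.
Proof.
rewrite (ge0_integral_translation u mindO (ind_ge0 O)).
by rewrite integral_indic ?setIT//; exact: measurable_open.
Qed.

Variables (S : set G) (sS : sigma_open mu S).

Lemma sigma_open_measurable : measurable (S : set (borel G)).
Proof.
case: sS => S_ [oS _ _ ->]; apply: bigcupT_measurable => n.
exact: measurable_open.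
Qed.

Let mindS : measurable_fun setT (ind S).
Proof. by apply/measurable_EFinP; apply: measurable_indic; exact: sigma_open_measurable. Qed.

Let indS s : ~ S s -> ind S s = 0.
Proof. by move=> Ss; rewrite /ind indicE memNset. Qed.

Let eform_indS u : eform (ind O) (ind S) u <= m%:E.
Proof.
rewrite -(integral_ind_translate u); apply: ge0_le_integral => //.
- by move=> s _; rewrite mule_ge0.
- exact: (measurable2_section1 u (measurable2_eform mindO mindS)).
- exact: (measurableT_comp mindO (measurable_addl u)).
- move=> s _; rewrite -[leRHS]mule1 lee_wpmul2l// lee_fin indicE.
  by case: (s \in S).
Qed.

Lemma ebilin_ind_le (q : borel G -> \bar R) :
  measurable_fun setT q -> (forall s, 0 <= q s) -> supported S q ->
  ebilin (ind O) (ind S) q <= m%:E * \int[mu]_s q s.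
Proof.
move=> mq q0 qS.
rewrite (ebilin_sym sS mindO mindS mq (ind_ge0 O) (ind_ge0 S) q0 indS qS).
rewrite -ge0_integralZl//; last by rewrite lee_fin ltW.
apply: ge0_le_integral => //.
- by move=> s _; rewrite mule_ge0// eform_ge0.
- by apply: emeasurable_funM => //; exact: (measurable_eform sS).
- exact: measurable_funeM.
- by move=> s _; rewrite muleC lee_wpmul2r ?eform_indS.
Qed.

Variable Psi : R -> \bar R.

(** Put [F = f * min f 1] and [H = g * min g 1]. Then
    [f u * g s <= F u * H s + F u + H s]: according to whether [f u] and [g s]
    exceed 1, the product is bounded by one of the terms or by
    [f u ^+ 2 + g s ^+ 2]. The set of [s] with [u + s] in [O] has measure [m]. *)
Lemma ebilin_bound_min (C : R) (f g : borel G -> R) :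
  unit_ball mu Psi f -> unit_ball mu Psi g ->
  supported S f -> supported S g ->
  \int[mu]_s (f s * Num.min (f s) 1%R)%:E <= C%:E ->
  \int[mu]_s (g s * Num.min (g s) 1%R)%:E <= C%:E ->
  ebilin (ind O) (EFin \o f) (EFin \o g) <= (C * C + m * C + m * C)%:E.
Proof.
move=> [mf f0 _ _] [mg g0 _ _] fS gS fC gC.
pose F s := (f s * Num.min (f s) 1%R)%:E.
pose H s := (g s * Num.min (g s) 1%R)%:E.
have mF : measurable_fun setT F.
  by apply/measurable_EFinP; apply: measurable_funM => //; exact: measurable_minr.
have mH : measurable_fun setT H.
  by apply/measurable_EFinP; apply: measurable_funM => //; exact: measurable_minr.
have F0 s : 0 <= F s by rewrite lee_fin mulr_ge0// le_min f0 ler01.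
have H0 s : 0 <= H s by rewrite lee_fin mulr_ge0// le_min g0 ler01.
have HS s : ~ S s -> H s = 0 by move=> /gS; rewrite /H => ->; rewrite mul0r.
have C0 : (0 <= C)%R by rewrite -lee_fin (le_trans _ fC)// ?integral_ge0// => s _; exact: F0.
have mge : measurable_fun setT (EFin \o g) by exact/measurable_EFinP.
have mfe : measurable_fun setT (EFin \o f) by exact/measurable_EFinP.
have g0e s : 0 <= (EFin \o g) s by rewrite lee_fin.
have f0e s : 0 <= (EFin \o f) s by rewrite lee_fin.
have gSe s : ~ S s -> (EFin \o g) s = 0 by move=> /gS /= ->.
have meg := measurable_eform sS mindO mge (ind_ge0 O) g0e gSe.
have meH := measurable_eform sS mindO mH (ind_ge0 O) H0 HS.
have eH0 u : 0 <= eform (ind O) H u by exact: eform_ge0.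
have pt u : (EFin \o f) u * eform (ind O) (EFin \o g) u <=
    F u * (C + m)%:E + ind S u * eform (ind O) H u.
  have [Su|Su] := pselect (S u); last first.
    by rewrite /= fS// mul0e adde_ge0// mule_ge0// lee_fin addr_ge0// ltW.
  rewrite [X in _ + X * _](_ : _ = 1) ?mul1e; last by rewrite /ind indicE mem_set.
  have sec q : measurable_fun setT q -> measurable_fun setT
      (fun s : borel G => ind O ((u : G) + (s : G))%R * q s).
    by move=> mq; exact: (measurable2_section1 u (measurable2_eform mindO mq)).
  have mi : measurable_fun setT (fun s : borel G => ind O ((u : G) + (s : G))%R).
    exact: (measurableT_comp mindO (measurable_addl u)).
  rewrite /eform -ge0_integralZl//; last 2 first.
  - exact: (sec _ mge).
  - by move=> s _; rewrite mule_ge0.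
  apply: (@le_trans _ _ (\int[mu]_s ((F u * H s + F u * ind O ((u : G) + (s : G))%R)
      + ind O ((u : G) + (s : G))%R * H s))).
    apply: ge0_le_integral => //.
    - by move=> s _; rewrite !mule_ge0.
    - by apply: measurable_funeM; exact: (sec _ mge).
    - apply: emeasurable_funD; last exact: (sec _ mH).
      by apply: emeasurable_funD; apply: measurable_funeM.
    - move=> s _; rewrite /ind indicE; case: (_ \in O); last first.
        by rewrite !mul0e !mule0 !adde0 mule_ge0.
      rewrite mul1e mule1 mul1e /F /H -!EFinM -!EFinD lee_fin.
      have fu := f0 u; have gs := g0 s.
      case: (leP (f u) 1%R) => f1; case: (leP (g s) 1%R) => g1; nra.
  rewrite ge0_integralD//; last 4 first.
  - by move=> s _; rewrite adde_ge0// mule_ge0.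
  - by apply: emeasurable_funD; apply: measurable_funeM.
  - by move=> s _; rewrite mule_ge0.
  - exact: (sec _ mH).
  apply: leeD => //.
  rewrite ge0_integralD//; last 4 first.
  - by move=> s _; rewrite mule_ge0.
  - exact: measurable_funeM.
  - by move=> s _; rewrite mule_ge0.
  - exact: measurable_funeM.
  rewrite !ge0_integralZl// integral_ind_translate EFinD.
  rewrite (@ge0_muleDr _ _ C%:E m%:E) ?lee_fin ?(ltW m0)//.
  by apply: leeD => //; rewrite lee_wpmul2l.
apply: (@le_trans _ _ (\int[mu]_u (F u * (C + m)%:E + ind S u * eform (ind O) H u))).
  apply: ge0_le_integral => //.
  - by move=> u _; rewrite mule_ge0// eform_ge0.
  - exact: emeasurable_funM.
  - apply: emeasurable_funD; last exact: emeasurable_funM.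
    exact: emeasurable_funM.
rewrite ge0_integralD//; last 4 first.
- by move=> u _; rewrite mule_ge0// lee_fin addr_ge0// ltW.
- exact: emeasurable_funM.
- by move=> u _; rewrite mule_ge0.
- exact: emeasurable_funM.
rewrite [leRHS](_ : _ = C%:E * (C + m)%:E + m%:E * C%:E); last first.
  by rewrite -!EFinM -EFinD; congr _%:E; ring.
apply: leeD.
- rewrite ge0_integralZr//; last by rewrite lee_fin addr_ge0// ltW.
  by rewrite lee_wpmul2r// lee_fin addr_ge0// ltW.
- apply: (le_trans (ebilin_ind_le mH H0 HS)).
  by rewrite lee_wpmul2l// lee_fin ltW.
Qed.

(** Use [f u * g s <= (f u ^+ 2 + g s ^+ 2) / 2]. The first half is controlled by
    [unit_ball_square_le] for [f] and [z]; the second one by the same lemma for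
    [g] and the average [eta] of [z] over a translate of [O]. *)
Lemma ebilin_bound_square (Phi : R -> \bar R) (z : borel G -> R)
    (W : borel G -> \bar R) (P : R) (f g : borel G -> R) :
  complementary_pair Phi Psi -> increasing_on_nonneg Phi -> increasing_on_nonneg Psi ->
  measurable_fun setT z -> (forall s, (0 <= z s)%R) ->
  measurable_fun setT W -> (forall s, 0 <= W s) ->
  (forall s x, (0 <= x)%R -> (x ^+ 2 * z s)%:E <= W s + Phi x) ->
  \int[mu]_s W s <= P%:E ->
  unit_ball mu Psi f -> unit_ball mu Psi g ->
  supported S f -> supported S g ->
  ebilin (ind O) (fun t => (z t * f t)%:E) (EFin \o g) <= (m * (P + 2))%:E.
Proof.
move=> pP iPhi iPsi mz z0 mW W0 zW WP uf ug fS gS.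
have [mf f0 _ _] := uf; have [mg g0 _ _] := ug.
have yPhi : young Phi by case: pP.
have zf2 := unit_ball_square_le pP iPhi iPsi uf mz z0 mW W0 zW WP.
pose zS s : \bar R := (z s * \1_S s)%:E.
pose WS s : \bar R := W s * ind S s.
pose g2 s : \bar R := (g s ^+ 2)%:E.
have m1S : measurable_fun setT (\1_S : borel G -> R).
  by apply: measurable_indic; exact: sigma_open_measurable.
have mzS : measurable_fun setT zS by apply/measurable_EFinP; exact: measurable_funM.
have mWS : measurable_fun setT WS by exact: emeasurable_funM.
have mg2 : measurable_fun setT g2 by apply/measurable_EFinP; exact: measurable_funX.
have mge : measurable_fun setT (EFin \o g) by exact/measurable_EFinP.
have zS0 s : 0 <= zS s by rewrite lee_fin mulr_ge0.
have WS0 s : 0 <= WS s by rewrite mule_ge0.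
have g20 s : 0 <= g2 s by rewrite lee_fin sqr_ge0.
have ge0 s : 0 <= (EFin \o g) s by rewrite lee_fin.
have zSS s : ~ S s -> zS s = 0 by move=> Ss; rewrite /zS indicE memNset// mulr0.
have WSS s : ~ S s -> WS s = 0 by move=> Ss; rewrite /WS indS// mule0.
have g2S s : ~ S s -> g2 s = 0 by move=> /gS; rewrite /g2 => ->; rewrite expr0n.
have geS s : ~ S s -> (EFin \o g) s = 0 by move=> /gS /= ->.
have WSP : \int[mu]_s WS s <= P%:E.
  apply: le_trans WP; apply: ge0_le_integral => //.
  move=> s _; rewrite -[leRHS]mule1 lee_wpmul2l// lee_fin indicE.
  by case: (s \in S).
have zWS s x : (0 <= x)%R -> (x ^+ 2)%:E * zS s <= WS s + Phi x.
  move=> x0; rewrite /zS /WS /ind indicE; have [_|_] := boolP (s \in S).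
    by rewrite mulr1 mule1 -EFinM; exact: zW.
  by rewrite mulr0 !mule0 add0e; exact: young_ge0.
have mi u : measurable_fun setT (fun s : borel G => ind O ((u : G) + (s : G))%R).
  exact: (measurableT_comp mindO (measurable_addl u)).
have sec u q : measurable_fun setT q -> measurable_fun setT
    (fun s : borel G => ind O ((u : G) + (s : G))%R * q s).
  by move=> mq; exact: (measurable2_section1 u (measurable2_eform mindO mq)).
(* [eta] satisfies the inequality assumed for [z], by integrating the latter *)
have avg s x : (0 <= x)%R -> (x ^+ 2)%:E * eform (ind O) zS s <=
    eform (ind O) WS s + m%:E * Phi x.
  move=> x0; have Px0 := young_ge0 yPhi x0.
  rewrite /eform -ge0_integralZl//; last 3 first.
  - exact: (sec s _ mzS).
  - by move=> t _; rewrite mule_ge0.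
  - by rewrite lee_fin sqr_ge0.
  rewrite -[X in m%:E * X](fineK (increasing_fin_num yPhi iPhi x0)) muleC.
  rewrite -(integral_ind_translate s) -ge0_integralZl//; last by rewrite lee_fin fine_ge0.
  rewrite fineK ?(increasing_fin_num yPhi iPhi x0)//.
  rewrite -ge0_integralD//; last 4 first.
  - by move=> t _; rewrite mule_ge0.
  - exact: (sec s _ mWS).
  - by move=> t _; rewrite mule_ge0.
  - exact: measurable_funeM.
  apply: ge0_le_integral => //.
  - by move=> t _; rewrite !mule_ge0// lee_fin sqr_ge0.
  - by apply: measurable_funeM; exact: (sec s _ mzS).
  - apply: emeasurable_funD; first exact: (sec s _ mWS).
    exact: measurable_funeM.
  - move=> t _; rewrite [leLHS]muleCA [X in _ + X]muleC -ge0_muleDr//.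
    by rewrite lee_wpmul2l// zWS.
have mzh := measurable_eform sS mindO mzS (ind_ge0 O) zS0 zSS.
have mWh := measurable_eform sS mindO mWS (ind_ge0 O) WS0 WSS.
have mg2h := measurable_eform sS mindO mg2 (ind_ge0 O) g20 g2S.
have mgh := measurable_eform sS mindO mge (ind_ge0 O) ge0 geS.
have zh0 s : 0 <= eform (ind O) zS s by exact: eform_ge0.
have Wh0 s : 0 <= eform (ind O) WS s by exact: eform_ge0.
have g2h0 s : 0 <= eform (ind O) g2 s by exact: eform_ge0.
have gh0 s : 0 <= eform (ind O) (EFin \o g) s by exact: eform_ge0.
have Whfin s : eform (ind O) WS s <= P%:E.
  apply: le_trans WSP; apply: ge0_le_integral => //.
  - by move=> t _; rewrite mule_ge0.
  - exact: (sec s _ mWS).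
  - move=> t _; rewrite -[leRHS]mul1e lee_wpmul2r// lee_fin indicE.
    by case: (_ \in O).
have zhfin s : eform (ind O) zS s \is a fin_num.
  rewrite ge0_fin_numE//; have := avg s 1%R ler01.
  rewrite expr1n mul1e => /le_lt_trans; apply.
  rewrite -(fineK (increasing_fin_num yPhi iPhi (@ler01 R))).
  apply: lte_add_pinfty; last by rewrite -EFinM ltry.
  by apply: (le_lt_trans (Whfin s)); exact: ltry.
pose eta s : R := (fine (eform (ind O) zS s) / m * \1_S s)%R.
pose V s : \bar R := (m^-1)%:E * (ind S s * eform (ind O) WS s).
have meta : measurable_fun setT eta.
  apply: measurable_funM => //.
  apply: (measurable_funM _ (@measurable_cst _ _ (borel G) R setT (m^-1)%R)).
  exact: (measurableT_comp (fine_measurable measurableT) mzh).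
have eta0 s : (0 <= eta s)%R.
  by rewrite !mulr_ge0// ?fine_ge0// invr_ge0 ltW.
have mV : measurable_fun setT V by apply: measurable_funeM; exact: emeasurable_funM.
have V0 s : 0 <= V s by rewrite !mule_ge0// lee_fin invr_ge0 ltW.
have etaV s x : (0 <= x)%R -> (x ^+ 2 * eta s)%:E <= V s + Phi x.
  move=> x0; rewrite /eta /V /ind indicE; have [_|_] := boolP (s \in S); last first.
    by rewrite !mulr0 mul0e mule0 add0e; exact: young_ge0.
  rewrite mulr1 mul1e mulrA EFinM lee_pdivrMr//.
  rewrite ge0_muleDl ?young_ge0 ?mule_ge0 ?lee_fin ?invr_ge0 ?(ltW m0)//.
  rewrite muleAC -EFinM mulVf ?gt_eqF// mul1e (muleC (Phi x)).
  by rewrite EFinM fineK//; exact: avg.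
have VP : \int[mu]_s V s <= P%:E.
  rewrite ge0_integralZl//; last 3 first.
  - exact: emeasurable_funM.
  - by move=> s _; rewrite mule_ge0.
  - by rewrite lee_fin invr_ge0 ltW.
  rewrite muleC lee_pdivrMr// muleC.
  apply: (le_trans (ebilin_ind_le mWS WS0 WSS)).
  by rewrite lee_wpmul2l// lee_fin ltW.
have eg2 := unit_ball_square_le pP iPhi iPsi ug meta eta0 mV V0 etaV VP.
have zg2 : ebilin (ind O) zS g2 <= m%:E * (P + 2)%:E.
  rewrite (ebilin_sym sS mindO mzS mg2 (ind_ge0 O) zS0 g20 zSS g2S).
  apply: le_trans (_ : m%:E * \int[mu]_s (eta s * g s ^+ 2)%:E <= _); last first.
    by rewrite lee_wpmul2l// lee_fin ltW.
  rewrite -ge0_integralZl//; last 3 first.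
  - by apply/measurable_EFinP; apply: measurable_funM => //; exact: measurable_funX.
  - by move=> s _; rewrite lee_fin mulr_ge0// sqr_ge0.
  - by rewrite lee_fin ltW.
  rewrite le_eqVlt; apply/orP; left; apply/eqP; apply: eq_integral => s _.
  have [Ss|Ss] := pselect (S s); last first.
    by rewrite /g2 (gS s Ss) expr0n/= mul0e mulr0 mule0.
  rewrite /eta indicE mem_set// mulr1 -[X in _ * X = _]fineK// -!EFinM; congr _%:E.
  by field; rewrite gt_eqF.
pose q u : \bar R := (z u * f u ^+ 2)%:E.
have mq : measurable_fun setT q.
  by apply/measurable_EFinP; apply: measurable_funM => //; exact: measurable_funX.
have q0 u : 0 <= q u by rewrite lee_fin mulr_ge0// sqr_ge0.
have pt u : (z u * f u)%:E * eform (ind O) (EFin \o g) u <=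
    2^-1%:E * (q u * m%:E + zS u * eform (ind O) g2 u).
  have [Su|Su] := pselect (S u); last first.
    rewrite fS// mulr0 mul0e mule_ge0// ?lee_fin ?invr_ge0//.
    by rewrite adde_ge0 ?mule_ge0// lee_fin ltW.
  rewrite /zS indicE mem_set// mulr1 -(integral_ind_translate u).
  have zind0 (t : borel G) : 0 <= (z u)%:E * (ind O ((u : G) + (t : G))%R * g2 t).
    by apply: mule_ge0; [rewrite lee_fin|exact: mule_ge0].
  rewrite /eform -!ge0_integralZl//; last 6 first.
  - exact: (sec u _ mg2).
  - by move=> t _; rewrite mule_ge0.
  - by rewrite lee_fin.
  - exact: (sec u _ mge).
  - by move=> t _; rewrite mule_ge0.
  - by rewrite lee_fin mulr_ge0.
  rewrite -ge0_integralD//; last 3 first.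
  - by move=> t _; rewrite mule_ge0.
  - exact: measurable_funeM.
  - by apply: measurable_funeM; exact: (sec u _ mg2).
  rewrite -ge0_integralZl//; last 2 first.
  - apply: emeasurable_funD; first exact: measurable_funeM.
    by apply: measurable_funeM; exact: (sec u _ mg2).
  - by move=> t _; apply: adde_ge0; [exact: mule_ge0|exact: zind0].
  apply: ge0_le_integral => //.
  - by move=> t _; rewrite !mule_ge0// lee_fin mulr_ge0.
  - by apply: measurable_funeM; exact: (sec u _ mge).
  - apply: measurable_funeM; apply: emeasurable_funD; first exact: measurable_funeM.
    by apply: measurable_funeM; exact: (sec u _ mg2).
  - move=> t _; rewrite /ind indicE; case: (_ \in O); last first.
      by rewrite !mul0e !mule0 adde0 mule0.
    rewrite !mul1e mule1 /q /g2 -!EFinM lee_fin.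
    have : (0 <= z u * (f u - g t) ^+ 2)%R by rewrite mulr_ge0// sqr_ge0.
    rewrite !expr2; lra.
apply: (@le_trans _ _ (\int[mu]_u (2^-1%:E * (q u * m%:E + zS u * eform (ind O) g2 u)))).
  apply: ge0_le_integral => //.
  - by move=> u _; rewrite mule_ge0// lee_fin mulr_ge0.
  - apply: emeasurable_funM => //; apply/measurable_EFinP; exact: measurable_funM.
  - apply: measurable_funeM; apply: emeasurable_funD; exact: emeasurable_funM.
rewrite ge0_integralZl//; last 2 first.
- apply: emeasurable_funD; exact: emeasurable_funM.
- by move=> u _; rewrite adde_ge0 ?mule_ge0// lee_fin ltW.
rewrite ge0_integralD//; last 4 first.
- by move=> u _; rewrite mule_ge0// lee_fin ltW.
- exact: emeasurable_funM.
- by move=> u _; rewrite mule_ge0.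
- exact: emeasurable_funM.
apply: (@le_trans _ _ (2^-1%:E * ((m * (P + 2))%:E + (m * (P + 2))%:E))).
  rewrite lee_wpmul2l// ?lee_fin ?invr_ge0//; apply: leeD; last by rewrite EFinM.
  rewrite ge0_integralZr//; last by rewrite lee_fin ltW.
  by rewrite mulrC EFinM lee_wpmul2r// lee_fin ltW.
by rewrite -EFinD -EFinM lee_fin; lra.
Qed.

End MainEstimate.

End HaarIntegrals.

(** * Haar measure *)

Section HaarFacts.
Context {R : realType} {G : topologicalZmodType}.
Hypothesis HG : hausdorff_space G.
Hypothesis lcG : locally_compact [set: G].
Variable mu : {measure set (borel G) -> \bar R}.
Hypothesis haar : haar_measure mu.
Local Open Scope ereal_scope.

(** If [U] were null, its translates would be null, hence every compact set, by a
    finite cover, and finally the group, by inner regularity. The null open sets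
    are directed by inclusion; as a filter, they can be used with
    [compact_near_coveringP]. *)
Lemma haar_open_gt0 (U : set G) (x : G) : open U -> U x -> 0 < mu U.
Proof.
move=> oU Ux; rewrite lt0e measure_ge0 andbT; apply/negP => /eqP U0.
pose F : set_system (set G) := [set A | exists V0, [/\ open V0, mu V0 = 0 &
  forall V, open V -> mu V = 0 -> V0 `<=` V -> A V]].
have FF : ProperFilter F.
  apply: Build_ProperFilter_ex.
    by move=> A [V [oV V0]] /(_ V oV V0) AV; exists V; exact: AV.
  split.
  - by exists set0; split => //; exact: open0.
  - move=> A B [V [oV V0 AV]] [W [oW W0 BW]]; exists (V `|` W); split.
    + exact: openU.
    + apply/eqP; rewrite eq_le measure_ge0 andbT.
      apply: le_trans (measureU2 _ _ _) _; try exact: measurable_open.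
      by rewrite [X in X + _]V0 [X in _ + X]W0 adde0.
    + by move=> X oX X0; rewrite subUset => -[VX WX]; split; [exact: AV|exact: BW].
  - move=> A B AB [V [oV V0 AV]]; exists V; split => // X oX X0 VX.
    by apply: AB; exact: AV.
have Fnull : \forall V \near F, open V /\ mu V = 0.
  by exists set0; split => //; exact: open0.
have K0 (K : set G) : compact K -> mu K = 0.
  move=> cK; have /compact_near_coveringP nK := cK.
  have KV : \forall V \near F, K `<=` V.
    apply: (nK _ F (fun V => V)) => y _.
    pose Uy := [set s : G | U (x - y + s)%R].
    have oUy : open Uy by apply: open_comp => // s _; exact: addl_continuous.
    have Uy0 : mu Uy = 0.
      rewrite (measure_preimage_translation (haar_invariant haar))//.
      exact: measurable_open.
    exists (Uy, [set V | Uy `<=` V]) => /=.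
      split; first by apply: open_nbhs_nbhs; split => //=; rewrite /Uy/= subrK.
      by exists Uy.
    by move=> [s V] [/= Us UV]; exact: UV.
  have [V [KV' [oV V0]]] := filter_ex (filterI KV Fnull).
  apply/eqP; rewrite eq_le measure_ge0 andbT.
  rewrite -[leRHS]V0; apply: le_measure; rewrite ?inE//.
  - exact: compact_borel.
  - exact: measurable_open.
have := haar_neq0 haar; rewrite (haar_inner haar openT) => /eqP; apply.
apply/eqP; rewrite eq_le; apply/andP; split.
  by apply: ge_ereal_sup => _ [K [cK _] <-]; rewrite K0.
by apply: ereal_sup_ubound; exists set0; rewrite ?measure0//; split => //; exact: compact0.
Qed.

Lemma haar_finite_nbhs (x : G) : exists U : set G, [/\ open U, U x & mu U < +oo].
Proof.
have [K /= nK [cK clK]] := lcG (x := x) I.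
have nK' : nbhs x K by move: nK; rewrite /within/=; apply: filterS => y; exact.
exists (interior K); split; [exact: open_interior|exact: nK'|].
apply: le_lt_trans (haar_compact haar cK); apply: le_measure; rewrite ?inE.
- by apply: measurable_open; exact: open_interior.
- exact: measurable_closed.
- exact: interior_subset.
Qed.

Lemma haar_outer_open (B : set (borel G)) : measurable B -> mu B < +oo ->
  exists U : set G, [/\ open U, B `<=` U & mu U < +oo].
Proof.
move=> mB; rewrite (haar_outer haar mB) => /ereal_inf_lt[_ [U [oU BU] <-] fU].
by exists U.
Qed.

(** Outer regularity encloses each level set [1 / n < f] in an open set of finite
    measure. *)
Lemma sigma_open_support (f : borel G -> R) : measurable_fun setT f ->
  (forall s, (0 <= f s)%R) ->
  (forall e : R, (0 < e)%R -> mu [set s | (e < f s)%R] < +oo) ->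
  exists S, sigma_open mu S /\ forall s, ~ S s -> f s = 0%R.
Proof.
move=> mf f0 ffin.
have mA n : measurable [set s : borel G | (n.+1%:R^-1 < f s)%R].
  rewrite (_ : [set s | _] = f @^-1` `](n.+1%:R^-1)%R, +oo[%classic).
    by rewrite -[X in measurable X]setTI; exact: mf.
  by apply/seteqP; split => s /=; rewrite in_itv/= andbT.
have fA n : mu [set s : borel G | (n.+1%:R^-1 < f s)%R] < +oo.
  by apply: ffin; rewrite invr_gt0.
have [U HU] := choice (fun n => haar_outer_open (mA n) (fA n)).
exists (\bigcup_n U n); split.
  by apply: sigma_openP => n; case: (HU n).
move=> s Us; apply/eqP; rewrite eq_le f0 andbT leNgt; apply/negP => fs0.
apply: Us; exists (Num.truncn (f s)^-1) => //.
case: (HU (Num.truncn (f s)^-1)) => _ sub _; apply: sub => /=.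
by rewrite invf_plt ?posrE//; exact: truncnS_gt.
Qed.

End HaarFacts.

(** * Nonvanishing of the form *)

Section PositiveForm.
Context {R : realType} {G : topologicalZmodType}.
Variable mu : {measure set (borel G) -> \bar R}.
Local Open Scope ereal_scope.

Lemma cform_nonneg (k b : borel G -> R[i]) (u : G) : cmeasurable k -> cmeasurable b ->
  (forall s, k s = (normc (k s))%:C%C) -> ae_nonneg mu b ->
  cform mu k b u = (fine (eform mu (nn k) (nn b) u))%:C%C.
Proof.
move=> mk mb k0 b0.
pose r (s : borel G) : R := (normc (k ((u : G) + (s : G))%R) * normc (b s))%R.
have mr : measurable_fun setT r.
  apply: measurable_funM; last exact: cmeasurable_normc.
  apply: (measurableT_comp (cmeasurable_normc mk)); exact: measurable_addl.
transitivity (cintegral mu (fun s => (r s)%:C%C)).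
  apply: ae_eq_cintegral.
  - exact: (cmeasurable2_section1 (F := fun u s : G => k (u + s) * b s)%R u
      (cmeasurable2_cform mk mb)).
  - exact: cmeasurable_real.
  - by apply: filterS b0 => s bs; rewrite {1}k0 {1}bs /r rmorphM.
rewrite /cintegral /=; congr (_ +i* _)%C.
by rewrite /Rintegral integral0_eq.
Qed.

Lemma ae_open_ex (HG : hausdorff_space G) (haar : haar_measure mu) (P : G -> Prop) (W : set G) (x : G) :
  {ae mu, forall s : borel G, P s} -> open W -> W x -> exists2 s, W s & P s.
Proof.
move=> [N [mN N0 PN]] oW Wx; apply: contrapT => h.
have := haar_open_gt0 HG haar oW Wx; rewrite ltNge => /negP; apply.
rewrite -[leRHS]N0; apply: le_measure; rewrite ?inE//.
  exact: measurable_open.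
by move=> s Ws; apply: PN => Ps; apply: h; exists s.
Qed.

End PositiveForm.

Section Nonvanishing.
Context {R : realType} {G : topologicalZmodType}.
Hypothesis HG : hausdorff_space G.
Variable mu : {measure set (borel G) -> \bar R}.
Hypothesis haar : haar_measure mu.
Local Open Scope ereal_scope.
Variables (xi : {additive G -> R[i]}) (mxi : cmeasurable (xi : borel G -> R[i])).
Variables (O U : set G) (oO : open O) (oU : open U) (t0 : G).
Hypotheses (Ot0 : O (t0 + t0)%R) (Ut0 : U t0) (fU : mu U < +oo).
Variables (kappa : borel G -> R[i]) (mkappa : cmeasurable kappa).
Hypothesis kappa0 : forall s, kappa s = (normc (kappa s))%:C%C.
Hypothesis kappaO : forall s, O s -> (0 < normc (kappa s))%R.
Hypothesis xiU : forall t, U t -> (0 < Re ((xi t0)^*%C * xi t))%R.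
Variables (a : borel G -> R[i]) (ma : cmeasurable a) (q : borel G -> R).
Hypotheses (mq : measurable_fun setT q) (q0 : forall s, (0 <= q s)%R).
Hypotheses (qU : forall s, U s -> (0 < q s)%R) (qU0 : forall s, ~ U s -> q s = 0%R).
Hypothesis aq : {ae mu, forall s, a s = (q s)%:C%C}.
Variables (S : set G) (sS : sigma_open mu S) (aS : forall s, ~ S s -> a s = 0%R).
Hypothesis fin : ebilin mu (nn kappa) (nn (xi_mul xi a)) (nn a) < +oo.

Let E u := eform mu (nn kappa) (nn a) u.
Let inner_mu := haar_inner haar.

Let mE : measurable_fun setT (E : borel G -> \bar R).
Proof. exact: (measurable_eformK HG inner_mu mkappa sS ma aS). Qed.

Let nn_a : {ae mu, forall s, nn a s = (q s)%:E}.
Proof. by apply: filterS aq => s; rewrite /nn => ->; rewrite normc_real ger0_norm. Qed.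

Let a_nonneg : ae_nonneg mu a.
Proof. by apply: filterS aq => s ->; rewrite normc_real ger0_norm. Qed.

Let E_ge0 u : 0 <= E u. Proof. exact: eformK_ge0. Qed.

Lemma eform_gt0 u : O (u + t0)%R -> 0 < E u.
Proof.
move=> Ou; rewrite lt0e E_ge0 andbT; apply/eqP => E0.
have mF := measurable2_section1 u (measurable2_eform (measurable_nn mkappa) (measurable_nn ma)).
have := (ae_eq_integral_abs mu measurableT mF).1.
under eq_integral do rewrite gee0_abs ?mule_ge0 ?nn_ge0//.
move=> /(_ E0) F0.
pose W := U `&` (fun s => O (u + s)%R).
have oW : open W.
  by apply: openI => //; apply: (@open_comp _ _ (fun s : G => u + s)%R O) => // s _; exact: addl_continuous.
have [s [Us Os] []] := ae_open_ex HG haar (filterI F0 nn_a) oW (conj Ut0 Ou).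
move=> /(_ I) + as_; rewrite as_ /nn -EFinM => -[] /eqP.
by rewrite gt_eqF// mulr_gt0 ?qU ?kappaO.
Qed.

(** The real part of [conj (xi t0)] times the form is the integral of a
    nonnegative function which, almost everywhere on the open set of the [u] in
    [U] with [u + t0] in [O], is positive. This set contains [t0]. *)
Lemma cbilin_nonzero : cbilin mu kappa (xi_mul xi a) a <> 0%R.
Proof.
move=> D0.
have xaS := xi_mul_supp xi aS.
have mxa := cmeasurable_xi_mul mxi ma.
have i := cbilin_cintegrable HG inner_mu sS mkappa mxa ma xaS aS fin.
pose w := (xi t0)^*%C.
pose g (u : borel G) : R := (Re (w * xi u) * (q u * fine (E u)))%R.
have mg : measurable_fun setT g.
  apply: measurable_funM.
    by case: (cmeasurableM (cmeasurable_cst _ w) mxi).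
  apply: measurable_funM => //.
  exact: measurableT_comp.
have g0 u : (0 <= g u)%R.
  have [Uu|/qU0 qu0] := pselect (U u); last by rewrite /g qu0 mul0r mulr0.
  by rewrite !mulr_ge0 ?(ltW (xiU Uu))// fine_ge0.
have gE : {ae mu, forall u, Re (w * (xi_mul xi a u * cform mu kappa a u))%R = g u}.
  apply: filterS aq => u au; rewrite (cform_nonneg _ mkappa ma kappa0 a_nonneg).
  rewrite /xi_mul au -mulrA -rmorphM mulrA [LHS]Defs.ReM /= mulr0 subr0.
  by rewrite /g.
have [iw _] := cintegrableZ w i.
have ig : \int[mu]_u (g u)%:E = 0.
  have Z : Re (cintegral mu (fun u => w * (xi_mul xi a u * cform mu kappa a u))%R) = 0%R.
    by rewrite (cintegralZ w i) [X in (w * X)%R]D0 mulr0.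
  transitivity (\int[mu]_u (Re (w * (xi_mul xi a u * cform mu kappa a u))%R)%:E).
    apply: ae_eq_integral => //.
    - exact/measurable_EFinP.
    - by case/integrableP: iw.
    - by apply: filterS gE => u -> _.
  by rewrite -[LHS]fineK ?integrable_fin_num//; congr _%:E.
have := (ae_eq_integral_abs mu measurableT ((measurable_EFinP _ _).2 mg)).1.
under eq_integral do rewrite gee0_abs ?lee_fin//.
move=> /(_ ig) gae.
have fae := ae_finite_or_zero (measurable_nn mxa) mE (nn_ge0 _) E_ge0 fin.
pose W := U `&` (fun u => O (u + t0)%R).
have oW : open W.
  apply: openI => //; apply: (@open_comp _ _ (fun s : G => s + t0)%R O) => // s _.
  rewrite (_ : (fun s => _) = (fun s => t0 + s)%R); last by apply/funext => v; rewrite addrC.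
  exact: addl_continuous.
have [u [Uu Ou] [[/(_ I) gu fu] au]] :=
  ae_open_ex HG haar (filterI (filterI gae fae) aq) oW (conj Ut0 Ot0).
have qu := qU Uu; have xu := xiU Uu.
have Eu := eform_gt0 Ou.
have Efin : E u < +oo.
  case: fu => // /nn_eq0P; rewrite /xi_mul au => /eqP; rewrite mulf_eq0 => /orP[/eqP xu0|].
    by move: xu; rewrite xu0 mulr0 ltxx.
  by move=> /eqP[] qu0; move: qu; rewrite qu0 ltxx.
move: gu => [] /eqP; rewrite /g gt_eqF// mulr_gt0// mulr_gt0// fine_gt0//.
by rewrite Eu.
Qed.

End Nonvanishing.

(** * Weighted Orlicz spaces *)

Lemma measurable_inv_pos d (T : measurableType d) (R : realType) (f : T -> R) :
  measurable_fun setT f -> (forall s, 0 < f s) -> measurable_fun setT (fun s => (f s)^-1).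
Proof.
move=> mf f0; have -> : (fun s => (f s)^-1) = (fun s => f s `^ (- 1)).
  by apply/funext => s; rewrite powR_inv1// ltW.
exact: (measurableT_comp (measurable_powR (-1))).
Qed.

Lemma le_mulr_limit (R : realFieldType) (r B x y : R) : 0 <= B -> 0 <= x -> 0 <= y ->
  (forall d, 0 < d -> r <= B * (x + d) * (y + d)) -> r <= B * x * y.
Proof.
move=> B0 x0 y0 h; apply/ler_addgt0Pr => e e0.
pose D := B * (x + y + 1) + 1.
have D0 : 0 < D by rewrite ltr_wpDl// mulr_ge0// !addr_ge0.
pose d := Num.min 1 (e / D).
have d0 : 0 < d by rewrite lt_min ltr01 divr_gt0.
apply: (le_trans (h d d0)).
have d1 : d <= 1 by rewrite ge_min lexx.
have dD : d * D <= e by rewrite -ler_pdivlMr// ge_min lexx orbT.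
have h1 : 0 <= B * d * (1 - d).
  by apply: mulr_ge0; [exact: mulr_ge0 B0 (ltW d0)|rewrite subr_ge0].
by rewrite /D in dD; have := ltW d0; lra.
Qed.

Lemma Re_conj_mul_gt0 (R : rcfType) (w z : R[i]) : normc (w - z) < normc w ->
  0 < Re (w^*%C * z).
Proof.
case: w => a b; case: z => c d /= h.
have : 0 < Num.sqrt (a ^+ 2 + b ^+ 2) by apply: le_lt_trans h; exact: sqrtr_ge0.
rewrite sqrtr_gt0 => h0; move: h; rewrite ltr_sqrt// => h.
by have := sqr_ge0 c; have := sqr_ge0 d; rewrite !expr2 in h *; lra.
Qed.

Section WeightedOrlicz.
Local Open Scope quotient_scope.
Context {R : realType} {G : topologicalZmodType}.
Hypothesis HG : hausdorff_space G.
Variable mu : {measure set (borel G) -> \bar R}.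
Hypothesis haar : haar_measure mu.
Variables Phi Psi : R -> \bar R.
Hypotheses (pairPP : complementary_pair Phi Psi).
Hypotheses (iPhi : increasing_on_nonneg Phi) (iPsi : increasing_on_nonneg Psi).
Variable omega : G -> R.
Hypothesis womega : weight mu omega.
Local Open Scope ereal_scope.

Local Notation LPhi := (LPhi_weighted mu Phi omega).
Local Notation norm := (norm_Phi_weighted mu Phi omega).
Local Notation eform := (eform mu).
Local Notation ebilin := (ebilin mu).
Local Notation cform := (cform mu).
Local Notation cbilin := (cbilin mu).

Let inner_mu : inner_regular mu := haar_inner haar.
Let invariant_mu : translation_invariant mu := haar_invariant haar.
Let yPhi : young Phi. Proof. by case: pairPP. Qed.
Let omega_gt0 := weight_gt0 womega.
Let omega_meas : measurable_fun [set: borel G] (omega : borel G -> R) :=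
  weight_measurable womega.

Lemma L0_cmeasurable (a : L0 mu) : cmeasurable a.
Proof. by have := cmfunP (repr a); rewrite inE. Qed.

Lemma L0_linear (c : R[i]) (a b : L0 mu) :
  {ae mu, forall s, L0_fun (c *: a + b)%R s = (c * a s + b s)%R}.
Proof.
have E : (c *: a + b)%R = \pi_(L0 mu) (c *: repr a + repr b)%R.
  by rewrite L0_piD -L0_scale_pi !reprK.
by rewrite E; apply: filterS (L0_funK mu (c *: repr a + repr b)%R) => s ->.
Qed.

Lemma normc_weighted (a : borel G -> R[i]) s :
  normc (weighted (omega : borel G -> R) a s) = (omega s * normc (a s))%R.
Proof. by rewrite /weighted normcMr normc_real ger0_norm// ltW. Qed.

Lemma orlicz_ae (f g : borel G -> R[i]) : orlicz mu Phi f -> cmeasurable g ->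
  {ae mu, forall s, normc (f s) = normc (g s)} -> orlicz mu Phi g.
Proof.
move=> [mf [r r0 fr]] mg fg; split => //; exists r => //.
have m h : cmeasurable h -> measurable_fun setT (fun s : borel G => Phi (r * normc (h s))%R).
  move=> mh; apply: (measurable_nondecreasing_comp (u := fun s => r * normc (h s))%R).
  - exact: increasing_nondecreasing.
  - exact: (measurable_funM (@measurable_cst _ _ (borel G) R setT r) (cmeasurable_normc mh)).
  - by move=> s; rewrite mulr_ge0 ?normc_ge0 ?ltW.
have p h s : 0 <= Phi (r * normc (h s : R[i]))%R.
  by apply: young_ge0 => //; rewrite mulr_ge0 ?normc_ge0 ?ltW.
rewrite (_ : \int[mu]_s _ = \int[mu]_s Phi (r * normc (f s))%R)//.
apply: ge0_ae_eq_integral; [by []|exact: m|exact: m|by move=> s _; exact: p..|].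
by apply: filterS fg => s -> .
Qed.

Lemma LPhi_support (a : L0 mu) : LPhi a ->
  exists S, sigma_open mu S /\ forall s, ~ S s -> a s = 0%R.
Proof.
move=> oa; have [mw _] := oa.
have [S [sS S0]] := sigma_open_support haar (cmeasurable_normc mw)
  (fun s => normc_ge0 _) (fun e => orlicz_finite pairPP iPhi oa (e := e)).
exists S; split => // s /S0/eqP; rewrite normc_weighted mulf_eq0 gt_eqF//=.
by move=> /eqP/ComplexField.Normc.eq0_normc.
Qed.

Lemma LPhi_normE (a : L0 mu) : LPhi a ->
  orlicz_norm mu Phi (weighted (omega : borel G -> R) a) = (norm a)%:E.
Proof. by move=> oa; rewrite fineK//; exact: (orlicz_norm_fin pairPP). Qed.

Lemma LPhi_unit_ball (a : L0 mu) (N : R) : LPhi a -> (0 < N)%R -> (norm a <= N)%R ->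
  unit_ball mu Psi (fun s => omega s * normc (a s) / N)%R.
Proof.
move=> oa N0 aN.
have := orlicz_unit_ball pairPP iPhi oa N0.
rewrite (LPhi_normE oa) lee_fin => /(_ aN).
by under eq_fun do rewrite normc_weighted.
Qed.

Definition abs_fun (a : L0 mu) : borel G -> R[i] := fun s => (normc (a s))%:C%C.

Lemma abs_cmfun (a : L0 mu) : abs_fun a \in @cmfun _ (borel G) R.
Proof.
by rewrite inE; apply: cmeasurable_real; apply: cmeasurable_normc; exact: L0_cmeasurable.
Qed.

Definition L0_abs (a : L0 mu) : L0 mu := \pi_(L0 mu) (CMeasurableFun (abs_cmfun a)).

Lemma L0_absE (a : L0 mu) : {ae mu, forall s, L0_abs a s = (normc (a s))%:C%C}.
Proof. exact: L0_funK. Qed.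

Lemma L0_abs_nn (a : L0 mu) : {ae mu, forall s, nn (L0_abs a) s = nn a s}.
Proof.
by apply: filterS (L0_absE a) => s; rewrite /nn => ->; rewrite normc_real ger0_norm ?normc_ge0.
Qed.

Lemma L0_abs_nonneg (a : L0 mu) : ae_nonneg mu (L0_abs a).
Proof.
by apply: filterS (L0_absE a) => s ->; rewrite normc_real ger0_norm ?normc_ge0.
Qed.

Lemma LPhi_abs (a : L0 mu) : LPhi a -> LPhi (L0_abs a).
Proof.
move=> oa; apply: (orlicz_ae oa).
  by apply: cmeasurableM; [exact: cmeasurable_real|exact: L0_cmeasurable].
apply: filterS (L0_abs_nn a) => s; rewrite !normc_weighted.
by move=> h; rewrite [X in (_ * X)%R](_ : _ = normc (L0_abs a s))//; case: h.
Qed.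

Lemma ebilin_le (S : set G) (C : R) (k a b k' a' b' : borel G -> \bar R) :
  sigma_open mu S -> (0 <= C)%R ->
  measurable_fun setT k -> measurable_fun setT a -> measurable_fun setT b ->
  measurable_fun setT k' -> measurable_fun setT a' -> measurable_fun setT b' ->
  (forall s, 0 <= k s) -> (forall s, 0 <= a s) -> (forall s, 0 <= b s) ->
  (forall s, 0 <= k' s) -> (forall s, 0 <= a' s) -> (forall s, 0 <= b' s) ->
  supported S b -> (forall s, ~ S s -> b' s = 0) ->
  {ae mu, forall u : borel G, forall s : borel G,
    a u * (k ((u : G) + (s : G))%R * b s) <=
    C%:E * (a' u * (k' ((u : G) + (s : G))%R * b' s))} ->
  ebilin k a b <= C%:E * ebilin k' a' b'.
Proof.
move=> sS C0 mk ma mb mk' ma' mb' k0 a0 b0 k0' a0' b0' bS bS' le.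
have me := measurable_eform HG inner_mu sS mk mb k0 b0 bS.
have me' := measurable_eform HG inner_mu sS mk' mb' k0' b0' bS'.
have e0 u : 0 <= eform k b u by exact: eform_ge0.
have e0' u : 0 <= eform k' b' u by exact: eform_ge0.
rewrite /ebilin -ge0_integralZl//; last 2 first.
- exact: emeasurable_funM.
- by move=> u _; exact: mule_ge0.
apply: ae_ge0_le_integral => //.
- by move=> u _; exact: mule_ge0.
- exact: emeasurable_funM.
- by move=> u _; apply: mule_ge0 => //; exact: mule_ge0.
- by apply: measurable_funeM; exact: emeasurable_funM.
apply: filterS le => u le _.
have ms := measurable2_section1 u (measurable2_eform mk mb).
have ms' := measurable2_section1 u (measurable2_eform mk' mb').
have p s : 0 <= k ((u : G) + (s : G))%R * b s by exact: mule_ge0.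
have p' s : 0 <= k' ((u : G) + (s : G))%R * b' s by exact: mule_ge0.
have -> : a u * eform k b u = \int[mu]_s (a u * (k ((u : G) + (s : G))%R * b s)).
  by rewrite ge0_integralZl//; move=> s _; exact: p.
have -> : C%:E * (a' u * eform k' b' u) =
    \int[mu]_s (C%:E * (a' u * (k' ((u : G) + (s : G))%R * b' s))).
  rewrite ge0_integralZl//.
  - by rewrite ge0_integralZl//; move=> s _; exact: p'.
  - exact: measurable_funeM.
  - by move=> s _; apply: mule_ge0 => //; exact: p'.
apply: ge0_le_integral => //.
- by move=> s _; apply: mule_ge0 => //; exact: p.
- exact: measurable_funeM.
- by apply: measurable_funeM; exact: measurable_funeM.
Qed.

Section Bounds.
Variables (O : set G) (oO : open O) (m : R) (mO : mu O = m%:E) (m0 : (0 < m)%R).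
Variables (z : borel G -> R) (mz : measurable_fun setT z).
Hypothesis z0 : forall s, (0 <= z s)%R.

Let mindO : measurable_fun setT (ind O : borel G -> \bar R).
Proof. by apply/measurable_EFinP; apply: measurable_indic; exact: measurable_open. Qed.

Let ind_ge0 A s : 0 <= (ind A : borel G -> \bar R) s.
Proof. by rewrite lee_fin. Qed.

Lemma unit_ball_supports (f g : borel G -> R) : unit_ball mu Psi f -> unit_ball mu Psi g ->
  exists S, [/\ sigma_open mu S, forall s, ~ S s -> f s = 0%R & forall s, ~ S s -> g s = 0%R].
Proof.
move=> [mf f0 ff _] [mg g0 fg _].
have [S [sS fS]] := sigma_open_support haar mf f0 ff.
have [S' [sS' gS']] := sigma_open_support haar mg g0 fg.
exists (S `|` S'); by split; [exact: sigma_openU|exact: supportedUl|exact: supportedUr].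
Qed.

(** The factor [z] is bounded, so that [ebilin_bound_min] applies with the
    constant function 1 in its place. *)
Lemma ebilin_unit_ball_bounded_min (L : R) : {ae mu, forall s, (z s <= L)%R} ->
  young (fun x => Psi (Num.sqrt x)) ->
  exists2 M : R, (0 <= M)%R & forall f g : borel G -> R, unit_ball mu Psi f -> unit_ball mu Psi g ->
    ebilin (ind O) (fun t => (z t * f t)%:E) (EFin \o g) <= M%:E.
Proof.
move=> zL yT; have [C HC] := unit_ball_min_le mu pairPP iPsi yT.
pose L' := Num.max L 0%R; pose M := (C * C + m * C + m * C)%R.
exists (L' * Num.max M 0)%R; first by rewrite mulr_ge0 ?le_max ?lexx ?orbT.
move=> f g uf ug; have [S [sS fS gS]] := unit_ball_supports uf ug.
have [mf f0 _ _] := uf; have [mg g0 _ _] := ug.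
apply: (@le_trans _ _ (L'%:E * ebilin (ind O) (EFin \o f) (EFin \o g))).
  apply: (ebilin_le sS) => //.
  - by rewrite le_max lexx orbT.
  - by apply/measurable_EFinP; exact: measurable_funM.
  - exact/measurable_EFinP.
  - exact/measurable_EFinP.
  - exact/measurable_EFinP.
  - by move=> s; rewrite lee_fin mulr_ge0.
  - by move=> s /gS /= ->.
  - by move=> s /gS /= ->.
  apply: filterS zL => u zu s.
  rewrite -!EFinM lee_fin /= !mulrA ler_wpM2r// ler_wpM2r// ler_wpM2r//.
  by rewrite le_max zu.
rewrite EFinM lee_wpmul2l ?lee_fin ?le_max ?lexx ?orbT//.
apply: (@le_trans _ _ M%:E); last by rewrite lee_fin le_max lexx.
by apply: (ebilin_bound_min HG inner_mu invariant_mu oO mO m0 sS uf ug fS gS); exact: HC.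
Qed.

(** By definition of the complementary function, [y * (c * z s)] is at most
    [W s + Phi (sqrt y)]; the case [y = x ^+ 2] is what [ebilin_bound_square]
    assumes. *)
Lemma ebilin_unit_ball_bounded_square (c : R) : (0 < c)%R ->
  \int[mu]_s complementary (fun x => Phi (Num.sqrt x)) (c * z s)%R < +oo ->
  exists2 M : R, (0 <= M)%R & forall f g : borel G -> R, unit_ball mu Psi f -> unit_ball mu Psi g ->
    ebilin (ind O) (fun t => (z t * f t)%:E) (EFin \o g) <= M%:E.
Proof.
move=> c0 fin.
pose W s := complementary (fun x => Phi (Num.sqrt x)) (c * z s)%R.
have W0 s : 0 <= W s by apply: complementary_ge0; rewrite sqrtr0; exact: young_0.
have mcz : measurable_fun setT (fun s => c * z s)%R.
  exact: (measurable_funM (@measurable_cst _ _ (borel G) R setT c) mz).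
have cz0 s : (0 <= c * z s)%R by rewrite mulr_ge0// ltW.
have mW : measurable_fun setT W.
  apply: (measurable_nondecreasing_comp (u := fun s => c * z s)%R) => //.
  exact: complementary_nondecreasing.
pose P := fine (\int[mu]_s W s).
have PE : \int[mu]_s W s = P%:E by rewrite fineK// ge0_fin_numE ?integral_ge0.
have P0 : (0 <= P)%R by rewrite fine_ge0// integral_ge0.
have WP s x : (0 <= x)%R -> (x ^+ 2 * (c * z s))%:E <= W s + Phi x.
  move=> x0; rewrite -leeBlDr; last exact: increasing_fin_num.
  apply: ereal_sup_ubound; exists (x ^+ 2)%R.
    by rewrite /= in_itv/= andbT sqr_ge0.
  by rewrite sqrtr_sqr ger0_norm.
exists (c^-1 * (m * (P + 2)))%R.
  by rewrite mulr_ge0 ?invr_ge0 ?(ltW c0)// mulr_ge0 ?(ltW m0)// addr_ge0.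
move=> f g uf ug; have [S [sS fS gS]] := unit_ball_supports uf ug.
have [mf f0 _ _] := uf; have [mg g0 _ _] := ug.
apply: (@le_trans _ _ (c^-1%:E * ebilin (ind O) (fun t => (c * z t * f t)%:E) (EFin \o g))).
  apply: (ebilin_le sS) => //.
  - by rewrite invr_ge0 ltW.
  - by apply/measurable_EFinP; exact: measurable_funM.
  - exact/measurable_EFinP.
  - by apply/measurable_EFinP; exact: measurable_funM.
  - exact/measurable_EFinP.
  - by move=> s; rewrite lee_fin mulr_ge0.
  - by move=> s; rewrite lee_fin mulr_ge0.
  - by move=> s /gS /= ->.
  - by move=> s /gS /= ->.
  apply/nearW => u s.
  by rewrite -!EFinM lee_fin /= !mulrA mulVf ?gt_eqF// mul1r.
rewrite EFinM lee_wpmul2l ?lee_fin ?invr_ge0 ?(ltW c0)//.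
apply: (ebilin_bound_square HG inner_mu invariant_mu oO mO m0 sS pairPP iPhi iPsi mcz cz0 mW W0 WP _ uf ug fS gS).
by rewrite PE.
Qed.

End Bounds.

(** * The kernel *)

Section Kernel.
Variable xi : {additive G -> R[i]}.
Hypothesis mxi : cmeasurable (xi : borel G -> R[i]).
Variables (O : set G) (oO : open O).

(** By submultiplicativity [omega (- u) <= C * omega s * omega (- (u + s))]. With
    [omega (- (u + s))] in the denominator, [xi u] is replaced by [xi_tilde u] at
    the price of the factors [omega u] and [omega s], which are those of the
    weighted norms ([kernel_bound]). *)
Definition kernel_real (s : borel G) : R := (\1_O (s : G) / (1 + omega (- (s : G))))%R.

Definition kernel (s : borel G) : R[i] := (kernel_real s)%:C%C.

Lemma kernel_real_ge0 s : (0 <= kernel_real s)%R.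
Proof. by rewrite divr_ge0// addr_ge0// ltW. Qed.

Lemma measurable_kernel_real : measurable_fun setT kernel_real.
Proof.
have mo : measurable_fun setT (fun s : borel G => 1 + omega (- (s : G)))%R.
  apply: measurable_funD; first exact: measurable_cst.
  exact: (measurableT_comp omega_meas (@measurable_opp G)).
apply: measurable_funM.
  by apply: measurable_indic; exact: measurable_open.
by apply: measurable_inv_pos => // s; exact: addr_gt0.
Qed.

Lemma cmeasurable_kernel : cmeasurable kernel.
Proof. exact: (cmeasurable_real measurable_kernel_real). Qed.

Lemma kernel_out s : ~ O s -> kernel s = 0%R.
Proof. by move=> Os; rewrite /kernel /kernel_real indicE memNset// mul0r. Qed.

Lemma nn_kernel s : nn kernel s = (kernel_real s)%:E.
Proof. by rewrite /nn normc_real ger0_norm// kernel_real_ge0. Qed.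

Local Notation K := (nn kernel).

Let z (s : borel G) : R := normc (xi_tilde omega xi s).

Lemma kernel_bound (C : R) (a x : borel G -> R[i]) (u s : G) :
  (0 < C)%R -> (forall s t, (omega (s + t) <= C * (omega s * omega t))%R) ->
  (nn (xi_mul xi a) u * (K (u + s)%R * nn x s) <=
   C%:E * ((z u * (omega u * normc (a u)))%:E *
     (ind O (u + s)%R * (omega s * normc (x s))%:E)))%E.
Proof.
move=> C0 sub.
have p := mulr_gt0 (omega_gt0 u) (omega_gt0 (- u)%R).
have xiE : normc (xi u) = (z u * (omega u * omega (- u)))%R.
  rewrite /z /xi_tilde normcMr -[X in (_ * X)%R](ger0_norm (ltW p)) -normc_real.
  rewrite -mulrA -normcMr mulVf ?ComplexField.Normc.normc1 ?mulr1//.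
  by apply/eqP => -[] /eqP; rewrite gt_eqF.
rewrite nn_kernel /nn /xi_mul normcMr xiE /ind /kernel_real -!EFinM lee_fin.
have h := sub s (- (u + s))%R.
rewrite opprD addrCA subrr addr0 in h.
have w1 : (0 < 1 + omega (- (u + s)))%R by rewrite addr_gt0.
have h' : (omega (- u) / (1 + omega (- (u + s))) <= C * omega s)%R.
  rewrite ler_pdivrMr//; apply: le_trans (h) _.
  rewrite opprD -!mulrA ler_wpM2l// ?(ltW C0)// ler_wpM2l ?(ltW (omega_gt0 s))//.
  by rewrite lerDr.
have q : (0 <= z u * omega u * normc (a u) * \1_O (u + s)%R * normc (x s))%R.
  by rewrite !mulr_ge0 ?normc_ge0 ?(ltW (omega_gt0 _)).
have := ler_wpM2l q h'.
set w := ((1 + omega (- (u + s)))^-1)%R.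
set i := (\1_O (u + s))%R.
by move=> h2; apply: le_trans (le_trans _ h2) _; rewrite le_eqVlt; apply/orP; left; apply/eqP; ring.
Qed.

Variables (M : R) (M0 : (0 <= M)%R).
Hypothesis zM : forall f g : borel G -> R, unit_ball mu Psi f -> unit_ball mu Psi g ->
    ebilin (ind O) (fun t => (z t * f t)%:E) (EFin \o g) <= M%:E.

Let mz : measurable_fun setT z.
Proof.
apply: cmeasurable_normc; apply: cmeasurableM => //.
have mo : measurable_fun setT (fun s : borel G => omega s * omega (- (s : G)))%R.
  apply: measurable_funM => //.
  exact: (measurableT_comp omega_meas (@measurable_opp G)).
have -> : (fun s : borel G => ((omega s * omega (- (s : G)))%:C%C)^-1)%R =
    (fun s : borel G => ((omega s * omega (- (s : G)))^-1)%:C%C)%R.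
  by apply/funext => s; rewrite fmorphV.
apply: cmeasurable_real.
by apply: measurable_inv_pos => // s; exact: mulr_gt0.
Qed.

Lemma norm_ge0 a : LPhi a -> (0 <= norm a)%R.
Proof.
move=> oa; rewrite -lee_fin -(LPhi_normE oa).
apply: ereal_sup_ubound; exists (fun=> 0%R).
  split; first exact: cmeasurable_cst.
  rewrite integral0_eq// => s _; rewrite normc0.
  have [_ yPsi /(_ 0%R (lexx _)) <-] := pairPP; exact: young_0.
by rewrite integral0_eq// => s _; rewrite mulr0 normc0.
Qed.

Lemma kernel_ebilin_bounded : exists2 B : R, (0 <= B)%R &
  forall a x, LPhi a -> LPhi x ->
    ebilin K (nn (xi_mul xi a)) (nn x) <= (B * norm a * norm x)%:E.
Proof.
have [C C0 sub] := weight_submul womega.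
exists (C * M)%R; first by rewrite mulr_ge0// ltW.
move=> a x oa ox; have ma := L0_cmeasurable a; have mx := L0_cmeasurable x.
have a0 := norm_ge0 oa; have x0 := norm_ge0 ox.
have [S [sS xS]] := LPhi_support ox.
have key (Na Nx : R) : (0 < Na)%R -> (0 < Nx)%R -> (norm a <= Na)%R -> (norm x <= Nx)%R ->
    ebilin K (nn (xi_mul xi a)) (nn x) <= (C * M * Na * Nx)%:E.
  move=> Na0 Nx0 aNa xNx.
  pose f s := (omega s * normc (a s) / Na)%R.
  pose g s := (omega s * normc (x s) / Nx)%R.
  have uf : unit_ball mu Psi f by exact: (LPhi_unit_ball).
  have ug : unit_ball mu Psi g by exact: (LPhi_unit_ball).
  have [mf f0 _ _] := uf; have [mg g0 _ _] := ug.
  apply: (@le_trans _ _ ((C * Na * Nx)%:E * ebilin (ind O) (fun t => (z t * f t)%:E) (EFin \o g))).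
    apply: (ebilin_le sS).
    - by rewrite !mulr_ge0// ltW.
    - exact: (measurable_nn cmeasurable_kernel).
    - exact: (measurable_nn (cmeasurable_xi_mul mxi ma)).
    - exact: measurable_nn.
    - by apply/measurable_EFinP; apply: measurable_indic; exact: measurable_open.
    - by apply/measurable_EFinP; exact: measurable_funM.
    - exact/measurable_EFinP.
    - exact: nn_ge0.
    - exact: nn_ge0.
    - exact: nn_ge0.
    - by move=> s; rewrite lee_fin.
    - by move=> s; rewrite lee_fin mulr_ge0// normc_ge0.
    - by move=> s; rewrite lee_fin.
    - by move=> s /xS; exact: nn_eq0.
    - by move=> s /xS; rewrite /= /g => ->; rewrite normc0 mulr0 mul0r.
    apply/nearW => u s; apply: le_trans (kernel_bound a x u s C0 sub) _.
    rewrite /ind -!EFinM lee_fin /f /g le_eqVlt; apply/orP; left; apply/eqP.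
    by field; rewrite !gt_eqF.
  have := zM uf ug; rewrite (_ : (C * M * Na * Nx)%:E = (C * Na * Nx)%:E * M%:E).
    by move=> h; rewrite lee_wpmul2l// lee_fin !mulr_ge0// ltW.
  by rewrite -EFinM; congr _%:E; ring.
(* The norms may vanish, so they are enlarged by [d] before the functions are
   scaled into the unit ball. *)
have key' d : (0 < d)%R ->
    ebilin K (nn (xi_mul xi a)) (nn x) <= (C * M * (norm a + d) * (norm x + d))%:E.
  by move=> d0; apply: key; rewrite ?ltr_wpDl// lerDl ltW.
have fin := le_lt_trans (key' 1%R ltr01) (ltry _).
have E0 : 0 <= ebilin K (nn (xi_mul xi a)) (nn x).
  apply: integral_ge0 => u _; apply: mule_ge0; first exact: nn_ge0.
  by apply: eform_ge0 => s; exact: nn_ge0.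
rewrite -(fineK (_ : ebilin K _ _ \is a fin_num)) ?ge0_fin_numE// lee_fin.
have B0 : (0 <= C * M)%R by exact: mulr_ge0 (ltW C0) M0.
apply: (le_mulr_limit B0 a0 x0) => d d0.
by rewrite -lee_fin fineK ?ge0_fin_numE//; exact: key'.
Qed.

End Kernel.

(** * The derivation *)

Section KernelDerivation.
Hypothesis alg : LPhi_is_banach_algebra mu Phi omega.
Variable xi : {additive G -> R[i]}.
Hypothesis mxi : cmeasurable (xi : borel G -> R[i]).
Variables (O : set G) (oO : open O) (fO : mu O < +oo).
Variables (kappa : borel G -> R[i]) (mkappa : cmeasurable kappa).
Hypothesis kappaO : forall s, ~ O s -> kappa s = 0%R.
Local Notation K := (nn kappa).
Variable B : R.
Hypothesis kappaB : forall a x, LPhi a -> LPhi x ->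
  ebilin K (nn (xi_mul xi a)) (nn x) <= (B * norm a * norm x)%:E.

Implicit Types a b c x y : L0 mu.

(** The pairing of [kappa] with the convolution of [xi a] and [x]. *)
Definition kernel_derivation a x : R[i] := cbilin kappa (xi_mul xi a) x.
Local Notation D := kernel_derivation.

Let mL a : cmeasurable a := L0_cmeasurable a.
Let mxL a : cmeasurable (xi_mul xi a) := cmeasurable_xi_mul mxi (mL a).

Let support a : LPhi a -> exists S, sigma_open mu S /\ forall s, ~ S s -> a s = 0%R.
Proof. by move=> oa; exact: (LPhi_support oa). Qed.

Let supports a b : LPhi a -> LPhi b -> exists S, [/\ sigma_open mu S,
  forall s, ~ S s -> a s = 0%R & forall s, ~ S s -> b s = 0%R].
Proof.
move=> /support[S [sS aS]] /support[T [sT bT]]; exists (S `|` T).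
by split; [exact: sigma_openU|exact: supportedUl|exact: supportedUr].
Qed.

Let LPhiM a b : LPhi a -> LPhi b -> LPhi (convolution mu a b).
Proof. by case: alg => _ /ba_mul; apply. Qed.

Let fin a x : LPhi a -> LPhi x -> ebilin K (nn (xi_mul xi a)) (nn x) < +oo.
Proof. by move=> oa ox; exact: le_lt_trans (kappaB oa ox) (ltry _). Qed.

Lemma ae_eq_eform (k b b' : borel G -> \bar R) u :
  measurable_fun setT k -> measurable_fun setT b -> measurable_fun setT b' ->
  (forall s, 0 <= k s) -> (forall s, 0 <= b s) -> (forall s, 0 <= b' s) ->
  {ae mu, forall s, b s = b' s} -> eform k b u = eform k b' u.
Proof.
move=> mk mb mb' k0 b0 b0' bb'; apply: ge0_ae_eq_integral => //.
- exact: (measurable2_section1 u (measurable2_eform mk mb)).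
- exact: (measurable2_section1 u (measurable2_eform mk mb')).
- by move=> s _; exact: mule_ge0.
- by move=> s _; exact: mule_ge0.
- by apply: filterS bb' => s -> _.
Qed.

(** The triple integral is the form of [a] and of the convolution of [|x|] and
    [|c|], an element of the algebra. *)
Lemma ebilin_triple_fin a c x : LPhi a -> LPhi c -> LPhi x ->
  ebilin (eform K (nn c)) (nn (xi_mul xi a)) (nn x) < +oo.
Proof.
move=> oa oc ox.
have ox' := LPhi_abs ox.
have oc' := LPhi_abs oc.
have [S [sS xS]] := support ox'; have [T [sT cT]] := support oc'.
have yE : convolution_spec mu (L0_abs x) (L0_abs c)
    (convolution mu (L0_abs x) (L0_abs c)).
  by case: alg => conv _; exact: conv.
have E1 u : eform K (nn (L0_abs c)) u = eform K (nn c) u.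
  apply: ae_eq_eform; try exact: measurable_nn; try exact: nn_ge0; exact: L0_abs_nn.
have mKc : measurable_fun setT (eform K (nn (L0_abs c))).
  exact: (measurable_eformK HG inner_mu mkappa sT).
have E2 u : eform (eform K (nn (L0_abs c))) (nn (L0_abs x)) u =
    eform (eform K (nn c)) (nn x) u.
  rewrite (_ : eform K (nn c) = eform K (nn (L0_abs c))); last first.
    by apply/funext => s; rewrite E1.
  apply: ae_eq_eform => //; try exact: measurable_nn; try exact: nn_ge0; try exact: L0_abs_nn.
  by move=> s; exact: eformK_ge0.
apply: le_lt_trans (fin oa (LPhiM ox' oc')); rewrite le_eqVlt; apply/orP; left; apply/eqP.
apply: eq_integral => u _; congr (_ * _).
rewrite (eform_positive_convolution HG inner_mu invariant_mu oO fO mkappa kappaO u sS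
  (mL _) (mL _) (mL _) xS (L0_abs_nonneg _) (L0_abs_nonneg _) yE).
by rewrite E2.
Qed.

Lemma kernel_derivation_bounded a x : LPhi a -> LPhi x ->
  (normc (D a x) <= 4 * B * norm a * norm x)%R.
Proof.
move=> oa ox; have [S [sS aS xS]] := supports oa ox.
have xaS := xi_mul_supp xi aS.
have i := cbilin_cintegrable HG inner_mu sS mkappa (mxL a) (mL x) xaS xS (fin oa ox).
rewrite -lee_fin; apply: (le_trans (normc_cintegral_le i)).
rewrite (_ : (4 * B * norm a * norm x)%:E = 2%:E * (2%:E * (B * norm a * norm x)%:E)); last first.
  by rewrite -!EFinM; congr _%:E; ring.
rewrite lee_wpmul2l ?lee_fin//.
apply: (@le_trans _ _ (2%:E * ebilin K (nn (xi_mul xi a)) (nn x))); last first.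
  by rewrite lee_wpmul2l ?lee_fin//; exact: kappaB.
have mK := measurable_nn mkappa.
have me := measurable_eformK HG inner_mu mkappa sS (mL x) xS.
rewrite /ebilin -ge0_integralZl//; last 2 first.
- by apply: emeasurable_funM => //; exact: measurable_nn.
- by move=> u _; apply: mule_ge0; [exact: nn_ge0|exact: eformK_ge0].
apply: ge0_le_integral => //.
- by move=> u _; rewrite lee_fin normc_ge0.
- apply/measurable_EFinP; apply: cmeasurable_normc.
  exact: (cintegrable_cmeasurable i).
- by apply: measurable_funeM; apply: emeasurable_funM => //; exact: measurable_nn.
- move=> u _; rewrite normcMr EFinM muleCA lee_wpmul2l ?lee_fin ?normc_ge0//.
  exact: (nn_le_cform mu mkappa u (mL x)).
Qed.

Lemma kernel_derivation_linearr (l : R[i]) a x y : LPhi a -> LPhi x -> LPhi y ->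
  LPhi (l *: x + y)%R -> D a (l *: x + y)%R = (l * D a x + D a y)%R.
Proof.
move=> oa ox oy oxy; have [S [sS aS xS]] := supports oa ox.
have [T [sT yT xyT]] := supports oy oxy.
have sST := sigma_openU sS sT.
have xaS := xi_mul_supp xi aS.
have ci v : LPhi v -> supported (S `|` T) v -> _ :=
  fun ov vS => cbilin_cintegrable HG inner_mu sST mkappa (mxL a) (mL v) (supportedUl xaS) vS (fin oa ov).
have ix := ci x ox (supportedUl xS); have iy := ci y oy (supportedUr yT); have ixy := ci _ oxy (supportedUr xyT).
have lix := cintegrableZ l ix.
rewrite /D /cbilin -(cintegralZ l ix) -(cintegralD lix iy).
apply: ae_eq_cintegral.
- exact: (cintegrable_cmeasurable ixy).
- exact: (cintegrable_cmeasurable (cintegrableD lix iy)).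
have aef v : LPhi v -> supported (S `|` T) v ->
    {ae mu, forall u, xi_mul xi a u = 0%R \/ eform K (nn v) u < +oo}.
  move=> ov vS.
  have h := ae_finite_or_zero (measurable_nn (mxL a))
    (measurable_eformK HG inner_mu mkappa sST (mL v) vS) (nn_ge0 _)
    (fun s => eformK_ge0 mu kappa v s) (fin oa ov).
  by apply: filterS h => s [/nn_eq0P|]; [left|right].
apply: filterS2 (aef x ox (supportedUl xS)) (aef y oy (supportedUr yT)) => u [->|fx].
  by move=> _; rewrite !mul0r mulr0 addr0.
move=> [->|fy]; first by rewrite !mul0r mulr0 addr0.
have [jx _] := le_normc_cform mkappa (mL x) fx.
have [jy _] := le_normc_cform mkappa (mL y) fy.
have -> : cform kappa (L0_fun (l *: x + y)%R) u = (l * cform kappa x u + cform kappa y u)%R.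
  have ljx := cintegrableZ l jx.
  rewrite /cform -(cintegralZ l jx) -(cintegralD ljx jy).
  apply: ae_eq_cintegral.
  - exact: (cmeasurable2_section1 (F := fun u s : G => kappa (u + s) * L0_fun (l *: x + y) s)%R u
      (cmeasurable2_cform mkappa (mL _))).
  - exact: (cintegrable_cmeasurable (cintegrableD ljx jy)).
  apply: filterS (L0_linear l x y) => s ->.
  by rewrite mulrDr mulrCA.
by rewrite mulrDr mulrCA.
Qed.

Lemma kernel_derivation_linearl (l : R[i]) a b x : LPhi a -> LPhi b -> LPhi x ->
  LPhi (l *: a + b)%R -> D (l *: a + b)%R x = (l * D a x + D b x)%R.
Proof.
move=> oa ob ox oab; have [S [sS aS xS]] := supports oa ox.
have [T [sT bT abT]] := supports ob oab.
have sST := sigma_openU sS sT.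
have ci v : LPhi v -> supported (S `|` T) v -> _ :=
  fun ov vS => cbilin_cintegrable HG inner_mu sST mkappa (mxL v) (mL x)
    (xi_mul_supp xi vS) (supportedUl xS) (fin ov ox).
have ia := ci a oa (supportedUl aS); have ib := ci b ob (supportedUr bT); have iab := ci _ oab (supportedUr abT).
have lia := cintegrableZ l ia.
rewrite /D /cbilin -(cintegralZ l ia) -(cintegralD lia ib).
apply: ae_eq_cintegral.
- exact: (cintegrable_cmeasurable iab).
- exact: (cintegrable_cmeasurable (cintegrableD lia ib)).
apply: filterS (L0_linear l a b) => s; rewrite /xi_mul => ->; ring.
Qed.

Lemma kernel_derivation_leibniz a b x : LPhi a -> LPhi b -> LPhi x ->
  D (convolution mu a b) x =
  (D b (convolution mu x a) + D a (convolution mu b x))%R.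
Proof.
move=> oa ob ox; have [conv _] := alg.
have oh := LPhiM oa ob; have ok := LPhiM ob ox; have ol := LPhiM ox oa.
have [S1 [s1 aS bS]] := supports oa ob.
have [S2 [s2 xS hS]] := supports ox oh.
have [S3 [s3 kS lS]] := supports ok ol.
have sS := sigma_openU (sigma_openU s1 s2) s3.
pose w1 (f : borel G -> R[i]) (fS : supported S1 f) := supportedUl (S' := S3) (supportedUl (S' := S2) fS).
pose w2 (f : borel G -> R[i]) (fS : supported S2 f) := supportedUl (S' := S3) (supportedUr (S' := S1) fS).
pose w3 (f : borel G -> R[i]) (fS : supported S3 f) := supportedUr (S' := S1 `|` S2) fS.
apply: (cbilin_leibniz HG inner_mu invariant_mu oO fO mkappa kappaO sS mxi
  (mL a) (mL b) (mL x) (mL _) (mL _) (mL _)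
  (w1 _ aS) (w1 _ bS) (w2 _ xS) (w2 _ hS) (w3 _ kS) (w3 _ lS)
  (conv _ _ oa ob) (conv _ _ ob ox) (conv _ _ ox oa)).
- exact: ebilin_triple_fin.
- exact: ebilin_triple_fin.
- exact: fin.
Qed.

Lemma kernel_derivationP (A : set (L0 mu)) : A `<=` LPhi ->
  bounded_derivation A norm (convolution mu) D.
Proof.
move=> AL.
have lin (l : R[i]) u v : LPhi u -> LPhi v -> LPhi (l *: u + v)%R.
  by case: alg => _ /ba_linear; apply.
split.
- move=> a /AL oa; split.
    by move=> l x y /AL ox /AL oy; apply: kernel_derivation_linearr => //; exact: lin.
  exists (4 * B * norm a)%R => x /AL ox; exact: kernel_derivation_bounded.
- by move=> l a b x /AL oa /AL ob /AL ox; apply: kernel_derivation_linearl => //; exact: lin.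
- by exists (4 * B)%R => a x /AL oa /AL ox; exact: kernel_derivation_bounded.
- by move=> a b x /AL oa /AL ob /AL ox; exact: kernel_derivation_leibniz.
Qed.

End KernelDerivation.

(** * The test function *)

Section TestFunction.
Variables (U : set G) (oU : open U) (fU : mu U < +oo).

Definition test_real (s : borel G) : R := (\1_U (s : G) / omega s)%R.

Lemma measurable_test_real : measurable_fun setT test_real.
Proof.
apply: measurable_funM.
  by apply: measurable_indic; exact: measurable_open.
by apply: measurable_inv_pos => //; exact: (weight_measurable womega).
Qed.

Lemma test_cmfun : (fun s => (test_real s)%:C%C) \in @cmfun _ (borel G) R.
Proof. by rewrite inE; apply: cmeasurable_real; exact: measurable_test_real. Qed.

(** Its product with the weight is a step function, the indicator function of
    [U]. *)
Definition test_function : L0 mu := \pi_(L0 mu) (CMeasurableFun test_cmfun).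

Lemma test_functionE : {ae mu, forall s, test_function s = (test_real s)%:C%C}.
Proof. exact: L0_funK. Qed.

Local Notation indc := (fun s : borel G => (\1_U (s : G) : R)%:C%C).

Let mindc : cmeasurable indc.
Proof. by apply: cmeasurable_real; apply: measurable_indic; exact: measurable_open. Qed.

Let weighted_test : {ae mu, forall s,
  weighted (omega : borel G -> R) test_function s = indc s}.
Proof.
apply: filterS test_functionE => s; rewrite /weighted => ->.
by rewrite -rmorphM /test_real mulrCA mulfV ?mulr1// gt_eqF.
Qed.

Lemma orlicz_ind : orlicz mu Phi indc.
Proof.
split; first exact: mindc.
exists 1%R => //.
rewrite (_ : \int[mu]_s _ = Phi 1%R * mu U).
  by rewrite lte_mul_pinfty ?young_ge0// increasing_fin_num.
rewrite -[X in mu X]setIT -integral_indic//; last exact: measurable_open.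
rewrite -ge0_integralZl//; last 2 first.
- by apply/measurable_EFinP; apply: measurable_indic; exact: measurable_open.
- by rewrite young_ge0.
apply: eq_integral => s _; rewrite normc_real ger0_norm// mul1r.
rewrite indicE; case: (_ \in U); rewrite ?mule1// mule0; exact: young_0.
Qed.

Lemma step_ind : step indc.
Proof.
split; first exact: mindc.
apply: (@sub_finite_set _ _ [set 0%R; 1%R]); last exact: finite_set2.
move=> _ [s _ <-]; rewrite indicE; case: (_ \in U); [by right|by left].
Qed.

Lemma test_function_SPhi : SPhi_weighted mu Phi omega test_function.
Proof.
have mw : cmeasurable (weighted (omega : borel G -> R) test_function).
  apply: cmeasurableM; last exact: L0_cmeasurable.
  by apply: cmeasurable_real; exact: (weight_measurable womega).
split.
  apply: (orlicz_ae orlicz_ind mw).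
  by apply: filterS weighted_test => s ->.
move=> e e0; exists indc; split; [exact: step_ind|exact: orlicz_ind|].
apply: le_lt_trans (_ : 0 < e%:E) => //.
apply: ge_ereal_sup => _ [v [mv _] <-]; rewrite le_eqVlt; apply/orP; left; apply/eqP.
transitivity (\int[mu]_s (cst 0 s : \bar R)); last by rewrite integral0.
apply: ge0_ae_eq_integral => //.
- apply/measurable_EFinP; apply: cmeasurable_normc; apply: cmeasurableM => //.
  rewrite (_ : (_ \- _)%R = fun s => ( weighted (omega : borel G -> R) test_function s + (-1) * indc s)%R).
    by apply: cmeasurableD => //; apply: cmeasurableM => //; exact: cmeasurable_cst.
  by apply/funext => s; rewrite mulN1r.
- by move=> s _; rewrite lee_fin normc_ge0.
- apply: filterS weighted_test => s ws _.
  by rewrite /= ws subrr mul0r normc0.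
Qed.

End TestFunction.

End WeightedOrlicz.

(** * Failure of weak amenability *)

Unset Implicit Arguments.
Set Strict Implicit.
Set Printing Implicit Defensive.

Theorem theorem3p3 (R : realType) (G : topologicalZmodType)
    (mu : {measure set (borel G) -> \bar R}) (omega : G -> R)
    (Phi Psi : R -> \bar R) (xi : {additive G -> R[i]}) :
  hausdorff_space G -> locally_compact [set: G] ->
  haar_measure mu -> weight mu omega ->
  complementary_pair Phi Psi ->
  {within `[0, +oo[, continuous Phi} -> increasing_on_nonneg Phi ->
  {within `[0, +oo[, continuous Psi} -> increasing_on_nonneg Psi ->
  (exists s, xi s != 0) -> continuous (xi : G -> R[i]^o) ->
  cLinfty mu (xi_tilde omega xi) ->
  LPhi_is_banach_algebra mu Phi omega ->
  young (fun x => Psi (Num.sqrt x)) \/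
  (young (fun x => Phi (Num.sqrt x)) /\
   orlicz mu (complementary (fun x => Phi (Num.sqrt x)))
     (xi_tilde omega xi)) ->
  ~ weakly_amenable (LPhi_weighted mu Phi omega)
      (norm_Phi_weighted mu Phi omega) (convolution mu) /\
  ~ weakly_amenable (SPhi_weighted mu Phi omega)
      (norm_Phi_weighted mu Phi omega) (convolution mu).
Proof.
move=> HG lcG haar womega pairPP _ iPhi _ iPsi [t0 xit0] cxi xiL alg cases.
have omega_gt0 := weight_gt0 womega.
have momega : measurable_fun [set: borel G] (omega : borel G -> R) := weight_measurable womega.
have [mxit _] := xiL.
have mxi : cmeasurable (xi : borel G -> R[i]).
  rewrite (_ : (xi : borel G -> R[i]) = fun s : borel G =>
      xi_tilde omega xi s * (omega s * omega (- (s : G)))%:C%C).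
    apply: cmeasurableM => //; apply: cmeasurable_real; apply: measurable_funM => //.
    exact: (measurableT_comp momega (@measurable_opp G)).
  apply/funext => s; rewrite /xi_tilde divfK//.
  by apply/eqP => -[] /eqP; rewrite gt_eqF// mulr_gt0.
have [ O [oO Ot0 fO]] := haar_finite_nbhs lcG haar (t0 + t0).
have mu0 := haar_open_gt0 HG haar oO Ot0.
pose m := fine (mu O).
have mO : mu O = m%:E by rewrite fineK// ge0_fin_numE.
have m0 : 0 < m by rewrite -lte_fin -mO.
pose z (s : borel G) : R := normc (xi_tilde omega xi s).
have mz : measurable_fun setT z by exact: cmeasurable_normc.
have z0 s : 0 <= z s by exact: normc_ge0.
have [M M0 zM] : exists2 M : R, 0 <= M & forall f g : borel G -> R,
    unit_ball mu Psi f -> unit_ball mu Psi g ->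
    (ebilin mu (ind O) (fun t => (z t * f t)%:E) (EFin \o g) <= M%:E)%E.
  case: cases => [yT|[yT [_ [c c0 cfin]]]].
    have [L zL] := cLinfty_bound xiL.
    exact: (ebilin_unit_ball_bounded_min HG haar pairPP iPsi oO mO m0 mz z0 zL yT).
  exact: (ebilin_unit_ball_bounded_square HG haar pairPP iPhi iPsi oO mO m0 mz z0 c0 cfin).
have [B B0 kB] := kernel_ebilin_bounded HG haar pairPP iPhi womega mxi oO M0 zM.
pose kappa := kernel omega O.
have mk : cmeasurable kappa by exact: (cmeasurable_kernel womega oO).
have derivation := kernel_derivationP HG haar pairPP iPhi womega alg mxi oO fO mk
  (@kernel_out _ _ omega O) kB.
have [V [oV Vt0 fV]] := haar_finite_nbhs lcG haar t0.
(* near [t0], the product [conj (xi t0) * xi t] has positive real part *)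
pose near0 := [set t : G | normc (xi t0 - xi t) < normc (xi t0)].
have near0P : nbhs t0 near0.
  have e0 : 0 < `|xi t0| :> R[i] by rewrite normr_gt0.
  apply: (@filterS _ _ (nbhs_filter t0) _ _ _
    (@cvgr_dist_lt _ R[i]^o G (nbhs t0) (nbhs_filter t0) xi (xi t0) (cxi t0) _ e0)) => t.
  by rewrite !normc_def /near0 /= ltcR; case: (xi t0) => ? ?; case: (xi t).
pose U := interior near0 `&` V.
have oU : open U by apply: openI => //; exact: open_interior.
have Ut0 : U t0 by split.
have fU : (mu U < +oo)%E.
  apply: le_lt_trans fV; apply: le_measure; rewrite ?inE; try exact: measurable_open.
  exact: subIsetr.
have aS := test_function_SPhi pairPP iPhi womega oU fU.
set a := test_function womega oU in aS.
have aL : LPhi_weighted mu Phi omega a by case: aS.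
have Da : kernel_derivation xi kappa a a <> 0.
  have [S [sS aS0]] := LPhi_support haar pairPP iPhi womega aL.
  apply: (cbilin_nonzero HG haar mxi oO oU Ot0 Ut0 mk _ _ _ (L0_cmeasurable a)
    (measurable_test_real womega oU) _ _ _ (test_functionE womega oU) sS aS0).
  - by move=> s; rewrite normc_real ger0_norm//; exact: (kernel_real_ge0 womega).
  - move=> s Os; rewrite normc_real gtr0_norm.
      by rewrite /kernel_real indicE mem_set// divr_gt0// addr_gt0.
    by rewrite /kernel_real indicE mem_set// divr_gt0// addr_gt0.
  - by move=> t [/interior_subset + _]; exact: Re_conj_mul_gt0.
  - by move=> s; rewrite divr_ge0// ltW.
  - by move=> s Us; rewrite /test_real indicE mem_set// divr_gt0.
  - by move=> s Us; rewrite /test_real indicE memNset// mul0r.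
  - exact: le_lt_trans (kB _ _ aL aL) (ltry _).
(* an inner derivation vanishes on the diagonal *)
have notinner A : A `<=` LPhi_weighted mu Phi omega -> A a ->
    ~ weakly_amenable A (norm_Phi_weighted mu Phi omega) (convolution mu).
  move=> AL Aa /(_ _ (derivation A AL))[phi _ Dphi]; apply: Da.
  by rewrite (Dphi a a Aa Aa) subrr.
by split; apply: notinner => // f [].
Qed.
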